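(* Let $n\geq 1$ be an integer and let $\mathbb{K}=\mathbb{Q}(\sqrt{-m})\subseteq\mathbb{C}$, with $m\in\mathbb{N}$ squarefree, be an imaginary-quadratic number field with ring of integers $\mathcal{O}_{\mathbb{K}}$ and discriminant $d_{\mathbb{K}}$. (a) The set $$\Delta_{n,\mathbb{K}}^{*}:=\left\{\tfrac1u L\in SU(n,n;\mathbb{C})\;;\; L\in\mathcal{O}_{\mathbb{K}}^{2n\times 2n},\ 0\neq u\in\mathbb{C},\ u^n\in\mathcal{O}_{\mathbb{K}},\ u^n\mathcal{O}_{\mathbb{K}}=\mathcal{I}(L)^n\right\}$$ is a subgroup of $SU(n,n;\mathbb{C})$ containing $\Gamma_n(\mathcal{O}_{\mathbb{K}})$. (b) The map $$\Delta_{n,\mathbb{K}}^{*}\to \mathcal{C}\ell_{\mathbb{K}}[n],\qquad M=\tfrac1u L\mapsto[\mathcal{I}(L)],$$ (where $M=\frac1u L$ is any representation as in the definition of $\Delta_{n,\mathbb{K}}^{*}$) is a surjective homomorphism of groups. If $d_{\mathbb{K}}\neq -3,-4$, its kernel is equal to $$\{\varepsilon M\;;\;\varepsilon\in\mathbb{C},\ \varepsilon^{2n}=1,\ M\in\Gamma_n(\mathcal{O}_{\mathbb{K}})\}.$$ (c) The group $\Delta_{n,\mathbb{K}}^{*}$ is the maximal discrete extension of $\Gamma_n(\mathcal{O}_{\mathbb{K}})$ in $SU(n,n;\mathbb{C})$ and coincides with the normalizer of $\Gamma_n(\mathcal{O}_{\mathbb{K}})$ in $SU(n,n;\mathbb{C})$.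 If $d_{\mathbb{K}}\neq -3,-4$, the factor group $\Delta_{n,\mathbb{K}}^{*}/\Gamma_n(\mathcal{O}_{\mathbb{K}})$ is isomorphic to $\mathcal{C}_n\times\mathcal{C}\ell_{\mathbb{K}}[n]$.
   Context: $SU(n,n;\mathbb{C})$ is the group of all $M\in SL_{2n}(\mathbb{C})$ with $\overline{M}^{tr}JM=J$, where $J=\begin{pmatrix}0&-I\\ I&0\end{pmatrix}$ with $n\times n$ blocks and $I$ the identity matrix. The Hermitian modular group of degree $n$ is $\Gamma_n(\mathcal{O}_{\mathbb{K}}):=SU(n,n;\mathbb{C})\cap\mathcal{O}_{\mathbb{K}}^{2n\times 2n}$. For a matrix $L\in\mathcal{O}_{\mathbb{K}}^{2n\times 2n}$, $\mathcal{I}(L)$ denotes the ideal of $\mathcal{O}_{\mathbb{K}}$ generated by the entries of $L$. $\mathcal{C}\ell_{\mathbb{K}}$ is the ideal class group of $\mathbb{K}$, $[\mathcal{A}]$ is the class of a fractional ideal $\mathcal{A}$, and $\mathcal{C}\ell_{\mathbb{K}}[n]=\{[\mathcal{A}]\in\mathcal{C}\ell_{\mathbb{K}};\ [\mathcal{A}]^n=[\mathcal{O}_{\mathbb{K}}]\}$ is its $n$-torsion subgroup. $\mathcal{C}_n$ is a cyclic group of order $n$. ''Maximal discrete extension of $\Gamma$ in $G$'' means the discrete subgroup of $G$ that contains $\Gamma$ and contains every discrete subgroup of $G$ containing $\Gamma$. *)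

(* Defs.v *)
From HB Require Import structures.
From mathcomp Require Import all_boot all_order all_algebra all_fingroup.
From mathcomp Require Import all_solvable.
From mathcomp Require Import complex.
From mathcomp Require Import boolp classical_sets functions reals.
From mathcomp Require Import topology normedtype.

Set Implicit Arguments.
Unset Strict Implicit.
Unset Printing Implicit Defensive.

Import Order.TTheory GRing.Theory Num.Theory.
Import numFieldNormedType.Exports.

Local Open Scope classical_set_scope.
Local Open Scope ring_scope.

(* The type ascription makes the Euclidean topology of R[i], and hence of     *)
(* the matrices over it, available by inference.                              *)
Definition Cplx (R : realType) : numClosedFieldType := R[i].

(* Groups and ideal classes are presented as sets of elements of an ambient   *)
(* type, with the group law given on that type.                               *)

Definition is_hom (T U : Type) (A : set T) (opT : T -> T -> T)
    (opU : U -> U -> U) (f : T -> U) : Prop :=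
  forall x y, A x -> A y -> f (opT x y) = opU (f x) (f y).

Definition isomorphic (T U : Type) (A : set T) (opT : T -> T -> T)
    (B : set U) (opU : U -> U -> U) : Prop :=
  exists f : T -> U, set_bij A B f /\ is_hom A opT opU f.

Definition prod_op (T U : Type) (opT : T -> T -> T) (opU : U -> U -> U)
    (x y : T * U) : T * U := (opT x.1 y.1, opU x.2 y.2).

(* 0 is excluded, being divisible by every square. *)
Definition squarefree (m : nat) : Prop :=
  forall k : nat, (k ^ 2 %| m)%N -> k = 1%N.

(* The field Q(sqrt(-m)) as a subset of the complex numbers. *)
Definition imquad (R : realType) (m : nat) : set (Cplx R) :=
  [set z | exists a b : rat, z = ratr a + ratr b * sqrtC (- m%:R)].

Definition ringO (R : realType) (m : nat) : set (Cplx R) :=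
  [set z | imquad m z /\ integralOver (fun k : int => k%:~R : Cplx R) z].

Definition integral_basis (R : realType) (m : nat) (w1 w2 : Cplx R) : Prop :=
  [/\ ringO m w1, ringO m w2 &
    forall z, ringO m z ->
      exists! c : int * int, z = c.1%:~R * w1 + c.2%:~R * w2].

(* The two embeddings of the field are the inclusion and its complex          *)
(* conjugate, so the discriminant is the square of det (w1, w2; w1^*, w2^* ). *)
Definition is_discriminant (R : realType) (m : nat) (d : int) : Prop :=
  exists w1 w2 : Cplx R, integral_basis m w1 w2 /\
    d%:~R = (w1 * w2^* - w2 * w1^*) ^+ 2.

Definition submoduleO (R : realType) (m : nat) (A : set (Cplx R)) : Prop :=
  [/\ A 0, forall x y, A x -> A y -> A (x + y) &
    forall a x, ringO m a -> A x -> A (a * x)].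

Definition generated (R : realType) (m : nat) (S : set (Cplx R)) :
    set (Cplx R) := smallest (@submoduleO R m) S.

Definition dilate (R : realType) (z : Cplx R) (A : set (Cplx R)) :
    set (Cplx R) := [set z * x | x in A].

Definition fractional_ideal (R : realType) (m : nat) (A : set (Cplx R)) :
    Prop :=
  [/\ submoduleO m A, A `<=` imquad m, exists2 x, A x & x != 0 &
    exists a, [/\ ringO m a, a != 0 & dilate a A `<=` ringO m]].

Definition ideal_mul (R : realType) (m : nat) (A B : set (Cplx R)) :
    set (Cplx R) := generated m [set x * y | x in A & y in B].

Definition ideal_pow (R : realType) (m : nat) (A : set (Cplx R)) (n : nat) :
    set (Cplx R) := iter n (ideal_mul m A) (ringO m).

Definition ideal_class (R : realType) (m : nat) (A : set (Cplx R)) :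
    set (set (Cplx R)) :=
  [set B | exists z, [/\ imquad m z, z != 0 & B = dilate z A]].

Definition class_group (R : realType) (m : nat) : set (set (set (Cplx R))) :=
  [set ideal_class m A | A in fractional_ideal m].

Definition class_one (R : realType) (m : nat) : set (set (Cplx R)) :=
  ideal_class m (ringO m).

(* The elementwise product of the classes of A and B is the class of A B. *)
Definition class_mul (R : realType) (m : nat) (X Y : set (set (Cplx R))) :
    set (set (Cplx R)) := [set ideal_mul m A B | A in X & B in Y].

Definition class_pow (R : realType) (m : nat) (X : set (set (Cplx R)))
    (n : nat) : set (set (Cplx R)) := iter n (class_mul m X) (class_one m).

Definition class_torsion (R : realType) (m n : nat) :
    set (set (set (Cplx R))) :=
  [set X | class_group m X /\ class_pow m X n = class_one m].

Definition subgroup_of (R : realType) (k : nat) (G H : set 'M[Cplx R]_k) :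
    Prop :=
  [/\ H `<=` G, H 1%:M, forall M N, H M -> H N -> H (M *m N) &
    forall M, H M -> H (invmx M)].

Definition discrete_set (T : topologicalType) (A : set T) : Prop :=
  A `<=` isolated A.

Definition mx_set_mul (R : realType) (k : nat) (A B : set 'M[Cplx R]_k) :
    set 'M[Cplx R]_k := [set M *m N | M in A & N in B].

(* Carrier of G / H; for H normal in G its group law is mx_set_mul. *)
Definition mx_cosets (R : realType) (k : nat) (G H : set 'M[Cplx R]_k) :
    set (set 'M[Cplx R]_k) := [set [set M *m N | N in H] | M in G].

Definition mx_normalizer (R : realType) (k : nat) (G H : set 'M[Cplx R]_k) :
    set 'M[Cplx R]_k :=
  [set M | G M /\ [set M *m N *m invmx M | N in H] = H].

Definition maximal_discrete_extension (R : realType) (k : nat)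
    (G H D : set 'M[Cplx R]_k) : Prop :=
  [/\ subgroup_of G D, discrete_set D, H `<=` D &
    forall E, subgroup_of G E -> discrete_set E -> H `<=` E -> E `<=` D].

Definition mxJ (R : realType) (n : nat) : 'M[Cplx R]_(n + n) :=
  block_mx 0 (- 1%:M) 1%:M 0.

Definition SU (R : realType) (n : nat) : set 'M[Cplx R]_(n + n) :=
  [set M | \det M = 1 /\ (map_mx Num.conj M)^T *m mxJ R n *m M = mxJ R n].

Definition integral_mx (R : realType) (m k : nat) : set 'M[Cplx R]_k :=
  [set L | forall i j, ringO m (L i j)].

Definition hermitian_modular (R : realType) (m n : nat) :
    set 'M[Cplx R]_(n + n) := @SU R n `&` @integral_mx R m (n + n).

Definition entry_ideal (R : realType) (m k : nat) (L : 'M[Cplx R]_k) :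
    set (Cplx R) := generated m [set x | exists i j, x = L i j].

Definition Delta_rep (R : realType) (m n : nat) (L : 'M[Cplx R]_(n + n))
    (u : Cplx R) : Prop :=
  [/\ @integral_mx R m (n + n) L, u != 0, ringO m (u ^+ n),
      dilate (u ^+ n) (ringO m) = ideal_pow m (entry_ideal m L) n &
      @SU R n (u^-1 *: L)].

Definition Delta (R : realType) (m n : nat) : set 'M[Cplx R]_(n + n) :=
  [set M | exists L u, Delta_rep m L u /\ M = u^-1 *: L].

Arguments SU : clear implicits.
Arguments hermitian_modular : clear implicits.
Arguments Delta : clear implicits.
Arguments class_torsion : clear implicits.
Arguments class_one : clear implicits.

(* Main.v *)
From Pilot Require Import Defs.
From HB Require Import structures.
From mathcomp Require Import all_boot all_order all_algebra all_fingroup.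
From mathcomp Require Import all_solvable all_field.
From mathcomp Require Import complex.
From mathcomp Require Import boolp classical_sets functions reals.
From mathcomp Require Import topology normedtype.
From mathcomp Require Import ring lra zify.
(* Re-imported because all_fingroup has its own [generated]. *)
Import Pilot.Defs.

Set Implicit Arguments.
Unset Strict Implicit.
Unset Printing Implicit Defensive.

Import Order.TTheory GRing.Theory Num.Theory.
Import numFieldNormedType.Exports.

Local Open Scope classical_set_scope.
Local Open Scope ring_scope.

(** Write M = L/u with L integral. Since |u|^2 and u^n lie in K, membership in
    Delta is equivalent to two integrality conditions on the entries of the
    unitary matrix M: all products x y^* of two entries lie in O, and all
    n-fold products of entries lie in O. The second condition follows from the
    first one. Multiplying M by a translation of Gamma makes the determinant r
    of its upper left block nonzero; r is real and r^2 is an integer, and if r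
    were irrational, a prime p of odd valuation in r^2 would be ramified, so
    conjugation is trivial mod the prime above p and M reduces, up to a scalar,
    to a symplectic similitude over F_p; a suitable translation then gives an
    upper left determinant prime to p, whose product with r is an integer.

    The first condition is detected by the unitary transvections
    tau_w = 1 + w w^* J with w isotropic: it suffices that y y^* is integral
    for y = M x, x real and integral. For the normalizer this is immediate, as
    tau_y lies in Gamma. In a discrete group E containing Gamma, Shimizu's
    lemma says that |<v, w>| is 0 or at least 1 when tau_v and tau_w lie in E.
    With Dirichlet approximation this forces the ratios of the entries of y
    and the squares |<y, x>|^2 into K, and a recursion with fast growing
    denominators forces the latter to be integers.

    For the surjectivity in (b), let A = (a, b) be an ideal with A^n = z O and
    let u^n = z. A bidiagonal matrix P over A with determinant z gives the
    block diagonal matrix with blocks P/u and the adjoint inverse of P/u.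

    The quotient Delta/Gamma is abelian of exponent n and contains a cyclic
    group of order n coming from scalars; the latter has a complement. *)

(** * The field and its ring of integers *)

(** The two integrality conditions remove the choice of L and u. They pass to products and, since
    the inverse of a unitary matrix has the conjugated entries up to sign and position, to inverses.
    Transvections enter because tau_w - 1 displays the outer product of w entry by entry and
    conjugation by M sends tau_w to tau_(M w); real vectors are always isotropic, so they supply
    enough test vectors in Gamma. The obstacle in the discrete case is that nothing ties the entries
    of E to K: discreteness only yields gaps between values, so rationality over K has to come
    before integrality. Integrality of y y^* is then recovered from the integers |<y, x>|^2 by
    polarization, as an element of K with integral trace and norm lies in O. The expansion of det M
    = 1 into products of 2n entries serves as a substitute for ideal factorization. The condition on
    d enters through the units: it makes 1 and -1 the only scalars of Gamma, so the scalars of Delta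
    modulo Gamma are the 2n-th roots of unity modulo sign, which squaring identifies with the n-th
    roots of unity. *)

Section Conjugation.

Variable R : realType.
Local Notation C := (Cplx R).
Implicit Types x y z w : C.

Lemma conjCD z w : (z + w)^* = z^* + w^*. Proof. exact: rmorphD. Qed.
Lemma conjCN z : (- z)^* = - z^*. Proof. exact: rmorphN. Qed.
Lemma conjCB z w : (z - w)^* = z^* - w^*. Proof. exact: rmorphB. Qed.
Lemma conjCM z w : (z * w)^* = z^* * w^*. Proof. exact: rmorphM. Qed.
Lemma conjCX z k : (z ^+ k)^* = z^* ^+ k. Proof. exact: rmorphXn. Qed.
Lemma conjCV z : (z^-1)^* = (z^*)^-1. Proof. exact: fmorphV. Qed.

Lemma conjC_sum (I : Type) (r : seq I) (P : pred I) (F : I -> C) :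
  (\sum_(i <- r | P i) F i)^* = \sum_(i <- r | P i) (F i)^*.
Proof. exact: rmorph_sum. Qed.

Lemma conjC_prod (I : Type) (r : seq I) (P : pred I) (F : I -> C) :
  (\prod_(i <- r | P i) F i)^* = \prod_(i <- r | P i) (F i)^*.
Proof. exact: rmorph_prod. Qed.

Lemma conjC_ratr (q : rat) : (ratr q : C)^* = ratr q.
Proof. exact: fmorph_rat. Qed.

Lemma conjC_int (k : int) : (k%:~R : C)^* = k%:~R.
Proof. exact: rmorph_int. Qed.

End Conjugation.

Section ImaginaryQuadratic.

Variables (R : realType) (m : nat).
Local Notation C := (Cplx R).
Local Notation K := (@imquad R m).
Local Notation O := (@ringO R m).
Implicit Types x y z w : C.

Let s : C := sqrtC (- m%:R).

Lemma sqr_sqrtCN : s ^+ 2 = - m%:R.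
Proof. exact: sqrtCK. Qed.

Lemma conj_sqrtCN : s^* = - s.
Proof.
have /eqP : (s^*) ^+ 2 = s ^+ 2.
  by rewrite -conjCX sqr_sqrtCN rmorphN rmorph_nat.
rewrite eqf_sqr => /orP[/eqP/CrealP rs|/eqP//].
have /eqP : s ^+ 2 == 0.
  by rewrite eq_le real_exprn_even_ge0 // andbT sqr_sqrtCN oppr_le0 ler0n.
by move/eqP; rewrite sqrf_eq0 => /eqP ->; rewrite oppr0 conjC0.
Qed.

Lemma imquad_ratr (q : rat) : K (ratr q).
Proof. by exists q, 0; rewrite raddf0 mul0r addr0. Qed.

Lemma imquad_int (k : int) : K k%:~R.
Proof. by rewrite -(ratr_int C); exact: imquad_ratr. Qed.

Lemma imquad0 : K 0. Proof. exact: (imquad_int 0). Qed.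
Lemma imquad1 : K 1. Proof. exact: (imquad_int 1). Qed.

Lemma imquadD z w : K z -> K w -> K (z + w).
Proof.
move=> [a [b ->]] [a' [b' ->]]; exists (a + a'), (b + b').
by rewrite !rmorphD /=; ring.
Qed.

Lemma imquadM z w : K z -> K w -> K (z * w).
Proof.
move=> [a [b ->]] [a' [b' ->]]; exists (a * a' - m%:R * b * b'), (a * b' + b * a').
rewrite !(rmorphD, rmorphN, rmorphM, rmorph_nat) /=.
have := sqr_sqrtCN; rewrite -/s => h.
by ring: h.
Qed.

Lemma imquadN z : K z -> K (- z).
Proof. by rewrite -mulN1r => Kz; apply: imquadM => //; exact: (imquad_int (- 1)). Qed.

Lemma imquadB z w : K z -> K w -> K (z - w).
Proof. by move=> Kz /imquadN; exact: imquadD. Qed.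

Lemma imquad_conj z : K z -> K z^*.
Proof.
move=> [a [b ->]]; exists a, (- b).
by rewrite conjCD conjC_ratr conjCM conjC_ratr -/s conj_sqrtCN rmorphN mulrN mulNr.
Qed.

Lemma imquad_real z : K z -> z^* = z -> exists q : rat, z = ratr q.
Proof.
move=> [a [b ->]]; rewrite conjCD conjC_ratr conjCM conjC_ratr -/s conj_sqrtCN => /addrI.
move=> /eqP; rewrite mulrN eqNr => /eqP ->.
by exists a; rewrite addr0.
Qed.

Lemma imquadV z : K z -> K z^-1.
Proof.
move=> Kz; have [->|z0] := eqVneq z 0; first by rewrite invr0; exact: imquad0.
have [q hq] : exists q : rat, z * z^* = ratr q.
  apply: imquad_real; first by apply: imquadM => //; exact: imquad_conj.
  by rewrite conjCM conjCK mulrC.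
have -> : z^-1 = z^* * ratr q^-1.
  have -> : (ratr q^-1 : C) = (ratr q)^-1 by exact: fmorphV.
  rewrite -hq invfM; have : z^* != 0 by rewrite conjC_eq0.
  by move=> ?; field; apply/andP.
by apply: imquadM; [exact: imquad_conj|exact: imquad_ratr].
Qed.

Lemma imquad_div z w : K z -> K w -> K (z / w).
Proof. by move=> ? /imquadV; exact: imquadM. Qed.

Lemma imquad_sum (I : Type) (r : seq I) (P : pred I) (F : I -> C) :
  (forall i, P i -> K (F i)) -> K (\sum_(i <- r | P i) F i).
Proof. by move=> h; apply: (big_ind K) => //; [exact: imquad0|exact: imquadD]. Qed.

(** The monic relation is transported through [rat] into [algC], where rational algebraic integers
    are known to be integers. *)
Lemma rat_integral_int (q : rat) :
  integralOver (fun k : int => k%:~R : C) (ratr q) -> exists k : int, q = k%:~R.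
Proof.
move=> [p mp rp].
have rq : root (map_poly (intmul 1 : int -> rat) p) q.
  rewrite -(fmorph_root (@ratr C)) -map_poly_comp /=.
  by rewrite (eq_map_poly (g := fun k : int => k%:~R)) // => k /=; rewrite ratr_int.
have rA : root (map_poly (intmul 1 : int -> algC) p) (ratr q).
  move: rq; rewrite -(fmorph_root (@ratr algC)) -map_poly_comp /=.
  by rewrite (eq_map_poly (g := intmul 1)) // => k /=; rewrite ratr_int.
have /intrP[k hk] : (ratr q : algC) \in Num.int.
  apply: Cint_rat_Aint; first by apply/CratP; exists q.
  apply: root_monic_Aint rA _ _; first by apply: monic_map.
  by apply/polyOverP => i; rewrite coef_map /= intr_int.
exists k; apply: (fmorph_inj (@ratr algC)); exact: (etrans hk (esym (ratr_int _ k))).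
Qed.

Lemma ringO_imquad z : O z -> K z. Proof. by case. Qed.

Lemma ringO_int (k : int) : O k%:~R.
Proof.
split; first exact: imquad_int.
exact: (integral_id (intmul 1 : {rmorphism int -> C})).
Qed.

Lemma ringO_nat (k : nat) : O k%:R.
Proof. exact: (ringO_int k). Qed.

Lemma ringO0 : O 0. Proof. exact: (ringO_int 0). Qed.
Lemma ringO1 : O 1. Proof. exact: (ringO_int 1). Qed.

Lemma ringOD z w : O z -> O w -> O (z + w).
Proof.
move=> [Kz iz] [Kw iw]; split; first exact: imquadD.
exact: (@integral_add _ _ (intmul 1 : {rmorphism int -> C})).
Qed.

Lemma ringOM z w : O z -> O w -> O (z * w).
Proof.
move=> [Kz iz] [Kw iw]; split; first exact: imquadM.
exact: (@integral_mul _ _ (intmul 1 : {rmorphism int -> C})).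
Qed.

Lemma ringON z : O z -> O (- z).
Proof. by rewrite -mulN1r => Oz; apply: ringOM => //; exact: (ringO_int (- 1)). Qed.

Lemma ringOB z w : O z -> O w -> O (z - w).
Proof. by move=> Oz /ringON; exact: ringOD. Qed.

Lemma ringOX z k : O z -> O (z ^+ k).
Proof.
move=> Oz; elim: k => [|k IH]; first by rewrite expr0; exact: ringO1.
by rewrite exprS; exact: ringOM.
Qed.

Lemma ringO_sum (I : Type) (r : seq I) (P : pred I) (F : I -> C) :
  (forall i, P i -> O (F i)) -> O (\sum_(i <- r | P i) F i).
Proof. by move=> h; apply: (big_ind O) => //; [exact: ringO0|exact: ringOD]. Qed.

Lemma ringO_prod (I : Type) (r : seq I) (P : pred I) (F : I -> C) :
  (forall i, P i -> O (F i)) -> O (\prod_(i <- r | P i) F i).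
Proof. by move=> h; apply: (big_ind O) => //; [exact: ringO1|exact: ringOM]. Qed.

Lemma ringO_sign (b : bool) z : O z -> O ((-1) ^+ b * z).
Proof. by case: b => Oz; rewrite ?expr1 ?mulN1r ?expr0 ?mul1r //; exact: ringON. Qed.

Lemma ringO_conj z : O z -> O z^*.
Proof.
move=> [Kz [p mp rp]]; split; first exact: imquad_conj.
exists p => //; move: rp; rewrite -(fmorph_root Num.conj) -map_poly_comp /=.
by rewrite (eq_map_poly (g := fun k : int => k%:~R)) // => k /=; rewrite conjC_int.
Qed.

Lemma ringO_rat (q : rat) : O (ratr q) -> exists k : int, q = k%:~R.
Proof. by move=> [_ /rat_integral_int]. Qed.

Lemma ringO_real z : O z -> z^* = z -> exists k : int, z = k%:~R.
Proof.
move=> Oz rz; have [q hq] := imquad_real (ringO_imquad Oz) rz.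
have [k hk] : exists k : int, q = k%:~R by apply: ringO_rat; rewrite -hq.
by exists k; rewrite hq hk ratr_int.
Qed.

Lemma ringO_trace z : O z -> exists k : int, z + z^* = k%:~R.
Proof.
move=> Oz; apply: ringO_real; first by apply: ringOD => //; exact: ringO_conj.
by rewrite conjCD conjCK addrC.
Qed.

Lemma ringO_norm z : O z -> exists k : int, z * z^* = k%:~R.
Proof.
move=> Oz; apply: ringO_real; first by apply: ringOM => //; exact: ringO_conj.
by rewrite conjCM conjCK mulrC.
Qed.

(** Composing the monic polynomial of z^k with X^k gives one for z. [K z] is a hypothesis because a
    root may leave the field. *)
Lemma ringO_root z k : (0 < k)%N -> K z -> O (z ^+ k) -> O z.
Proof.
move=> k0 Kz [_ [p mp rp]]; split=> //.
exists (p \Po 'X^k).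
  rewrite monicE lead_coef_comp ?size_polyXn // lead_coefXn expr1n mulr1.
  by rewrite -monicE.
by rewrite /root map_comp_poly map_polyXn horner_comp hornerXn.
Qed.

Lemma ringO_trace_norm z (t k : int) :
  K z -> z + z^* = t%:~R -> z * z^* = k%:~R -> O z.
Proof.
move=> Kz ht hk; split=> //; exists ('X^2 - t *: 'X + k%:P).
  rewrite monicE -addrA lead_coefDl ?lead_coefXn // size_polyXn.
  rewrite (leq_ltn_trans (size_polyD _ _)) // gtn_max size_polyN.
  rewrite (leq_ltn_trans (size_scale_leq _ _)) ?size_polyX //.
  by rewrite (leq_ltn_trans (size_polyC_leq1 _)).
change (root (map_poly (intmul 1 : int -> C) ('X^2 - t *: 'X + k%:P)) z).
rewrite /root rmorphD rmorphB /= map_polyZ /= map_polyX map_polyXn map_polyC /=.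
rewrite !hornerE /= -ht -hk; apply/eqP; ring.
Qed.

Lemma ringO_sqrtCN : O s.
Proof.
apply: (@ringO_root _ 2) => //; last first.
  by rewrite sqr_sqrtCN; apply: ringON; exact: ringO_nat.
by exists 0, 1; rewrite raddf0 rmorph1 add0r mul1r.
Qed.

Lemma imquad_frac z : K z -> exists2 k : nat, (0 < k)%N & O (k%:R * z).
Proof.
move=> [a [b ->]].
have key (q : rat) : (`|denq q|%N)%:R * ratr q = (numq q)%:~R :> C.
  by rewrite pmulrn absz_denq /ratr mulrC divfK // intr_eq0 denq_neq0.
exists (`|denq a| * `|denq b|)%N; first by rewrite muln_gt0 !absz_gt0 !denq_neq0.
rewrite natrM mulrDr; apply: ringOD.
  rewrite mulrAC key; apply: ringOM; [exact: ringO_int|exact: ringO_nat].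
rewrite mulrA -(mulrA _ _ (ratr b)) key.
apply: ringOM; last exact: ringO_sqrtCN.
by apply: ringOM; [exact: ringO_nat|exact: ringO_int].
Qed.

Lemma ringO_norm_lt1 z : O z -> `|z| < 1 -> z = 0.
Proof.
move=> Oz z1; have [k hk] := ringO_norm Oz.
have : `|z| ^+ 2 < 1 by rewrite expr_lt1.
rewrite normCK hk -[X in _ < X]/(1%:~R : C) ltr_int => k1.
have : 0 <= `|z| ^+ 2 by rewrite exprn_ge0.
rewrite normCK hk ler0z => k0.
have k00 : k = 0 by move: k1 k0; lia.
by move: hk; rewrite k00 -normCK => /eqP; rewrite sqrf_eq0 normr_eq0 => /eqP.
Qed.

End ImaginaryQuadratic.

Lemma intM_eq1 (a b : int) : a * b = 1 -> 0 <= a -> a = 1.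
Proof.
move=> /(congr1 absz); rewrite abszM => /eqP.
by rewrite muln_eq1 => /andP[/eqP a1 _]; lia.
Qed.

(** Replaces an arbitrary integral basis by one of the form 1, w. The coordinates a, b of 1 are
    coprime because rational elements of O are integers; Bezout completes them to a unimodular
    change of basis, which preserves the discriminant. *)
Lemma ringO_basis (R : realType) (m : nat) (d : int) :
  (0 < m)%N -> is_discriminant R m d ->
  exists (w : Cplx R) (t k : int),
    [/\ ringO m w, w + w^* = t%:~R /\ w * w^* = k%:~R, d = t ^+ 2 - 4 * k,
        d < 0 & forall z, ringO m z -> exists a b : int, z = a%:~R + b%:~R * w].
Proof.
move=> m0 [w1 [w2 [[Ow1 Ow2 Ob] hd]]].
have [[a b] [/= hab _]] := Ob 1 (@ringO1 R m).
have g1 : gcdz a b = 1.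
  set g := gcdz a b.
  have g0 : g != 0.
    apply/eqP => /eqP; rewrite gcdz_eq0 => /andP[/eqP a0 /eqP b0].
    by move: hab => /eqP; rewrite a0 b0 !mul0r addr0 oner_eq0.
  have gC0 : (g%:~R : Cplx R) != 0 by rewrite intr_eq0.
  have [a' ha] : exists a', a = a' * g by apply/dvdzP; exact: dvdz_gcdl.
  have [b' hb] : exists b', b = b' * g by apply/dvdzP; exact: dvdz_gcdr.
  have : ringO m (ratr (g%:~R)^-1 : Cplx R).
    have -> : ratr (g%:~R)^-1 = (g%:~R)^-1 :> Cplx R.
      by transitivity ((ratr g%:~R)^-1 : Cplx R); [exact: fmorphV|rewrite ratr_int].
    have -> : (g%:~R)^-1 = a'%:~R * w1 + b'%:~R * w2.
      by rewrite -[LHS]mulr1 [X in _ * X]hab ha hb !rmorphM /=; field.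
    by apply: ringOD; apply: ringOM => //; exact: ringO_int.
  move=> /ringO_rat[j hj].
  have : g%:~R * j%:~R = 1 :> rat by rewrite -hj mulfV // intr_eq0.
  rewrite -intrM => /eqP; rewrite -[1]/(1%:~R) eqr_int => /eqP gj.
  exact: intM_eq1 gj _.
have [u [v huv]] := Bezoutz a b; rewrite g1 in huv.
have huvC : u%:~R * a%:~R + v%:~R * b%:~R = 1 :> Cplx R.
  by rewrite -!rmorphM -rmorphD huv.
have [w wE] : exists w, w = - v%:~R * w1 + u%:~R * w2 by eexists.
have Ow : ringO m w.
  rewrite wE.
  by apply: ringOD; apply: ringOM => //; [apply: ringON|]; exact: ringO_int.
have [t ht] := ringO_trace Ow; have [k hk] := ringO_norm Ow.
have e1 : w1 = u%:~R - b%:~R * w.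
  have : u%:~R * (a%:~R * w1 + b%:~R * w2) - b%:~R * w =
    (u%:~R * a%:~R + v%:~R * b%:~R) * w1 by rewrite wE; ring.
  by rewrite -hab huvC mulr1 mul1r.
have e2 : w2 = v%:~R + a%:~R * w.
  have : v%:~R * (a%:~R * w1 + b%:~R * w2) + a%:~R * w =
    (u%:~R * a%:~R + v%:~R * b%:~R) * w2 by rewrite wE; ring.
  by rewrite -hab huvC mulr1 mul1r.
have dw : d%:~R = (w - w^*) ^+ 2.
  have e : w1 * w2^* - w2 * w1^* = w^* - w.
    rewrite e1 e2 !(conjCD, conjCN, conjCM, conjC_int).
    transitivity ((u%:~R * a%:~R + v%:~R * b%:~R) * (w^* - w)); first by ring.
    by rewrite huvC mul1r.
  by rewrite hd e; ring.
exists w, t, k; split=> //.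
- apply/eqP; rewrite -(eqr_int (Cplx R)) dw rmorphB rmorphXn rmorphM /= -ht -hk.
  by apply/eqP; ring.
- have dle : d%:~R = - (`|w - w^*| ^+ 2).
    by rewrite dw normCK conjCB conjCK; ring.
  have : (d%:~R : Cplx R) <= 0 by rewrite dle oppr_le0 exprn_ge0.
  rewrite lerz0 lt_neqAle => ->; rewrite andbT; apply/eqP => d0.
  have /eqP : (w - w^*) ^+ 2 = 0 by rewrite -dw d0.
  rewrite sqrf_eq0 subr_eq0 => /eqP rw.
  have [[a1 b1] [/= hs _]] := Ob _ (@ringO_sqrtCN R m).
  have : (sqrtC (- m%:R : Cplx R))^* = sqrtC (- m%:R).
    rewrite hs e1 e2 !(conjCD, conjCN, conjCM, conjC_int) -rw; ring.
  rewrite conj_sqrtCN => /eqP; rewrite eqNr sqrtC_eq0 oppr_eq0 pnatr_eq0.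
  by rewrite -leqn0 leqNgt m0.
- move=> z /Ob[[x y] [/= -> _]].
  exists (x * u + y * v), (y * a - x * b).
  by rewrite e1 e2 !(rmorphD, rmorphN, rmorphM) /=; ring.
Qed.

Lemma ringO_basis_neq_conj (R : realType) (d t k : int) (w : Cplx R) :
  w + w^* = t%:~R -> w * w^* = k%:~R -> d = t ^+ 2 - 4 * k -> d < 0 -> w - w^* != 0.
Proof.
move=> ht hk dE d0; apply/eqP => wr.
suff : (d%:~R : Cplx R) = 0 by move/eqP; rewrite intr_eq0; lia.
rewrite dE rmorphB rmorphXn rmorphM /= -ht -hk.
by transitivity ((w - w^*) ^+ 2); [ring|rewrite wr expr0n].
Qed.

(** For z = a + bw of norm 1 one has (2a + tb)^2 - d b^2 = 4. Since d is negative, congruent to 0 or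
    1 modulo 4 and different from -3 and -4, it is at most -7, which forces b = 0. *)
Lemma ringO_unit (R : realType) (m : nat) (d : int) (z : Cplx R) :
  (0 < m)%N -> is_discriminant R m d -> d <> -3 -> d <> -4 ->
  ringO m z -> ringO m z^-1 -> z != 0 -> z = 1 \/ z = -1.
Proof.
move=> m0 hd d3 d4 Oz Ozi z0.
have [w [t [k [Ow [ht hk] dE d0 Ob]]]] := ringO_basis m0 hd.
have [n1 hn1] := ringO_norm Oz; have [n2 hn2] := ringO_norm Ozi.
have nn : n1 * n2 = 1.
  apply/eqP; rewrite -(eqr_int (Cplx R)) rmorphM /= -hn1 -hn2 conjCV.
  by apply/eqP; field; rewrite conjC_eq0 z0.
have n1ge : 0 <= n1 by rewrite -(ler0z (Cplx R)) -hn1 -normCK exprn_ge0.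
have n11 : n1 = 1 by exact: intM_eq1 nn n1ge.
have [a [b hz]] := Ob _ Oz.
have hN : a ^+ 2 + t * a * b + k * b ^+ 2 = 1.
  apply/eqP; rewrite -n11 -(eqr_int (Cplx R)) -hn1 hz.
  rewrite conjCD conjCM !conjC_int !(rmorphD, rmorphM, rmorphXn) /= -ht -hk.
  by apply/eqP; ring.
have d7 : d <= -7.
  have [q [r [tm hr]]] : exists q r : int, t = 2 * q + r /\ (r = 0 \/ r = 1).
    by exists (t %/ 2)%Z, (t %% 2)%Z; split; lia.
  have : d = 4 * (q ^+ 2 + q * r - k) + r ^+ 2 by rewrite dE tm; ring.
  by move: (q ^+ 2 + _ - k) d0 d3 d4 => X; case: hr => ->; lia.
have b0 : b = 0.
  have : (2 * a + t * b) ^+ 2 + (- d) * b ^+ 2 = 4.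
    transitivity (4 * (a ^+ 2 + t * a * b + k * b ^+ 2)); first by rewrite dE; ring.
    by rewrite hN.
  have := sqr_ge0 (2 * a + t * b); move: ((2 * a + t * b) ^+ 2) => X X0 E.
  by move: E d7 X0; clear; rewrite expr2; nia.
move: hN hz; rewrite b0 mul0r addr0 mulr0 addr0 expr0n /= mulr0 addr0 => a1 ->.
have [->|->] : a = 1 \/ a = -1 by move: a1; clear; rewrite expr2; nia.
  by left.
by right.
Qed.

Lemma intr_Fp_eq0 (p : nat) (x : int) : prime p ->
  (x%:~R == 0 :> 'F_p) = (p%:Z %| x)%Z.
Proof. by move=> pp; rewrite -(dvdz_pcharf (pchar_Fp pp)). Qed.

(** Reduction of O modulo a prime of degree one that is stable under conjugation, encoded as a total
    function constrained on O only. *)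
Definition residue_hom (R : realType) (m p : nat) (rho : Cplx R -> 'F_p) : Prop :=
  [/\ forall a : int, rho a%:~R = a%:~R,
      forall z z', ringO m z -> ringO m z' -> rho (z + z') = rho z + rho z',
      forall z z', ringO m z -> ringO m z' -> rho (z * z') = rho z * rho z' &
      forall z, ringO m z -> rho z^* = rho z].

(* A prime dividing trace and norm of an element outside pO ramifies, so the  *)
(* residue field is F_p and conjugation acts trivially on it.                 *)
Lemma residue_map (R : realType) (m : nat) (d : int) (p : nat) (y : Cplx R)
    (t0 k0 : int) :
  (0 < m)%N -> is_discriminant R m d -> prime p ->
  ringO m y -> ~ ringO m (y / p%:R) ->
  y + y^* = p%:R * t0%:~R -> y * y^* = p%:R * k0%:~R ->
  exists rho : Cplx R -> 'F_p, residue_hom m rho.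
Proof.
move=> m0 hd pp Oy nOy ty ny.
have [w [t [k [Ow [ht hk] dE d0 Ob]]]] := ringO_basis m0 hd.
have wr := ringO_basis_neq_conj ht hk dE d0.
have inj (a b a' b' : int) : a%:~R + b%:~R * w = a'%:~R + b'%:~R * w -> a = a' /\ b = b'.
  move=> e; have bb : b = b'.
    apply/eqP; rewrite -(eqr_int (Cplx R)) -subr_eq0.
    have /eqP : (b%:~R - b'%:~R) * (w - w^*) = 0.
      transitivity ((a%:~R + b%:~R * w) - (a%:~R + b%:~R * w)^*
        - ((a'%:~R + b'%:~R * w) - (a'%:~R + b'%:~R * w)^*)).
        by rewrite !conjCD !conjCM !conjC_int; ring.
      by rewrite e subrr.
    by rewrite mulf_eq0 (negPf wr) orbF.
  split=> //; apply/eqP; rewrite -(eqr_int (Cplx R)).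
  by move: e; rewrite bb => /addIr ->.
have w2 : w * w = t%:~R * w - k%:~R by rewrite -ht -hk; ring.
have cw : w^* = t%:~R - w by rewrite -ht; ring.
have [x1 [x2 hy]] := Ob _ Oy.
have hT : 2 * x1 + t * x2 = p%:Z * t0.
  apply/eqP; rewrite -(eqr_int (Cplx R)) rmorphD !rmorphM /= -ty hy.
  by rewrite conjCD conjCM !conjC_int cw; apply/eqP; ring.
have hN : x1 ^+ 2 + t * x1 * x2 + k * x2 ^+ 2 = p%:Z * k0.
  apply/eqP; rewrite -(eqr_int (Cplx R)) !(rmorphD, rmorphM, rmorphXn) /= -ny hy.
  rewrite conjCD conjCM !conjC_int -ht -hk; apply/eqP; ring.
have p0 (x : int) : (p%:Z * x)%:~R = 0 :> 'F_p.
  by apply/eqP; rewrite intr_Fp_eq0 // dvdz_mulr.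
have hTp := congr1 (intmul 1 : int -> 'F_p) hT.
have hNp := congr1 (intmul 1 : int -> 'F_p) hN.
rewrite p0 !(rmorphD, rmorphM, rmorphXn) /= in hTp.
rewrite p0 !(rmorphD, rmorphM, rmorphXn) /= in hNp.
set X1 : 'F_p := x1%:~R in hTp hNp; set X2 : 'F_p := x2%:~R in hTp hNp.
have X20 : X2 != 0.
  apply/eqP => X20; apply: nOy.
  move: hNp; rewrite X20 !(mulr0, addr0, expr0n) /= => /eqP.
  rewrite sqrf_eq0 intr_Fp_eq0 // => /dvdzP[q1 hq1].
  have /dvdzP[q2 hq2] : (p%:Z %| x2)%Z by rewrite -intr_Fp_eq0 //; exact/eqP.
  have -> : y / p%:R = q1%:~R + q2%:~R * w.
    rewrite hy hq1 hq2 !rmorphM /=; field.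
    by rewrite pnatr_eq0 -lt0n prime_gt0.
  by apply: ringOD; [|apply: ringOM => //]; exact: ringO_int.
(* The residue of w. Trace and norm of y = x1 + x2 w vanish modulo p, so y has to reduce to 0, and
   this equation is solved for w. Then [th] is a double root of X^2 - tX + k. *)
pose th := - X1 / X2.
have th1 : th + th = t%:~R.
  apply: (mulIf X20); rewrite /th mulrDl !divfK //.
  have -> : t%:~R * X2 = (2%:~R * X1 + t%:~R * X2) - (X1 + X1) by ring.
  by rewrite hTp; ring.
have th2 : th * th = t%:~R * th - k%:~R.
  apply: (mulIf X20); apply: (mulIf X20).
  have -> : th * th * X2 * X2 = (th * X2) ^+ 2 by ring.
  have -> : (t%:~R * th - k%:~R) * X2 * X2 =
    t%:~R * (th * X2) * X2 - k%:~R * X2 ^+ 2 by ring.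
  rewrite /th divfK //; apply/eqP; rewrite -subr_eq0; apply/eqP.
  by rewrite -[RHS]hNp; ring.
(* The coordinates in the basis 1, w are unique by [inj]; the value 0 outside O is a dummy. *)
pose rho (z : Cplx R) : 'F_p :=
  if pselect (exists ab : int * int, z = ab.1%:~R + ab.2%:~R * w) is left e
  then (projT1 (cid e)).1%:~R + (projT1 (cid e)).2%:~R * th else 0.
have rhoE (a b : int) : rho (a%:~R + b%:~R * w) = a%:~R + b%:~R * th.
  rewrite /rho; case: pselect => [e|]; last by case; exists (a, b).
  by case: cid => -[a' b'] /= /inj[-> ->].
exists rho; split.
- by move=> a; have := rhoE a 0; rewrite !mul0r !addr0.
- move=> _ _ /Ob[a [b ->]] /Ob[a' [b' ->]]; rewrite !rhoE.
  have -> : a%:~R + b%:~R * w + (a'%:~R + b'%:~R * w) =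
    (a + a')%:~R + (b + b')%:~R * w by rewrite !rmorphD /=; ring.
  by rewrite rhoE !rmorphD /=; ring.
- move=> _ _ /Ob[a [b ->]] /Ob[a' [b' ->]]; rewrite !rhoE.
  have -> : (a%:~R + b%:~R * w) * (a'%:~R + b'%:~R * w) =
    (a * a' - k * b * b')%:~R + (a * b' + b * a' + t * b * b')%:~R * w.
    rewrite !(rmorphD, rmorphN, rmorphM) /=; ring: w2.
  rewrite rhoE !(rmorphD, rmorphN, rmorphM) /=; ring: th2.
- move=> _ /Ob[a [b ->]]; rewrite rhoE conjCD conjCM !conjC_int cw.
  have -> : a%:~R + b%:~R * (t%:~R - w) = (a + b * t)%:~R + (- b)%:~R * w.
    by rewrite !(rmorphD, rmorphN, rmorphM) /=; ring.
  by rewrite rhoE !(rmorphD, rmorphN, rmorphM) /= -th1; ring.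
Qed.

(** * Unitary matrices and transvections *)

Section UnitaryGroup.

Variables (R : realType) (n : nat).
Local Notation C := (Cplx R).
Local Notation J := (mxJ R n).
Local Notation SU := (SU R n).

Definition cadj p q (A : 'M[C]_(p, q)) : 'M[C]_(q, p) := (map_mx Num.conj A)^T.

Lemma cadjE p q (A : 'M[C]_(p, q)) i j : cadj A i j = (A j i)^*.
Proof. by rewrite !mxE. Qed.

Lemma cadjK p q (A : 'M[C]_(p, q)) : cadj (cadj A) = A.
Proof. by apply/matrixP => i j; rewrite !cadjE conjCK. Qed.

Lemma cadjM p q r (A : 'M[C]_(p, q)) (B : 'M[C]_(q, r)) :
  cadj (A *m B) = cadj B *m cadj A.
Proof. by rewrite /cadj map_mxM trmx_mul. Qed.

Lemma cadjD p q (A B : 'M[C]_(p, q)) : cadj (A + B) = cadj A + cadj B.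
Proof. by rewrite /cadj map_mxD linearD. Qed.

Lemma cadjZ p q c (A : 'M[C]_(p, q)) : cadj (c *: A) = c^* *: cadj A.
Proof. by rewrite /cadj map_mxZ linearZ. Qed.

Lemma cadj1 p : cadj (1%:M : 'M[C]_p) = 1%:M.
Proof. by rewrite /cadj map_mx1 trmx1. Qed.

(** J is a signed permutation matrix: the only nonzero entry of row i is [jsign i], in column
    [swap i]. Multiplication by J thus becomes a reindexing with signs. *)
Definition swap (i : 'I_(n + n)) : 'I_(n + n) :=
  match fintype.split i with inl k => rshift n k | inr k => lshift n k end.

Definition jsign (i : 'I_(n + n)) : C := (-1) ^+ (i < n)%N.

Lemma swap_lshift k : swap (lshift n k) = rshift n k.
Proof. by rewrite /swap (unsplitK (inl k)). Qed.

Lemma swap_rshift k : swap (rshift n k) = lshift n k.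
Proof. by rewrite /swap (unsplitK (inr k)). Qed.

Lemma jsign_lshift k : jsign (lshift n k) = -1.
Proof. by rewrite /jsign /= ltn_ord. Qed.

Lemma jsign_rshift k : jsign (rshift n k) = 1.
Proof. by rewrite /jsign /= ltnNge leq_addr. Qed.

Variant shift_spec : 'I_(n + n) -> Type :=
  | ShiftL k : shift_spec (lshift n k)
  | ShiftR k : shift_spec (rshift n k).

Lemma shiftP i : shift_spec i.
Proof. by case: (split_ordP i) => k ->; constructor. Qed.

Lemma swapK : involutive swap.
Proof. by move=> i; case: (shiftP i) => k; rewrite ?(swap_lshift, swap_rshift). Qed.

Lemma swap_neq i : swap i != i.
Proof.
by case: (shiftP i) => k; rewrite ?(swap_lshift, swap_rshift) ?eq_lrshift ?eq_rlshift.
Qed.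

Lemma jsign_swap i : jsign (swap i) = - jsign i.
Proof.
by case: (shiftP i) => k;
  rewrite ?(swap_lshift, swap_rshift, jsign_lshift, jsign_rshift) ?opprK.
Qed.

Lemma jsignK i : jsign i * jsign i = 1.
Proof. by rewrite /jsign -expr2 sqrr_sign. Qed.

Lemma jsign_neq0 i : jsign i != 0.
Proof. by rewrite /jsign signr_eq0. Qed.

Lemma conj_jsign i : (jsign i)^* = jsign i.
Proof. by rewrite /jsign; case: (_ < _)%N; rewrite ?expr1 ?expr0 ?conjCN conjC1. Qed.

Lemma mxJE i j : J i j = jsign i * (j == swap i)%:R.
Proof.
rewrite /mxJ; case: (shiftP i) => k; case: (shiftP j) => l;
  rewrite ?block_mxEul ?block_mxEur ?block_mxEdl ?block_mxEdr !mxE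
    ?(swap_lshift, swap_rshift, jsign_lshift, jsign_rshift)
    ?(eq_lshift, eq_rshift, eq_lrshift, eq_rlshift) ?mulr0 ?mulN1r ?mul1r //.
- by rewrite eq_sym.
- by rewrite eq_sym.
Qed.

Lemma mulJmx p (A : 'M[C]_(n + n, p)) i j : (J *m A) i j = jsign i * A (swap i) j.
Proof.
rewrite mxE (bigD1 (swap i)) //= big1 => [|k ki]; rewrite mxJE.
  by rewrite eqxx mulr1 addr0.
by rewrite (negPf ki) mulr0 mul0r.
Qed.

Lemma mulmxJ p (A : 'M[C]_(p, n + n)) i j : (A *m J) i j = - jsign j * A i (swap j).
Proof.
rewrite mxE (bigD1 (swap j)) //= big1 => [|k ki]; rewrite mxJE.
  by rewrite swapK eqxx mulr1 addr0 jsign_swap mulrC.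
by rewrite -[j]swapK (inj_eq (can_inj swapK)) eq_sym (negPf ki) !mulr0.
Qed.

Lemma mxJ_sqr : J *m J = - 1%:M.
Proof.
apply/matrixP => i j; rewrite mulJmx mxJE swapK jsign_swap mulrA mulrN jsignK !mxE.
by rewrite mulN1r eq_sym.
Qed.

Lemma cadjJ : cadj J = - J.
Proof.
apply/matrixP => i j; rewrite cadjE [RHS]mxE !mxJE conjCM conj_jsign rmorph_nat.
rewrite -[in X in (X == _)](swapK i) (inj_eq (can_inj swapK)) eq_sym.
by case: eqP => [->|_]; rewrite ?mulr0 ?oppr0 // jsign_swap mulNr.
Qed.

Lemma SU_inverse M : SU M -> (- J *m cadj M *m J) *m M = 1%:M.
Proof.
move=> [_ h]; rewrite !mulNmx -!mulmxA (mulmxA (cadj M)) h.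
by rewrite mxJ_sqr opprK.
Qed.

Lemma SU_unitmx M : SU M -> M \in unitmx.
Proof. by move=> [h _]; rewrite unitmxE h unitr1. Qed.

Lemma SU_invmx M : SU M -> invmx M = - J *m cadj M *m J.
Proof.
move=> SM; rewrite -[LHS]mul1mx -(SU_inverse SM) -[RHS]mulmx1.
by rewrite -(mulmxV (SU_unitmx SM)) !mulmxA.
Qed.

Lemma SU_invmxE M i j : SU M ->
  invmx M i j = jsign i * jsign j * (M (swap j) (swap i))^*.
Proof.
move=> /SU_invmx ->; rewrite mulmxJ mulNmx mxE mulJmx cadjE.
by rewrite mulrNN mulrA [X in X * _]mulrC.
Qed.

Lemma SU_cadj M : SU M -> M *m J *m cadj M = J.
Proof.
move=> SM; have := mulmxV (SU_unitmx SM); rewrite (SU_invmx SM) !mulmxA mulmxN.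
move=> h; rewrite -[RHS]mul1mx -h -[RHS]mulmxA mxJ_sqr mulmxN mulmx1.
by rewrite !mulNmx opprK.
Qed.

Lemma SU1 : SU 1%:M.
Proof. by split; [rewrite det1|rewrite -/(cadj _) cadj1 mul1mx mulmx1]. Qed.

Lemma SUM M N : SU M -> SU N -> SU (M *m N).
Proof.
move=> [dM hM] [dN hN]; split; first by rewrite det_mulmx dM dN mulr1.
rewrite -/(cadj _) cadjM -!mulmxA (mulmxA J) (mulmxA (cadj M)) (mulmxA (cadj M)) hM.
by rewrite mulmxA hN.
Qed.

Lemma SUV M : SU M -> SU (invmx M).
Proof.
move=> SM; split; first by rewrite det_inv SM.1 invr1.
rewrite -/(cadj _) -{1}SM.2 -/(cadj _) !mulmxA -cadjM mulmxV ?SU_unitmx // cadj1.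
by rewrite mul1mx -mulmxA mulmxV ?SU_unitmx // mulmx1.
Qed.

Lemma SUZ c M : c ^+ (2 * n) = 1 -> SU M -> SU (c *: M).
Proof.
move=> c1 [dM hM]; split.
  by rewrite detZ dM mulr1 addnn -mul2n.
rewrite -/(cadj _) cadjZ -!scalemxAl -scalemxAr scalerA -/(cadj _) hM.
(* For n = 0 the root condition says nothing about c, but all matrices are empty. *)
have [n0|n0] := posnP n.
  by move: (mxJ R n); rewrite n0 => A; apply/matrixP => -[].
suff -> : c^* * c = 1 by rewrite scale1r.
have h : `|c| = 1.
  by apply/eqP; rewrite -(@pexpr_eq1 _ _ (2 * n)) ?muln_gt0 // -normrX c1 normr1.
by rewrite -normCKC h expr1n.
Qed.

Definition form (x y : 'cV[C]_(n + n)) : C := (cadj x *m J *m y) 0 0.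

Lemma formE x y : form x y = \sum_i jsign i * (x i 0)^* * y (swap i) 0.
Proof.
rewrite /form -mulmxA mxE; apply: eq_bigr => i _.
by rewrite mulJmx cadjE mulrCA mulrA.
Qed.

Lemma mx11_form x y : cadj x *m J *m y = (form x y)%:M.
Proof. exact: mx11_scalar. Qed.

Lemma formDl x x' y : form (x + x') y = form x y + form x' y.
Proof. by rewrite /form cadjD !mulmxDl mxE. Qed.

Lemma formDr x y y' : form x (y + y') = form x y + form x y'.
Proof. by rewrite /form mulmxDr mxE. Qed.

Lemma formZl c x y : form (c *: x) y = c^* * form x y.
Proof. by rewrite /form cadjZ -!scalemxAl mxE. Qed.

Lemma formZr c x y : form x (c *: y) = c * form x y.
Proof. by rewrite /form -scalemxAr mxE. Qed.

Lemma form_conj x y : (form x y)^* = - form y x.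
Proof.
rewrite /form -cadjE !cadjM cadjK cadjJ mulNmx mulmxN mulmxA.
by rewrite mxE.
Qed.

Lemma formM M x y : SU M -> form (M *m x) (M *m y) = form x y.
Proof.
move=> [_ h]; rewrite /form cadjM -!mulmxA (mulmxA J) (mulmxA (cadj M)) (mulmxA (cadj M)).
by rewrite h !mulmxA.
Qed.

Lemma form_delta x i : form x (delta_mx i 0) = jsign (swap i) * (x (swap i) 0)^*.
Proof.
rewrite formE (bigD1 (swap i)) //= big1 => [|k ki].
  by rewrite swapK mxE !eqxx mulr1 addr0.
rewrite mxE; have -> : (swap k == i) = false; last by rewrite mulr0.
by apply/negbTE; apply: contra ki => /eqP <-; rewrite swapK.
Qed.

Definition transvection (w : 'cV[C]_(n + n)) : 'M[C]_(n + n) :=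
  1%:M + w *m cadj w *m J.

(** The block matrix with rows (1, -v) and (u, 1) is factored both as lower times upper and as upper
    times lower triangular. *)
Lemma det_rank1 p (u : 'cV[C]_p) (v : 'rV[C]_p) :
  \det (1%:M + u *m v) = 1 + (v *m u) 0 0.
Proof.
have e1 : block_mx 1%:M 0 u 1%:M *m block_mx 1%:M (- v) 0 (1%:M + u *m v) =
    block_mx 1%:M (- v) u 1%:M :> 'M[C]_(1 + p).
  rewrite mulmx_block !(mul0mx, mulmx0, mul1mx, mulmx1, addr0, add0r, mulmxN).
  by rewrite addrC addrK.
have e2 : block_mx (1%:M + v *m u) (- v) 0 1%:M *m block_mx 1%:M 0 u 1%:M =
    block_mx 1%:M (- v) u 1%:M :> 'M[C]_(1 + p).
  rewrite mulmx_block !(mul0mx, mulmx0, mul1mx, mulmx1, addr0, add0r, mulNmx).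
  by rewrite addrK.
have := congr1 determinant e1; rewrite -e2 !det_mulmx !det_ublock !det_lblock.
by rewrite !det1 !mul1r !mulr1 det_mx11 !mxE eqxx => ->.
Qed.

Lemma SU_transvection w : form w w = 0 -> SU (transvection w).
Proof.
move=> w0; split; first by rewrite /transvection -mulmxA det_rank1 -/(form w w) w0 addr0.
rewrite -/(cadj _) /transvection cadjD cadj1 !cadjM cadjK cadjJ.
rewrite mulNmx mulmxDl mul1mx mulmxDr mulmx1 mulmxDl mulmxA !mulNmx.
have -> : J *m (w *m cadj w) *m J *m (w *m cadj w *m J) = 0.
  have hA : w *m cadj w *m J *m (w *m cadj w) = 0.
    rewrite !mulmxA -(mulmxA w (cadj w) J) -(mulmxA w _ w) mx11_form w0.
    by rewrite raddf0 mulmx0 mul0mx.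
  transitivity (J *m (w *m cadj w *m J *m (w *m cadj w)) *m J).
    by move: (mxJ R n) (cadj w) => j b; rewrite !mulmxA.
  by rewrite hA mulmx0 mul0mx.
by rewrite oppr0 addr0 -!mulmxA subrK.
Qed.

Lemma transvection_conj M w : SU M ->
  M *m transvection w *m invmx M = transvection (M *m w).
Proof.
move=> SM; rewrite /transvection mulmxDr mulmx1 mulmxDl mulmxV ?SU_unitmx //.
rewrite (SU_invmx SM) cadjM; congr (_ + _).
transitivity (- (M *m w *m cadj w *m (J *m J) *m cadj M *m J)).
  by move: (mxJ R n) (cadj M) (cadj w) => j a b; rewrite !mulNmx mulmxN !mulmxA.
by rewrite mxJ_sqr mulmxN mulmx1 !mulNmx opprK !mulmxA.
Qed.

Lemma transvectionE w x : transvection w *m x = x + form w x *: w.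
Proof.
rewrite /transvection mulmxDl mul1mx -!mulmxA (mulmxA (cadj w)) mx11_form.
by rewrite mul_mx_scalar.
Qed.

End UnitaryGroup.

(** * Modules over the ring of integers *)

Section Submodules.

Variables (R : realType) (m : nat).
Local Notation C := (Cplx R).
Local Notation K := (@imquad R m).
Local Notation O := (@ringO R m).
Local Notation submodule := (@submoduleO R m).
Implicit Types (A B S T : set C) (x y z u : C).

Lemma submodule_ringO : submodule O.
Proof. by split; [exact: ringO0|exact: ringOD|move=> *; exact: ringOM]. Qed.

Lemma submodule_opp A x : submodule A -> A x -> A (- x).
Proof.
by move=> [_ _ AZ] Ax; rewrite -mulN1r; apply: AZ => //; exact: (ringO_int _ _ (- 1)).
Qed.

Lemma submodule_sum A (I : Type) (r : seq I) (P : pred I) (F : I -> C) :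
  submodule A -> (forall i, P i -> A (F i)) -> A (\sum_(i <- r | P i) F i).
Proof. by move=> [A0 AD _] h; apply: (big_ind A). Qed.

Lemma submodule_scale A x : submodule A -> submodule [set y | A (x * y)].
Proof.
move=> [A0 AD AZ]; split=> /=; first by rewrite mulr0.
  by move=> y z ? ?; rewrite mulrDr; exact: AD.
by move=> a y Oa Ay; rewrite mulrCA; exact: AZ.
Qed.

Lemma dilateP A x y : x != 0 -> dilate x A y <-> A (x^-1 * y).
Proof.
move=> x0; split=> [[z Az <-]|Ay]; first by rewrite mulKf.
by exists (x^-1 * y) => //; rewrite mulVKf.
Qed.

Lemma dilateE A x : x != 0 -> dilate x A = [set y | A (x^-1 * y)].
Proof. by move=> x0; apply/seteqP; split=> y; rewrite dilateP. Qed.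

Lemma submodule_dilate A x : x != 0 -> submodule A -> submodule (dilate x A).
Proof. by move=> x0 SA; rewrite dilateE //; exact: submodule_scale. Qed.

Lemma dilate_dilate x y A : dilate x (dilate y A) = dilate (x * y) A.
Proof.
apply/seteqP; split=> [z [_ [a Aa <-] <-]|z [a Aa <-]].
  by exists a; rewrite ?mulrA.
by exists (y * a); [exists a|rewrite mulrA].
Qed.

Lemma dilate1 A : dilate 1 A = A.
Proof.
apply/seteqP; split=> [z [a Aa <-]|z Az]; first by rewrite mul1r.
by exists z; rewrite ?mul1r.
Qed.

Lemma submodule_generated S : submodule (generated m S).
Proof.
split=> [T [[] //]|x y Sx Sy T sT|a x Oa Sx T sT].
  by case: (sT) => -[_ TD _] _; apply: TD; [exact: Sx|exact: Sy].
by case: (sT) => -[_ _ TZ] _; apply: TZ => //; exact: Sx.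
Qed.

Lemma mem_generated S x : S x -> generated m S x.
Proof. by move=> Sx; exact: sub_gen_smallest. Qed.

Lemma generated_min S T : submodule T -> S `<=` T -> generated m S `<=` T.
Proof. exact: smallest_sub. Qed.

Lemma submodule_ideal_mul A B : submodule (ideal_mul m A B).
Proof. exact: submodule_generated. Qed.

Lemma mem_ideal_mul A B x y : A x -> B y -> ideal_mul m A B (x * y).
Proof. by move=> Ax By; apply: mem_generated; exists x => //; exists y. Qed.

Lemma ideal_mul_min A B T : submodule T ->
  (forall x y, A x -> B y -> T (x * y)) -> ideal_mul m A B `<=` T.
Proof. by move=> sT h; apply: generated_min => // _ [x Ax [y By <-]]; exact: h. Qed.

Lemma ideal_mul_dilate A B x y : x != 0 -> y != 0 ->
  ideal_mul m (dilate x A) (dilate y B) = dilate (x * y) (ideal_mul m A B).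
Proof.
move=> x0 y0; have xy0 : x * y != 0 by rewrite mulf_neq0.
apply/seteqP; split.
  apply: ideal_mul_min; first by apply: submodule_dilate => //; exact: submodule_ideal_mul.
  move=> _ _ [a Aa <-] [b Bb <-]; exists (a * b); first exact: mem_ideal_mul.
  by ring.
move=> _ [z + <-]; move: z; apply: ideal_mul_min.
  exact: submodule_scale (submodule_ideal_mul _ _).
move=> a b Aa Bb /=; have -> : x * y * (a * b) = (x * a) * (y * b) by ring.
by apply: mem_ideal_mul; [exists a|exists b].
Qed.

Lemma submodule_ideal_pow A k : submodule (ideal_pow m A k).
Proof. by case: k => [|k]; [exact: submodule_ringO|exact: submodule_ideal_mul]. Qed.

Lemma ideal_pow_prod A k (F : 'I_k -> C) :
  (forall i, A (F i)) -> ideal_pow m A k (\prod_i F i).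
Proof.
elim: k F => [|k IH] F AF; first by rewrite big_ord0; exact: ringO1.
by rewrite big_ord_recl; apply: mem_ideal_mul => //; exact: IH.
Qed.

Lemma ideal_powX A k x : A x -> ideal_pow m A k (x ^+ k).
Proof.
by move=> Ax; rewrite -[k in x ^+ k]card_ord -prodr_const; exact: ideal_pow_prod.
Qed.

(** The k-th power of a generated module is spanned by the k-fold products of generators. The
    induction extends linearly in one factor at a time. *)
Lemma ideal_pow_generated_min S k T : submodule T ->
  (forall F : 'I_k -> C, (forall i, S (F i)) -> T (\prod_i F i)) ->
  ideal_pow m (generated m S) k `<=` T.
Proof.
elim: k T => [|k IH] T sT h.
  move=> x Ox; have := h (fun=> 0) (fun i : 'I_0 => False_ind _ (elimF idP (ltn0 i) (ltn_ord i))).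
  by rewrite big_ord0 -[x]mulr1 => T1; case: sT => _ _; exact.
apply: ideal_mul_min => // x y; move: x.
have hS x : S x -> ideal_pow m (generated m S) k `<=` [set y | T (x * y)].
  move=> Sx; apply: IH; first exact: submodule_scale.
  move=> F SF /=; pose G i := if unlift ord0 i is Some j then F j else x.
  have G0 : G ord0 = x by rewrite /G unlift_none.
  have GS j : G (lift ord0 j) = F j by rewrite /G liftK.
  have : T (\prod_i G i).
    by apply: h => i; rewrite /G; case: unliftP => [j|] _.
  by rewrite big_ord_recl G0 (eq_bigr F) // => i _; rewrite GS.
move=> + + py; apply: generated_min => [|x Sx]; last exact: hS.
have [T0 TD TZ] := sT; split=> /=; first by rewrite mul0r.
  by move=> a b ? ?; rewrite mulrDl; exact: TD.
by move=> a b ? ?; rewrite -mulrA; exact: TZ.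
Qed.

Lemma generated_id A : submodule A -> generated m A = A.
Proof. exact: smallest_id. Qed.

End Submodules.

(** * Integrality criterion for the extended group *)

Section Delta.

Variables (R : realType) (m n : nat).
Hypothesis n_gt0 : (0 < n)%N.
Local Notation C := (Cplx R).
Local Notation K := (@imquad R m).
Local Notation O := (@ringO R m).
Local Notation SU := (SU R n).
Local Notation Gamma := (hermitian_modular R m n).
Local Notation Delta := (Delta R m n).
Implicit Types M N L : 'M[C]_(n + n).

Definition pair_integral k (M : 'M[C]_k) : Prop :=
  forall i a j b, O (M i a * (M j b)^*).

Definition prod_integral k (M : 'M[C]_k) : Prop :=
  forall f g : 'I_n -> 'I_k, O (\prod_i M (f i) (g i)).

Lemma ringO_jsign (i : 'I_(n + n)) z : O z -> O (jsign R i * z).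
Proof. exact: ringO_sign. Qed.

(** L satisfies the unitary equation with J scaled by |u|^2; any nonzero entry of J then writes
    |u|^2 as an integral expression in the entries of L. *)
Lemma Delta_rep_norm L u : Delta_rep m L u ->
  exists2 k : int, u * u^* = k%:~R & (k%:~R : C) != 0.
Proof.
move=> [iL u0 _ _ [_ h]].
have nu0 : u * u^* != 0 by rewrite mulf_neq0 ?conjC_eq0.
have {}h : cadj L *m mxJ R n *m L = (u * u^*) *: mxJ R n.
  transitivity ((u * u^*) *: (cadj (u^-1 *: L) *m mxJ R n *m (u^-1 *: L))).
    rewrite cadjZ -!scalemxAl -scalemxAr !scalerA conjCV.
    suff -> : u * u^* / u^* / u = 1 by rewrite scale1r.
    by field; rewrite conjC_eq0 u0.
  by rewrite -[in RHS]h.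
pose i := lshift n (Ordinal n_gt0).
have : O (u * u^*).
  have := congr1 (fun A : 'M[C]__ => A (swap i) i) h.
  rewrite [in X in _ = X -> _]mxE mxJE swapK eqxx mulr1 jsign_swap jsign_lshift opprK mulr1 => <-.
  rewrite -mulmxA mxE; apply: ringO_sum => k _; apply: ringOM.
    by rewrite cadjE; apply: ringO_conj; exact: iL.
  by rewrite mulJmx; apply: ringO_jsign; exact: iL.
move=> /ringO_real[|k hk]; first by rewrite conjCM conjCK mulrC.
by exists k; rewrite -?hk.
Qed.

(** Membership in [Delta] stated without a representation L/u. *)
Definition good M : Prop := [/\ SU M, pair_integral M & prod_integral M].

Lemma good_Delta_rep L u : Delta_rep m L u -> good (u^-1 *: L).
Proof.
move=> rep; have [k hk k0] := Delta_rep_norm rep.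
have [iL u0 Ou hI SL] := rep.
have un0 : u ^+ n != 0 by rewrite expf_neq0.
have powO x : ideal_pow m (entry_ideal m L) n x -> O ((u ^+ n)^-1 * x).
  by rewrite -hI => [[y Oy <-]]; rewrite mulKf.
have entry i a : entry_ideal m L (L i a) by apply: mem_generated; exists i, a.
split=> //.
- move=> i a j b; rewrite !mxE.
  (* The pair product lies in K because |u|^2 is an integer, and its n-th power is integral because
     x^n / u^n is integral for every entry x of L. *)
  apply: (@ringO_root _ _ _ n) => //.
    have -> : u^-1 * L i a * (u^-1 * L j b)^* = L i a * (L j b)^* / k%:~R.
      by rewrite conjCM conjCV -hk; field; rewrite conjC_eq0 u0.
    apply: imquad_div; last exact: imquad_int.
    by apply: imquadM; last apply: imquad_conj; apply: ringO_imquad; exact: iL.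
  rewrite exprMn -conjCX !exprMn; apply: ringOM; last apply: ringO_conj;
    by rewrite exprVn; apply: powO; exact: ideal_powX.
- move=> f g; under eq_bigr do rewrite mxE.
  rewrite big_split /= prodr_const card_ord exprVn; apply: powO.
  exact: ideal_pow_prod.
Qed.

Lemma SU_entry_neq0 M : SU M -> exists i j, M i j != 0.
Proof.
move=> SM; apply: contrapT => h.
have M0 : M = 0.
  by apply/matrixP => i j; rewrite mxE; apply/eqP/negPn/negP => nz; apply: h; exists i, j.
have := SM.1; rewrite M0 -(scale0r (1%:M : 'M[C]_(n + n))) detZ.
rewrite expr0n addn_eq0 andbb (gtn_eqF n_gt0) mul0r => /eqP.
by rewrite eq_sym oner_eq0.
Qed.

(** The conjugate u of any nonzero entry works: uM is integral by the pair condition. For u^n in the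
    n-th power of the entry ideal, expand u^n det M: in each term n entries absorb the factors u,
    and the product of the other n entries is an integral coefficient. *)
Lemma Delta_rep_good M i j : good M -> M i j != 0 ->
  Delta_rep m ((M i j)^* *: M) (M i j)^*.
Proof.
move=> [SM pM qM] Mij; set u := (M i j)^*.
have u0 : u != 0 by rewrite conjC_eq0.
have un0 : u ^+ n != 0 by rewrite expf_neq0.
have Oun : O (u ^+ n).
  rewrite -conjCX; apply: ringO_conj; rewrite -[n in _ ^+ n]card_ord -prodr_const.
  exact: qM (fun=> i) (fun=> j).
split=> //.
- by move=> a b; rewrite mxE mulrC; exact: pM.
- apply/seteqP; split.
    move=> _ [x Ox <-]; have [_ _ PZ] := submodule_ideal_pow m (entry_ideal m (u *: M)) n.
    rewrite mulrC; apply: (PZ) => //; rewrite -[u ^+ n]mulr1 -SM.1 /determinant mulr_sumr.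
    apply: submodule_sum; first exact: submodule_ideal_pow.
    move=> s _; rewrite big_split_ord /=.
    set A := \prod_(k < n) M (lshift n k) _; set B := \prod_(k < n) _.
    have -> : u ^+ n * ((-1) ^+ s * (A * B)) = ((-1) ^+ s * B) * (u ^+ n * A).
      by rewrite mulrA mulrACA mulrC.
    apply: PZ; first by apply: ringO_sign; exact: qM.
    rewrite -[n in u ^+ n]card_ord -prodr_const -big_split /=.
    apply: ideal_pow_prod => k; apply: mem_generated.
    by exists (lshift n k), (s (lshift n k)); rewrite mxE.
  apply: ideal_pow_generated_min.
    by apply: submodule_dilate => //; exact: submodule_ringO.
  move=> F hF; have [f hf] := fin_all_exists hF; have [g hg] := fin_all_exists hf.
  exists (\prod_k M (f k) (g k)); first exact: qM.
  rewrite -[n in u ^+ n]card_ord -prodr_const -big_split /=.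
  by apply: eq_bigr => k _; rewrite hg mxE.
- by rewrite scalerA mulVf // scale1r.
Qed.

Lemma DeltaP M : Delta M <-> good M.
Proof.
split=> [[L [u [rep ->]]]|gM]; first exact: good_Delta_rep.
have [i [j Mij]] := SU_entry_neq0 (let: And3 h _ _ := gM in h).
exists ((M i j)^* *: M), (M i j)^*; split; first exact: Delta_rep_good.
by rewrite scalerA mulVf ?scale1r // conjC_eq0.
Qed.

Lemma good_Gamma M : Gamma M -> good M.
Proof.
move=> [SM iM]; split=> // [i a j b|f g].
  by apply: ringOM; [|apply: ringO_conj]; exact: iM.
by apply: ringO_prod => i _; exact: iM.
Qed.

Lemma good1 : good 1%:M.
Proof.
apply: good_Gamma; split; first exact: SU1.
by move=> i j; rewrite mxE; exact: ringO_nat.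
Qed.

Lemma pair_integralM M N : pair_integral M -> pair_integral N -> pair_integral (M *m N).
Proof.
move=> pM pN i a j b; rewrite !mxE conjC_sum big_distrlr /=.
apply: ringO_sum => k _; apply: ringO_sum => l _.
by rewrite conjCM mulrACA; apply: ringOM.
Qed.

Lemma prod_integralM M N : prod_integral M -> prod_integral N -> prod_integral (M *m N).
Proof.
move=> qM qN f g; under eq_bigr do rewrite mxE.
rewrite bigA_distr_bigA /=; apply: ringO_sum => h _.
by rewrite big_split /=; apply: ringOM; [exact: qM|exact: qN].
Qed.

Lemma goodM M N : good M -> good N -> good (M *m N).
Proof.
move=> [SM pM qM] [SN pN qN]; split; first exact: SUM.
  exact: pair_integralM.
exact: prod_integralM.
Qed.

Lemma goodV M : good M -> good (invmx M).
Proof.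
move=> [SM pM qM]; split; first exact: SUV.
  move=> i a j b; rewrite !SU_invmxE // conjCM conjCK conjCM !conj_jsign.
  rewrite mulrACA -!mulrA; do 4 apply: ringO_jsign.
  by rewrite mulrC; exact: pM.
move=> f g; under eq_bigr do rewrite SU_invmxE //.
rewrite big_split /=; apply: ringOM.
  by apply: ringO_prod => i _; apply: ringO_jsign; rewrite -[jsign _ _]mulr1; apply: ringO_jsign; exact: ringO1.
rewrite -conjC_prod; apply: ringO_conj; exact: (qM (fun i => swap (g i)) (fun i => swap (f i))).
Qed.

Lemma Delta_subgroup : subgroup_of SU Delta.
Proof.
split=> [M /DeltaP[]//||M N /DeltaP gM /DeltaP gN|M /DeltaP gM]; apply/DeltaP.
- exact: good1.
- exact: goodM.
- exact: goodV.
Qed.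

Lemma Gamma_sub_Delta : Gamma `<=` Delta.
Proof. by move=> M /good_Gamma /DeltaP. Qed.

End Delta.

(** * Pairwise integrality implies integrality of n-fold products *)

(** (A, B) is a coprime symmetric pair. S is built to have its image complementary to that of A, so
    a kernel vector x of A + SB satisfies Ax = 0 and SBx = 0; symmetry then gives Bx = 0 and
    coprimality x = 0. Over a small finite field no scalar S need work. *)
Lemma symmetric_translate (F : fieldType) (n : nat) (A B P Q : 'M[F]_n) (f : F) :
  f != 0 -> A^T *m B = B^T *m A -> P *m A + Q *m B = f%:M ->
  exists2 S : 'M[F]_n, S^T = S & \det (A + S *m B) != 0.
Proof.
move=> f0 sAB PQ; set r := \rank A; set L := col_ebase A; set U := row_ebase A.
have LU : L *m pid_mx r *m U = A by exact: mulmx_ebase.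
have uL : L \in unitmx by exact: col_ebase_unit.
have uU : U \in unitmx by exact: row_ebase_unit.
exists (L *m copid_mx r *m L^T).
  rewrite !trmx_mul trmxK mulmxA; congr (_ *m _ *m _).
  by rewrite /copid_mx linearB /= trmx1 tr_pid_mx.
rewrite -det_tr; apply/negP => /det0P[v v0 hv]; move/negP: v0; apply.
have {hv} hx : (A + L *m copid_mx r *m L^T *m B) *m v^T = 0.
  by apply: trmx_inj; rewrite trmx_mul trmxK hv trmx0.
set x := v^T in hx; suff x0 : x = 0 by rewrite -[v]trmxK -/x x0 trmx0.
have hx2 : (pid_mx r : 'M_n) *m (U *m x) + copid_mx r *m (L^T *m B *m x) = 0.
  apply: (can_inj (mulKmx uL)); rewrite mulmx0 -[RHS]hx [in RHS]mulmxDl [in LHS]mulmxDr.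
  by congr (_ + _); rewrite -?[in X in _ = X *m _]LU !mulmxA.
have rn : (r <= n)%N by exact: rank_leq_row.
have px : (pid_mx r : 'M_n) *m (U *m x) = 0.
  move: hx2; move: (U *m x) (L^T *m B *m x) => y z h.
  have := congr1 (fun t : 'cV_n => (pid_mx r : 'M_n) *m t) h.
  rewrite mulmx0 mulmxDr !mulmxA pid_mx_id //.
  by rewrite mul_pid_mx_copid // mul0mx addr0.
have Ax : A *m x = 0 by rewrite -LU -!mulmxA px mulmx0.
have cx : copid_mx r *m (L^T *m B *m x) = 0 by move: hx2; rewrite px add0r.
have qx : (pid_mx r : 'M_n) *m (L^T *m B *m x) = 0.
  have uUT : U^T \in unitmx by rewrite unitmx_tr.
  apply: (can_inj (mulKmx uUT)); rewrite mulmx0.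
  transitivity (A^T *m B *m x); last by rewrite sAB -mulmxA Ax mulmx0.
  by rewrite -[X in _ = X^T *m _ *m _]LU !trmx_mul tr_pid_mx !mulmxA.
have Bx : B *m x = 0.
  have uLT : L^T \in unitmx by rewrite unitmx_tr.
  apply: (can_inj (mulKmx uLT)); rewrite mulmx0 mulmxA.
  by rewrite -[LHS]mul1mx -[1%:M](subrK (pid_mx r)) [LHS]mulmxDl -/(copid_mx r) cx qx addr0.
apply: (@scalerI _ _ f) => //; rewrite scaler0 -mul_scalar_mx -PQ mulmxDl.
by rewrite -!mulmxA Ax Bx !mulmx0 addr0.
Qed.

Lemma nat_square_of_logn (e : nat) : (0 < e)%N ->
  (forall p, prime p -> ~~ odd (logn p e)) -> exists z, e = (z * z)%N.
Proof.
move=> e0 h; exists (\prod_(p <- primes e) p ^ (logn p e)./2)%N.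
rewrite -big_split /= {1}(prod_prime_decomp e0) prime_decompE big_map /=.
rewrite big_seq [RHS]big_seq; apply: eq_bigr => p; rewrite mem_primes => /andP[pp _].
by rewrite -expnD addnn -{1}(odd_double_half (logn p e)) (negPf (h p pp)).
Qed.

Lemma logn_absz_sqr (p : nat) (x : int) :
  logn p `|x ^+ 2|%N = (logn p `|x|%N).*2.
Proof. by rewrite abszX lognX mul2n. Qed.

(** * Reduction of integral matrices modulo a ramified prime *)

Section Residue.

Variables (R : realType) (m p : nat) (rho : Cplx R -> 'F_p).
Hypothesis rhoP : residue_hom m rho.
Local Notation C := (Cplx R).
Local Notation O := (@ringO R m).

Lemma residue_sum (I : Type) (r : seq I) (P : pred I) (F : I -> C) :
  (forall i, O (F i)) -> rho (\sum_(i <- r | P i) F i) = \sum_(i <- r | P i) rho (F i).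
Proof.
move=> h; have [r0 rD _ _] := rhoP.
suff [_ //] : O (\sum_(i <- r | P i) F i) /\
  rho (\sum_(i <- r | P i) F i) = \sum_(i <- r | P i) rho (F i).
elim/big_rec2: _ => [|i x y _ [Oy <-]]; first by split; [exact: ringO0|exact: (r0 0)].
by split; [exact: ringOD|rewrite rD].
Qed.

Lemma residue_prod (I : Type) (r : seq I) (P : pred I) (F : I -> C) :
  (forall i, O (F i)) -> rho (\prod_(i <- r | P i) F i) = \prod_(i <- r | P i) rho (F i).
Proof.
move=> h; have [r0 _ rM _] := rhoP.
suff [_ //] : O (\prod_(i <- r | P i) F i) /\
  rho (\prod_(i <- r | P i) F i) = \prod_(i <- r | P i) rho (F i).
elim/big_rec2: _ => [|i x y _ [Oy <-]]; first by split; [exact: ringO1|exact: (r0 1)].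
by split; [exact: ringOM|rewrite rM].
Qed.

Lemma residue_det k (A : 'M[C]_k) : integral_mx m A ->
  rho (\det A) = \det (map_mx rho A).
Proof.
move=> iA; have [r0 _ rM _] := rhoP; rewrite /determinant residue_sum => [|s].
  apply: eq_bigr => s _; rewrite rM; last 2 first.
  - by rewrite -[_ ^+ _]mulr1; apply: ringO_sign; exact: ringO1.
  - exact: ringO_prod.
  rewrite residue_prod; last by [].
  congr (_ * _); last by apply: eq_bigr => i _; rewrite mxE.
  by case: (odd_perm s); rewrite ?expr1 ?expr0; [exact: (r0 (-1))|exact: (r0 1)].
by apply: ringO_sign; exact: ringO_prod.
Qed.

Lemma residue_mulmx k l q (A : 'M[C]_(k, l)) (B : 'M[C]_(l, q)) :
  (forall i j, O (A i j)) -> (forall i j, O (B i j)) ->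
  map_mx rho (A *m B) = map_mx rho A *m map_mx rho B.
Proof.
move=> iA iB; have [_ _ rM _] := rhoP; apply/matrixP => i j; rewrite !mxE.
rewrite residue_sum => [|a]; last exact: ringOM.
by apply: eq_bigr => a _; rewrite !mxE rM.
Qed.

Lemma residue_cadj k l (A : 'M[C]_(k, l)) : (forall i j, O (A i j)) ->
  map_mx rho (cadj A) = (map_mx rho A)^T.
Proof.
by move=> iA; have [_ _ _ rc] := rhoP; apply/matrixP => i j; rewrite !mxE rc.
Qed.

End Residue.

(** * The determinant of the upper left block *)

Section Corner.

Variables (R : realType) (m n : nat).
Hypothesis n_gt0 : (0 < n)%N.
Local Notation C := (Cplx R).
Local Notation O := (@ringO R m).
Local Notation SU := (SU R n).
Local Notation Gamma := (hermitian_modular R m n).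
Implicit Types M N : 'M[C]_(n + n).

Definition corner M : C := \det (ulsubmx M).

Definition translation (S : 'M[int]_n) : 'M[C]_(n + n) :=
  block_mx 1%:M (map_mx intr S) 0 1%:M.

Lemma cadj_block (A B D E : 'M[C]_n) :
  cadj (block_mx A B D E) = block_mx (cadj A) (cadj D) (cadj B) (cadj E).
Proof. by rewrite /cadj map_block_mx tr_block_mx. Qed.

Lemma Gamma_translation S : S^T = S -> Gamma (translation S).
Proof.
move=> sS; split; last first.
  move=> i j; case: (shiftP i) => k; case: (shiftP j) => l;
    rewrite ?block_mxEul ?block_mxEur ?block_mxEdl ?block_mxEdr !mxE.
  - exact: ringO_nat.
  - exact: ringO_int.
  - exact: ringO0.
  - exact: ringO_nat.
split; first by rewrite det_ublock !det1 mulr1.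
rewrite -/(cadj _) cadj_block !cadj1.
have -> : cadj (0 : 'M[C]_n) = 0 by rewrite /cadj map_mx0 trmx0.
have -> : cadj (map_mx intr S : 'M[C]_n) = map_mx intr S.
  by apply/matrixP => i j; rewrite cadjE !mxE conjC_int -[in RHS]sS mxE.
rewrite /mxJ !mulmx_block !(mul0mx, mulmx0, mul1mx, mulmx1, addr0, add0r).
by rewrite mulmxN !mulmx1 subrr.
Qed.

Lemma ulsubmx_translation S M :
  ulsubmx (translation S *m M) = ulsubmx M + map_mx intr S *m dlsubmx M.
Proof. by rewrite -[M in LHS]submxK mulmx_block block_mxKul mul1mx. Qed.

Lemma SU_ul_dl M : SU M ->
  cadj (ulsubmx M) *m dlsubmx M = cadj (dlsubmx M) *m ulsubmx M.
Proof.
move=> [_]; rewrite -/(cadj _) -[M in cadj M]submxK -[M in _ *m M]submxK.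
move: (ulsubmx M) (ursubmx M) (dlsubmx M) (drsubmx M) => A B D E.
rewrite cadj_block /mxJ !mulmx_block.
rewrite !(mul0mx, mulmx0, mul1mx, mulmx1, addr0, add0r, mulmxN, mulNmx).
by move=> /eq_block_mx[/eqP + _ _ _]; rewrite subr_eq0 => /eqP.
Qed.

(** The unitary relations reduce M, multiplied by an upper triangular block matrix of determinant
    det A^*, to a lower triangular one of determinant det A; here A is the upper left block and det
    M = 1. *)
Lemma corner_real M : SU M -> (corner M)^* = corner M.
Proof.
move=> SM; pose M' := block_mx (ulsubmx M) (ursubmx M) (dlsubmx M) (drsubmx M).
have : \det M' = 1 by rewrite /M' submxK; exact: SM.1.
have : M' *m mxJ R n *m cadj M' = mxJ R n by rewrite /M' submxK; exact: SU_cadj.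
rewrite /M' /corner {M'}.
move: (ulsubmx M) (ursubmx M) (dlsubmx M) (drsubmx M) => A B D E + dM.
rewrite cadj_block /mxJ !mulmx_block.
rewrite !(mul0mx, mulmx0, mul1mx, mulmx1, addr0, add0r, mulmxN, mulNmx).
move=> /eq_block_mx[h1 _ h2 _].
have e : block_mx A B D E *m block_mx 1%:M (- cadj B) 0 (cadj A) = block_mx A 0 D 1%:M.
  by rewrite mulmx_block !(mul0mx, mulmx0, mulmx1, addr0, add0r, mulmxN) addrC h1 addrC h2.
have := congr1 determinant e; rewrite det_mulmx dM mul1r det_ublock det_lblock !det1.
by rewrite mul1r mulr1 => h; rewrite -[RHS]h /cadj det_tr det_map_mx.
Qed.

(** The polynomial det (A + zD) does not vanish at z = i: for a kernel vector x, the symmetry of A^*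
    D makes the norm of Dx zero, so Ax = Dx = 0 against invertibility of M. Hence it is nonzero at
    some natural number k, and S = k is a scalar matrix. *)
Lemma corner_neq0 M : SU M -> exists S : 'M[int]_n,
  S^T = S /\ corner (translation S *m M) != 0.
Proof.
move=> SM; set A := ulsubmx M; set D := dlsubmx M.
pose P : {poly C} := \det (map_mx polyC A + 'X *: map_mx polyC D).
have PE z : P.[z] = \det (A + z *: D).
  rewrite -horner_evalE -det_map_mx; congr (\det _); apply/matrixP => i j.
  transitivity (((A i j)%:P + 'X * (D i j)%:P).[z]); first by rewrite !mxE.
  by rewrite !hornerE [RHS]mxE [X in _ = _ + X]mxE.
have Pi : P.['i] != 0.
  rewrite PE -det_tr; apply/negP => /det0P[v v0 hv]; move/negP: v0; apply.
  have {hv} hx : (A + 'i *: D) *m v^T = 0.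
    by apply: trmx_inj; rewrite trmx_mul trmxK hv trmx0.
  set x := v^T in hx; suff x0 : x = 0 by rewrite -[v]trmxK -/x x0 trmx0.
  have Ax : A *m x = - 'i *: (D *m x).
    by apply/eqP; rewrite scaleNr -addr_eq0 scalemxAl -mulmxDl hx.
  have Dx : D *m x = 0.
    have e1 : cadj (A *m x) *m (D *m x) = cadj (D *m x) *m (A *m x).
      by rewrite !cadjM !mulmxA -(mulmxA (cadj x)) (SU_ul_dl SM) !mulmxA.
    have {e1} : cadj (D *m x) *m (D *m x) = 0.
      move: e1; rewrite Ax cadjZ -scalemxAl -scalemxAr conjCN conjCi opprK scaleNr.
      move/eqP; rewrite -addr_eq0 -mulr2n -scaler_nat scalerA scaler_eq0.
      by rewrite mulf_eq0 pnatr_eq0 /= (negPf (neq0Ci _)) /= => /eqP.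
    move=> e0; apply/matrixP => i j; rewrite ord1 [RHS]mxE.
    have /eqP := congr1 (fun X : 'M[C]_1 => X 0 0) e0; rewrite [X in _ == X]mxE mxE.
    under eq_bigr do rewrite cadjE -normCKC.
    rewrite psumr_eq0 => [/allP/(_ i (mem_index_enum _))|k _]; last exact: exprn_ge0.
    by rewrite /= sqrf_eq0 normr_eq0 => /eqP.
  have {}Ax : A *m x = 0 by rewrite Ax Dx scaler0.
  have Mx : M *m col_mx x 0 = 0.
    by rewrite -[M]submxK mul_block_col !mulmx0 !addr0 -/A -/D Ax Dx col_mx0.
  have : col_mx x 0 = 0 :> 'cV_(n + n).
    by apply: (can_inj (mulKmx (SU_unitmx SM))); rewrite Mx mulmx0.
  by rewrite -col_mx0 => /eq_col_mx[].
have P0 : P != 0 by apply: contraNneq Pi => ->; rewrite horner0.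
have [k Pk] : exists k : nat, P.[k%:R] != 0.
  apply: contrapT => nk.
  have hr : all (root P) [seq k%:R | k <- iota 0 (size P)].
    apply/allP => _ /mapP[k _ ->]; apply/negPn/negP => h; apply: nk.
    by exists k.
  have := max_poly_roots P0 hr; rewrite size_map size_iota ltnn.
  by move=> h; have : false by apply: h; rewrite map_inj_uniq ?iota_uniq //; exact: mulrIn (oner_neq0 _).
exists (k%:Z)%:M; split; first exact: tr_scalar_mx.
rewrite /corner ulsubmx_translation map_scalar_mx mul_scalar_mx.
by move: Pk; rewrite PE.
Qed.

Definition cross_integral k l (A B : 'M[C]_(k, l)) : Prop :=
  forall i a j b, O (A i a * (B j b)^*).

Lemma det_cross_integral k (A B : 'M[C]_k) :
  cross_integral A B -> O (\det A * (\det B)^*).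
Proof.
move=> h; rewrite /determinant conjC_sum big_distrlr /=.
apply: ringO_sum => s _; apply: ringO_sum => t _.
rewrite conjCM mulrACA rmorphXn /= conjCN conjC1 -mulrA; do 2 apply: ringO_sign.
by rewrite conjC_prod -big_split /=; apply: ringO_prod.
Qed.

Lemma pair_integral_Gamma_cross M N N' : pair_integral m M -> Gamma N -> Gamma N' ->
  cross_integral (N *m M) (N' *m M).
Proof.
move=> pM [_ iN] [_ iN'] i a j b; rewrite !mxE conjC_sum big_distrlr /=.
apply: ringO_sum => k _; apply: ringO_sum => l _.
by rewrite conjCM mulrACA; apply: ringOM; [apply: ringOM => //; exact: ringO_conj|].
Qed.

(** Each Leibniz term of the conjugated corner has n factors, one for each factor of the product. *)
Lemma prod_cross_det M (f g : 'I_n -> 'I_(n + n)) : pair_integral m M ->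
  O (\prod_i M (f i) (g i) * (corner M)^*).
Proof.
move=> pM; rewrite /corner /determinant conjC_sum mulr_sumr.
apply: ringO_sum => s _; rewrite conjCM rmorphXn /= conjCN conjC1 mulrCA.
apply: ringO_sign; rewrite conjC_prod -big_split /=; apply: ringO_prod => i _.
by rewrite mxE mxE; exact: pM.
Qed.

(* 1 is the conjugate of det M, a signed sum of products of 2n entries. *)
Lemma SU_det_expand M (y : C) (T : set C) : SU M -> submoduleO m T ->
  (forall f g f' g' : 'I_n -> 'I_(n + n),
     T (y * ((\prod_i M (f i) (g i))^* * (\prod_i M (f' i) (g' i))^*))) -> T y.
Proof.
move=> [dM _] sT h; have -> : y = y * (\det M)^* by rewrite dM conjC1 mulr1.
rewrite /determinant conjC_sum mulr_sumr; apply: (@submodule_sum _ m) => // s _.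
rewrite conjCM mulrCA big_split_ord /= conjCM.
have [_ _ TZ] := sT; apply: TZ; last exact: h.
by apply: ringO_conj; rewrite -[_ ^+ _]mulr1; apply: ringO_sign; exact: ringO1.
Qed.

Lemma prod_sqr_integral M (f g : 'I_n -> 'I_(n + n)) : SU M -> pair_integral m M ->
  O ((\prod_i M (f i) (g i)) ^+ 2).
Proof.
move=> SM pM; apply: (SU_det_expand SM (submodule_ringO _ _)) => f1 g1 f2 g2.
rewrite expr2 mulrACA; apply: ringOM; rewrite conjC_prod -big_split /=;
  by apply: ringO_prod => i _; exact: pM.
Qed.

End Corner.

Section GoodOfPair.

Variables (R : realType) (m n : nat) (d : int).
Hypotheses (m_gt0 : (0 < m)%N) (hd : is_discriminant R m d) (n_gt0 : (0 < n)%N).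
Local Notation C := (Cplx R).
Local Notation K := (@imquad R m).
Local Notation O := (@ringO R m).
Local Notation SU := (SU R n).
Local Notation Gamma := (hermitian_modular R m n).
Implicit Types M N : 'M[C]_(n + n).

Lemma ringO_div_nat (a : int) (k : nat) : (0 < k)%N ->
  O (a%:~R / k%:R) -> (k%:Z %| a)%Z.
Proof.
move=> k0 Oak; have k0C : (k%:R : C) != 0 by rewrite pnatr_eq0 -lt0n.
have [|j hj] := ringO_real Oak.
  by rewrite conjCM conjCV conjC_int (conjC_int _ k).
apply/dvdzP; exists j; apply/eqP; rewrite -(eqr_int C) rmorphM /= -hj.
by rewrite -pmulrn divfK.
Qed.

Lemma corner_sqr_int M : SU M -> pair_integral m M ->
  exists e : int, corner M * corner M = e%:~R.
Proof.
move=> SM pM; have rM := corner_real SM.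
apply: (@ringO_real _ m); last by rewrite conjCM rM.
rewrite -{2}rM; apply: det_cross_integral => i a j b.
by rewrite !mxE; exact: pM.
Qed.

(** * Excluding primes of odd valuation in the square of the corner *)

Section OddPrime.

Variables (M : 'M[C]_(n + n)) (e : int) (p l : nat).
Hypotheses (SM : SU M) (pM : pair_integral m M) (M0 : corner M != 0).
Hypotheses (eE : corner M * corner M = e%:~R) (pp : prime p).
Hypothesis le : logn p `|e|%N = l.*2.+1.

Let p_gt0 : (0 < p)%N. Proof. exact: prime_gt0. Qed.
Let pC0 : (p%:R : C) != 0. Proof. by rewrite pnatr_eq0 -lt0n. Qed.

Let e0 : e != 0.
Proof. by rewrite -(intr_eq0 C) -eE mulf_neq0. Qed.

Lemma dvd_logn (k : nat) (x : int) : x != 0 ->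
  ((p ^ k)%N%:Z %| x)%Z = (k <= logn p `|x|%N)%N.
Proof. by move=> x0; rewrite dvdzE /= pfactor_dvdn // absz_gt0. Qed.

(** Otherwise expanding det M = 1 would put e / p^(2l + 2) into O, although e has valuation 2l +
    1. *)
Lemma exists_product_ndvd : exists f g : 'I_n -> 'I_(n + n),
  ~ O (corner M * (\prod_(i < n) M (f i) (g i))^* / p%:R ^+ l.+1).
Proof.
apply: contrapT => h.
have Ow (f g : 'I_n -> 'I_(n + n)) : O (corner M * (\prod_(i < n) M (f i) (g i))^* / p%:R ^+ l.+1).
  by apply: contrapT => nO; apply: h; exists f, g.
have : O (e%:~R / (p ^ (l.+1 + l.+1))%:R).
  apply: (SU_det_expand SM (submodule_ringO _ _)) => f g f' g'.
  set w := (\prod_i _)^*; set w' := (\prod_i _)^*.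
  have -> : e%:~R / (p ^ (l.+1 + l.+1))%:R * (w * w') =
      (corner M * w / p%:R ^+ l.+1) * (corner M * w' / p%:R ^+ l.+1).
    rewrite -eE natrX exprD; move: w w' (corner M) (p%:R ^+ l.+1) (expf_neq0 l.+1 pC0).
    by move=> w w' r q q0; field.
  by apply: ringOM; exact: Ow.
move=> /ringO_div_nat; rewrite expn_gt0 p_gt0 => /(_ isT).
by rewrite dvd_logn // le addnn doubleS ltnn.
Qed.

(** For y = r w^* with r the corner, the trace T satisfies T^2 = e (tr w^2 + 2|w|^2) and the norm is
    e |w|^2, so p^(l+1) divides T and p^(2l+1) divides the norm. Dividing y by the largest power of
    p that keeps it integral, at most p^l, leaves both divisible by p. *)
Lemma exists_residue_hom : exists rho : C -> 'F_p, residue_hom m rho.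
Proof.
have [f [g hy]] := exists_product_ndvd.
set w := \prod_(i < n) M (f i) (g i) in hy; set y := corner M * w^* in hy.
have rr := corner_real SM.
have Oy : O y.
  have := ringO_conj (prod_cross_det f g pM); rewrite conjCM conjCK mulrC.
  by rewrite -/w /y.
have Ow2 : O (w ^+ 2) by exact: prod_sqr_integral.
have Oww : O (w * w^*).
  rewrite conjC_prod /w -big_split /=; apply: ringO_prod => i _; exact: pM.
have [T hT] := ringO_trace Oy.
have [j hj] : exists j : int, w * w^* = j%:~R.
  by apply: (@ringO_real _ m) => //; rewrite conjCM conjCK mulrC.
have [j2 hj2] := ringO_trace Ow2.
have hN : y * y^* = (e * j)%:~R.
  by rewrite /y conjCM conjCK rr rmorphM /= -eE -hj; ring.
have hT2 : T ^+ 2 = e * (j2 + 2 * j).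
  apply/eqP; rewrite -(eqr_int C) rmorphXn rmorphM rmorphD rmorphM /= -hT -eE -hj -hj2.
  by rewrite /y conjCX conjCM conjCK rr; apply/eqP; ring.
have pT : ((p ^ l.+1)%N%:Z %| T)%Z.
  have [->|T0] := eqVneq T 0; first exact: dvdz0.
  rewrite dvd_logn //.
  have : ((p ^ l.*2.+1)%N%:Z %| T ^+ 2)%Z.
    by rewrite hT2; apply: dvdz_mulr; rewrite dvd_logn // le.
  by rewrite dvd_logn ?expf_neq0 // logn_absz_sqr ltn_double.
have exk : exists k, ~~ `[< O (y / p%:R ^+ k) >] by exists l.+1; apply/asboolPn.
have [k /asboolPn nk kmin] := ex_minnP exk.
have k0 : (0 < k)%N.
  by rewrite lt0n; apply/eqP => k0; apply: nk; rewrite k0 expr0 divr1.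
have kl : (k.-1 <= l)%N by rewrite -ltnS prednK // kmin //; apply/asboolPn.
set y' := y / p%:R ^+ k.-1.
have Oy' : O y'.
  apply: contrapT => nO; have := kmin k.-1; rewrite leqNgt prednK // leqnn => h.
  by have := h (introT (asboolPn _) nO).
have nOy' : ~ O (y' / p%:R).
  move=> h; apply: nk; move: h; rewrite /y' -mulrA -invfM -exprSr.
  by rewrite prednK.
have [T' hT'] := ringO_trace Oy'; have [N' hN'] := ringO_norm Oy'.
have pkC : (p%:R : C) ^+ k.-1 != 0 by rewrite expf_neq0.
have cp : ((p%:R : C) ^+ k.-1)^* = p%:R ^+ k.-1 by rewrite conjCX (conjC_int _ p).
have eT : T = (p ^ k.-1)%N%:Z * T'.
  apply/eqP; rewrite -(eqr_int C) rmorphM /= -hT' -hT /y' conjCM conjCV cp.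
  by rewrite -pmulrn natrX; apply/eqP; field.
have eN : e * j = (p ^ k.-1.*2)%N%:Z * N'.
  apply/eqP; rewrite -(eqr_int C) [X in _ == X]rmorphM /= -hN' -hN /y' conjCM conjCV cp.
  rewrite -pmulrn -addnn natrX exprD; apply/eqP.
  by move: (p%:R ^+ k.-1) pkC => q q0; field.
have [t0 ht0] : exists t0, T' = p%:Z * t0.
  move: pT; rewrite -(subnK kl) -addSn expnD mulnC eT PoszM dvdz_mul2l; last first.
    by rewrite eqz_nat -lt0n expn_gt0 p_gt0.
  rewrite expnS PoszM => h.
  have /dvdzP[q ->] := dvdz_trans (dvdz_mulr _ (dvdzz p%:Z)) h.
  by exists q; rewrite mulrC.
have [k1 hk1] : exists k1, N' = p%:Z * k1.
  have : ((p ^ l.*2.+1)%N%:Z %| e * j)%Z by apply: dvdz_mulr; rewrite dvd_logn // le.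
  rewrite -(subnK kl) doubleD -addSn expnD mulnC eN PoszM dvdz_mul2l; last first.
    by rewrite eqz_nat -lt0n expn_gt0 p_gt0.
  rewrite expnS PoszM => h.
  have /dvdzP[q ->] := dvdz_trans (dvdz_mulr _ (dvdzz p%:Z)) h.
  by exists q; rewrite mulrC.
apply: (residue_map m_gt0 hd pp Oy' nOy').
  by rewrite hT' ht0 rmorphM.
by rewrite hN' hk1 rmorphM.
Qed.

(** An entry or a sum of two entries serves as c. If p divided |x|^2 and |x + y|^2 for all entries
    x, y, then x y^* / p would have integral trace and norm, and the unitary equation would express
    -1/p as an element of O. *)
Lemma exists_multiplier : exists (c : C) (f : int),
  [/\ forall i j, O (M i j * c^*), c * c^* = f%:~R & ~~ (p%:Z %| f)%Z].
Proof.
apply: contrapT => h.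
have div c : (forall i j, O (M i j * c^*)) -> O (c * c^*) ->
    exists q : int, c * c^* = p%:R * q%:~R.
  move=> Oc /ringO_real[|f hf]; first by rewrite conjCM conjCK mulrC.
  have [/dvdzP[q hq]|nf] := boolP (p%:Z %| f)%Z; first by exists q; rewrite hf hq rmorphM mulrC.
  by case: h; exists c, f.
have single i a : exists q : int, M i a * (M i a)^* = p%:R * q%:~R by apply: div.
have double i a j b : exists q : int,
    (M i a + M j b) * (M i a + M j b)^* = p%:R * q%:~R.
  apply: div => [k l'|]; first by rewrite conjCD mulrDr; exact: ringOD.
  by rewrite conjCD mulrDl !mulrDr; do 3 ?apply: ringOD.
have pO i a j b : O (M i a * (M j b)^* / p%:R).
  have [q1 h1] := single i a; have [q2 h2] := single j b; have [q3 h3] := double i a j b.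
  have cp : ((p%:R : C))^* = p%:R by rewrite (conjC_int _ p).
  apply: (@ringO_trace_norm _ _ _ (q3 - q1 - q2) (q1 * q2)).
  - by apply: imquad_div; [apply: ringO_imquad; exact: pM|exact: (imquad_int _ _ p)].
  - rewrite conjCM conjCV cp conjCM conjCK !rmorphB /=.
    apply: (mulfI pC0); rewrite !mulrBr -h1 -h2 -h3 conjCD; field.
    exact: pC0.
  - rewrite conjCM conjCV cp conjCM conjCK rmorphM /=.
    apply: (mulfI pC0); apply: (mulfI pC0).
    transitivity ((M i a * (M i a)^*) * (M j b * (M j b)^*)); first by field.
    by rewrite h1 h2; ring.
pose i := lshift n (Ordinal n_gt0).
have : O (((-1)%:~R : C) / p%:R).
  have -> : ((-1)%:~R : C) = (cadj M *m mxJ R n *m M) i (swap i).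
    by rewrite SM.2 mxJE eqxx mulr1 jsign_lshift.
  rewrite -mulmxA mxE mulr_suml; apply: ringO_sum => k _.
  by rewrite mulJmx cadjE mulrCA -!mulrA; apply: ringO_jsign; rewrite mulrCA mulrA.
move=> /ringO_div_nat => /(_ p_gt0); rewrite dvdzE /= dvdn1 => /eqP p1.
by move: pp; rewrite p1.
Qed.

Lemma odd_prime_contradiction : False.
Proof.
have [rho rhoP] := exists_residue_hom; have [r0 _ rM rc] := rhoP.
have [c [f [Oc cf pf]]] := exists_multiplier.
pose L := c^* *: M.
have iL i j : O (L i j) by rewrite mxE mulrC; exact: Oc.
have iA i j : O (ulsubmx L i j) by rewrite mxE mxE; exact: iL.
have iD i j : O (dlsubmx L i j) by rewrite mxE mxE; exact: iL.
have f0 : (f%:~R : 'F_p) != 0 by rewrite intr_Fp_eq0.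
have hAD : cadj (ulsubmx L) *m dlsubmx L = cadj (dlsubmx L) *m ulsubmx L.
  have -> : ulsubmx L = c^* *: ulsubmx M by apply/matrixP => i j; rewrite !mxE.
  have -> : dlsubmx L = c^* *: dlsubmx M by apply/matrixP => i j; rewrite !mxE.
  by rewrite !cadjZ -!scalemxAl -!scalemxAr (SU_ul_dl SM).
have icadj (A : 'M[C]_n) : (forall i j, O (A i j)) -> forall i j, O (cadj A i j).
  by move=> h i j; rewrite cadjE; exact: ringO_conj.
(* As conjugation is trivial on residues, the Hermitian symmetry of the two blocks becomes symmetry
   for the transpose. *)
pose A := map_mx rho (ulsubmx L); pose D := map_mx rho (dlsubmx L).
have sAD : A^T *m D = D^T *m A.
  rewrite /A /D -!(residue_cadj rhoP) // -!(residue_mulmx rhoP) ?hAD //; exact: icadj.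
pose V := c *: invmx M.
have iV i j : O (V i j).
  rewrite mxE SU_invmxE // mulrCA -mulrA; do 2 apply: ringO_jsign.
  by rewrite -[c]conjCK mulrC -conjCM; apply: ringO_conj; exact: Oc.
have VL : V *m L = f%:~R%:M.
  by rewrite /V /L -scalemxAl -scalemxAr mulVmx ?SU_unitmx // scalerA cf scalemx1.
have PQ : map_mx rho (ulsubmx V) *m A + map_mx rho (ursubmx V) *m D = (f%:~R)%:M.
  rewrite /A /D -!(residue_mulmx rhoP) //; last 2 first.
  - by move=> i j; rewrite mxE mxE; exact: iV.
  - by move=> i j; rewrite mxE mxE; exact: iV.
  have e1 : ulsubmx V *m ulsubmx L + ursubmx V *m dlsubmx L = f%:~R%:M.
    have := congr1 ulsubmx VL; rewrite -{1}[V]submxK -{1}[L]submxK mulmx_block block_mxKul => ->.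
    by apply/matrixP => i j; rewrite !mxE eq_lshift.
  apply/matrixP => i j; have [_ rD _ _] := rhoP.
  have := congr1 (fun X : 'M[C]_n => X i j) e1; rewrite [X in X = _ -> _]mxE.
  rewrite [X in _ = X -> _]mxE => e2; rewrite [LHS]mxE [X in X + _]mxE [X in _ + X]mxE -rD; last 2 first.
  - by rewrite mxE; apply: ringO_sum => k _; rewrite mxE mxE; apply: ringOM.
  - by rewrite mxE; apply: ringO_sum => k _; rewrite mxE mxE; apply: ringOM.
  by rewrite e2 [RHS]mxE; case: eqP => _ /=; rewrite ?mulr1n ?mulr0n; [exact: r0|exact: (r0 0)].
have [S sS detS] := symmetric_translate f0 sAD PQ.
pose Sz : 'M[int]_n := map_mx (fun x : 'F_p => (x : nat)%:Z) S.
have sSz : Sz^T = Sz by apply/matrixP => i j; rewrite !mxE -{1}sS mxE.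
have GN : Gamma (translation R Sz) := Gamma_translation R m sSz.
set N := translation R Sz in GN.
have SNM : SU (N *m M) by apply: SUM => //; case: GN.
have pNM : pair_integral m (N *m M) by apply: pair_integralM => //; case: (good_Gamma GN).
have [e' eE'] := corner_sqr_int SNM pNM.
have rr' := corner_real SNM.
pose X := ulsubmx L + map_mx intr Sz *m dlsubmx L.
have iSzD i j : O ((map_mx intr Sz *m dlsubmx L) i j).
  by rewrite mxE; apply: ringO_sum => k _; apply: ringOM => //; rewrite mxE; exact: ringO_int.
have iX : integral_mx m X by move=> i j; rewrite mxE; exact: ringOD.
have mX : map_mx rho X = A + S *m D.
  have <- : map_mx rho (map_mx intr Sz) = S.
    by apply/matrixP => i j; rewrite !mxE r0; exact: natr_Zp.
  rewrite /D -(residue_mulmx rhoP) //; last by move=> i j; rewrite mxE; exact: ringO_int.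
  by have [_ rD _ _] := rhoP; apply/matrixP => i j; rewrite [LHS]mxE [X i j]mxE rD // [RHS]mxE /A !mxE.
have dX : \det X = c^* ^+ n * corner (N *m M).
  rewrite /corner -detZ; congr (\det _).
  have -> : X = ulsubmx (N *m L) by rewrite ulsubmx_translation.
  by rewrite /L -scalemxAr; apply/matrixP => i j; rewrite !mxE.
have OX : O (\det X).
  rewrite /determinant; apply: ringO_sum => s _; apply: ringO_sign.
  exact: ringO_prod.
have pe' : ~~ (p%:Z %| e')%Z.
  apply/negP => pe'; have : rho (\det X * (\det X)^*) != 0.
    by rewrite rM //; [rewrite rc // (residue_det rhoP) // mX mulf_neq0|exact: ringO_conj].
  have -> : \det X * (\det X)^* = (f ^+ n * e')%:~R.
    rewrite dX conjCM conjCX conjCK rr' mulrACA eE' -exprMn [_ * c]mulrC cf.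
    by rewrite rmorphM rmorphXn.
  by rewrite r0 intr_Fp_eq0 // => /negP; apply; exact: dvdz_mull.
have e'0 : e' != 0 by apply: contraNneq pe' => ->; exact: dvdz0.
(* The square of this integer is e' e, of odd valuation at p since p does not divide e'. *)
have [h hh] : exists h : int, corner (N *m M) * corner M = h%:~R.
  apply: (@ringO_real _ m); last by rewrite conjCM rr' (corner_real SM).
  rewrite -(corner_real SM); apply: det_cross_integral => i a j b; rewrite !mxE /=.
  have := pair_integral_Gamma_cross pM GN (_ : Gamma 1%:M); rewrite mul1mx => H.
  have G1 : Gamma 1%:M.
    by split; [exact: SU1|move=> k k'; rewrite mxE; exact: ringO_nat].
  by have := H G1 (lshift n i) (lshift n a) (lshift n j) (lshift n b); rewrite mxE.
have h2 : h ^+ 2 = e' * e.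
  apply/eqP; rewrite -(eqr_int C) rmorphXn rmorphM /= -hh -eE -eE'; apply/eqP; ring.
have := logn_absz_sqr p h; rewrite h2 abszM lognM ?absz_gt0 // le.
have -> : logn p `|e'|%N = 0%N.
  by apply/eqP; rewrite -leqn0 leqNgt -(dvd_logn 1) // expn1.
by rewrite add0n => /(congr1 odd); rewrite /= !odd_double.
Qed.

End OddPrime.

Lemma corner_int M : SU M -> pair_integral m M -> corner M != 0 ->
  exists z : int, corner M = z%:~R.
Proof.
move=> SM pM M0; have [e eE] := corner_sqr_int SM pM.
have e0 : e != 0 by rewrite -(intr_eq0 C) -eE mulf_neq0.
have rr := corner_real SM.
have ege : 0 <= e by rewrite -(ler0z C) -eE -{2}rr -normCK exprn_ge0.
have [z hz] : exists z, `|e|%N = (z * z)%N.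
  apply: nat_square_of_logn; first by rewrite absz_gt0.
  move=> p pp; apply/negP => odd_e.
  apply: (@odd_prime_contradiction M e p (logn p `|e|)./2) => //.
  by rewrite -{1}(odd_double_half (logn p `|e|)) odd_e.
have : (corner M - z%:R) * (corner M + z%:R) = 0.
  transitivity (corner M * corner M - z%:R * z%:R); first by ring.
  by rewrite eE -natrM -hz pmulrn gez0_abs // subrr.
move=> /eqP; rewrite mulf_eq0 subr_eq0 addr_eq0 => /orP[]/eqP ->.
  by exists z.
by exists (- z%:Z); rewrite rmorphN.
Qed.

(** After a translation the corner is a nonzero integer z. An n-fold product w has wz in O, hence w
    in K, and w^2 in O, hence w in O. The translation is undone by its inverse, which is good as
    well. *)
Lemma prod_integral_of_pair M : SU M -> pair_integral m M -> prod_integral m n M.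
Proof.
move=> SM pM; have [S [sS NM0]] := corner_neq0 SM.
have GN : Gamma (translation R S) := Gamma_translation R m sS.
have gN := good_Gamma GN; have [SN pN _] := gN.
set N := translation R S in GN gN SN pN NM0.
have SNM : SU (N *m M) by exact: SUM.
have pNM : pair_integral m (N *m M) by exact: pair_integralM.
have [z hz] := corner_int SNM pNM NM0.
suff qNM : prod_integral m n (N *m M).
  have -> : M = invmx N *m (N *m M) by rewrite mulKmx // SU_unitmx.
  by apply: prod_integralM => //; case: (goodV gN).
move=> f g; have := prod_sqr_integral f g SNM pNM.
have := prod_cross_det f g pNM; rewrite hz conjC_int.
set w := \prod_i _ => Owz Ow2; apply: (@ringO_root _ _ _ 2) => //.
have z0 : (z%:~R : C) != 0 by rewrite -hz.
have -> : w = w * z%:~R / z%:~R by rewrite mulfK.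
by apply: imquad_div; [exact: ringO_imquad|exact: imquad_int].
Qed.

Lemma good_of_pair M : SU M -> pair_integral m M -> good m M.
Proof. by move=> SM pM; split=> //; exact: prod_integral_of_pair. Qed.

End GoodOfPair.

(** * The normalizer *)

Section Normalizer.

Variables (R : realType) (m n : nat).
Local Notation C := (Cplx R).
Local Notation O := (@ringO R m).
Local Notation SU := (SU R n).
Local Notation Gamma := (hermitian_modular R m n).
Local Notation Delta := (Delta R m n).
Implicit Types (M N : 'M[C]_(n + n)) (x y w : 'cV[C]_(n + n)).

Definition outer_integral y : Prop := forall i j, O (y i 0 * (y j 0)^*).

Lemma form_delta2 a b :
  form (delta_mx a 0 : 'cV[C]_(n + n)) (delta_mx b 0) = jsign R a * (b == swap a)%:R.
Proof.
rewrite form_delta mxE eqxx andbT rmorph_nat.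
rewrite -[in RHS](inj_eq (can_inj (@swapK n))) swapK.
by case: eqP => [->|_] //; rewrite !mulr0.
Qed.

(** This is an entry of the product of three integral matrices: the outer product of x, J, and the
    outer product of y. *)
Lemma outer_form_integral x y i j : outer_integral x -> outer_integral y ->
  O (x i 0 * form x y * (y j 0)^*).
Proof.
move=> ix iy; rewrite formE mulr_sumr mulr_suml; apply: ringO_sum => k _.
have -> : x i 0 * (jsign R k * (x k 0)^* * y (swap k) 0) * (y j 0)^* =
  jsign R k * ((x i 0 * (x k 0)^*) * (y (swap k) 0 * (y j 0)^*)) by ring.
by apply: ringO_jsign; apply: ringOM.
Qed.

Lemma ringO_jsignK (a : 'I_(n + n)) z : O (jsign R a * z) -> O z.
Proof. by move=> /(ringO_jsign a); rewrite mulrA jsignK mul1r. Qed.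

Lemma mulmx_delta_col M (a : 'I_(n + n)) i : (M *m delta_mx a 0 : 'cV_(n + n)) i 0 = M i a.
Proof. by rewrite -colE mxE. Qed.

(* Columns with form +-1 pair integrally, and any two columns reduce to this  *)
(* case after adding the dual column of the first one to the second.          *)
Lemma pair_of_outer M : SU M ->
  (forall a, outer_integral (M *m delta_mx a 0)) ->
  (forall a b, a != b -> outer_integral (M *m (delta_mx a 0 + delta_mx b 0))) ->
  pair_integral m M.
Proof.
move=> SM h1 h2.
have dual i a j : O (M i a * (M j (swap a))^*).
  have := outer_form_integral i j (h1 a) (h1 (swap a)).
  rewrite formM // form_delta2 eqxx mulr1 !mulmx_delta_col.
  by rewrite mulrAC mulrC => /ringO_jsignK.
move=> i a j b; have [->|ab] := eqVneq b (swap a); first exact: dual.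
have := outer_form_integral i j (h1 a) (h2 _ _ ab).
rewrite formM // formDr !form_delta2 eqxx (negPf ab) mulr0 add0r mulr1.
rewrite mulmxDr [fun_of_matrix (_ + _) j 0]mxE !mulmx_delta_col.
rewrite mulrAC mulrC => /ringO_jsignK h.
have -> : M i a * (M j b)^* = M i a * (M j b + M j (swap a))^* - M i a * (M j (swap a))^*.
  by rewrite conjCD; ring.
by apply: ringOB.
Qed.

Lemma Gamma_transvection w : (forall i, O (w i 0)) -> form w w = 0 -> Gamma (transvection w).
Proof.
move=> iw w0; split; first exact: SU_transvection.
move=> i j; rewrite mxE; apply: ringOD; first by rewrite mxE; exact: ringO_nat.
rewrite mulmxJ mulNr; apply: ringON; apply: ringO_jsign.
rewrite mxE big_ord1 cadjE; apply: ringOM => //; exact: ringO_conj.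
Qed.

Lemma outer_of_transvection w : integral_mx m (transvection w) -> outer_integral w.
Proof.
move=> iw i j; have := ringOB (iw i (swap j)) (ringO_nat R m (i == swap j)).
rewrite mxE [X in X + _ - _]mxE addrC addKr mulmxJ swapK jsign_swap opprK => /ringO_jsignK.
by rewrite mxE big_ord1 cadjE.
Qed.

Lemma form_real x : (forall i, (x i 0)^* = x i 0) -> form x x = 0.
Proof.
move=> rx; have : (form x x)^* = form x x.
  rewrite formE conjC_sum; apply: eq_bigr => i _.
  by rewrite !conjCM conj_jsign conjCK !rx.
by rewrite form_conj => /eqP; rewrite eqNr => /eqP.
Qed.

Lemma delta_real (a : 'I_(n + n)) i :
  ((delta_mx a 0 : 'cV[C]_(n + n)) i 0)^* = (delta_mx a 0 : 'cV[C]_(n + n)) i 0.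
Proof. by rewrite mxE rmorph_nat. Qed.

Lemma ringO_delta (a : 'I_(n + n)) i : O ((delta_mx a 0 : 'cV[C]_(n + n)) i 0).
Proof. by rewrite mxE; exact: ringO_nat. Qed.

Lemma pair_of_conj M : SU M ->
  (forall w, (forall i, O (w i 0)) -> (forall i, (w i 0)^* = w i 0) ->
    outer_integral (M *m w)) -> pair_integral m M.
Proof.
move=> SM h; apply: pair_of_outer => // [a|a b _]; apply: h => i.
- exact: ringO_delta.
- exact: delta_real.
- by rewrite mxE; apply: ringOD; exact: ringO_delta.
- by rewrite [fun_of_matrix (_ + _) i 0]mxE conjCD !delta_real.
Qed.

Lemma Gamma_conj M N : SU M -> pair_integral m M -> Gamma N ->
  Gamma (M *m N *m invmx M).
Proof.
move=> SM pM [SN iN]; split; first by apply: SUM; [exact: SUM|exact: SUV].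
move=> i j; rewrite mxE; apply: ringO_sum => k _; rewrite mxE mulr_suml.
apply: ringO_sum => l _; rewrite SU_invmxE // mulrAC mulrC.
apply: ringOM => //; rewrite mulrCA -mulrA; do 2 apply: ringO_jsign.
exact: pM.
Qed.

Lemma Delta_normalizer (d : int) : (0 < m)%N -> is_discriminant R m d -> (0 < n)%N ->
  Delta = mx_normalizer SU Gamma.
Proof.
move=> m0 hd n0; apply/seteqP; split=> M.
  move=> /(DeltaP _ n0) gM; have [SM pM _] := gM; split=> //.
  apply/seteqP; split=> [_ [N GN <-]|N GN]; first exact: Gamma_conj.
  have uM := SU_unitmx SM; have [SV pV _] := goodV gM.
  exists (invmx M *m N *m M).
    by have := Gamma_conj SV pV GN; rewrite invmxK.
  by rewrite !mulmxA mulmxV // mul1mx -mulmxA mulmxV // mulmx1.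
move=> [SM hM]; apply/(DeltaP _ n0); apply: (good_of_pair m0 hd n0) => //.
apply: pair_of_conj => // w iw rw; apply: outer_of_transvection.
rewrite -transvection_conj //.
have : Gamma (transvection w) by apply: Gamma_transvection => //; exact: form_real.
by move=> Gw; have [] : Gamma (M *m transvection w *m invmx M) by rewrite -hM; exists (transvection w).
Qed.

End Normalizer.

(** * Discreteness *)

Section Discreteness.

Variables (R : realType).
Local Notation C := (Cplx R).

Lemma isolated_mxP k (E : set 'M[C]_k) M : isolated E M <->
  E M /\ exists2 e : C, 0 < e &
    forall N, E N -> (forall i j, `|M i j - N i j| < e) -> N = M.
Proof.
split=> [[/set_mem EM [V /nbhs_ballP[e /= e0 eV] VE]]|[EM [e e0 h]]].
  split=> //; exists e => // N EN MN.
  have : (V `&` E) N.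
    by split=> //; apply: eV; rewrite /ball /=; split.
  by rewrite VE.
split; first exact/mem_set.
exists (ball M e); first exact: nbhsx_ballx.
apply/seteqP; split=> [N [[_ MN] EN]|_ ->].
  by apply: h => // i j; have := MN i j; rewrite -ball_normE.
by split=> //; exact: ballxx.
Qed.

Lemma norm_mul_le (a b x y : C) : `|a| <= x -> `|b| <= y -> `|a * b| <= x * y.
Proof. by move=> ax yb; rewrite normrM ler_pM. Qed.

End Discreteness.

Section DeltaDiscrete.

Variables (R : realType) (m n : nat).
Hypothesis n_gt0 : (0 < n)%N.
Local Notation C := (Cplx R).
Local Notation O := (@ringO R m).
Local Notation SU := (SU R n).
Implicit Types M N : 'M[C]_(n + n).

(** Within 1/4 of the identity, pair products are within 5/16 of 0 off the diagonal and within 9/16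
    of 1 on it; being in O, they equal 0 and 1. Hence M is scalar. *)
Lemma pair_integral_near1 M : SU M -> pair_integral m M ->
  (forall i j, `|M i j - (i == j)%:R| < 4^-1) ->
  exists e, [/\ e ^+ (2 * n) = 1, `|e| = 1 & M = e%:M].
Proof.
move=> SM pM near.
have q1 : (4^-1 : C) <= 1 by rewrite invf_le1 // ler1n.
have nle i j : `|M i j| <= 5 / 4.
  have -> : M i j = (M i j - (i == j)%:R) + (i == j)%:R by ring.
  apply: le_trans (ler_normD _ _) _.
  have -> : (5 / 4 : C) = 4^-1 + 1 by field.
  apply: lerD; first exact/ltW.
  by case: (i == j); rewrite ?normr1 ?normr0.
have ne0 i : M i i != 0.
  apply/eqP => Mi; have := near i i; rewrite Mi eqxx sub0r normrN normr1.
  by move=> /lt_le_trans /(_ q1); rewrite ltxx.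
have off i j : i != j -> M i j = 0.
  move=> ij; suff /eqP : M i j * (M i i)^* = 0.
    by rewrite mulf_eq0 conjC_eq0 (negPf (ne0 i)) orbF => /eqP.
  apply: (ringO_norm_lt1 (pM _ _ _ _)).
  have := near i j; rewrite (negPf ij) subr0 => /ltW h.
  have := norm_mul_le h (_ : `|(M i i)^*| <= 5 / 4); rewrite norm_conjC => /(_ (nle _ _)).
  move=> /le_lt_trans; apply; rewrite -subr_gt0.
  have -> : 1 - 4^-1 * (5 / 4) = 11 / 16 :> C by field.
  by rewrite divr_gt0.
have diag i j : M i i * (M j j)^* = 1.
  apply/eqP; rewrite -subr_eq0; apply/eqP.
  apply: (@ringO_norm_lt1 _ m); first by apply: ringOB; [exact: pM|exact: ringO1].
  have -> : M i i * (M j j)^* - 1 = (M i i - 1) * (M j j)^* + (M j j - 1)^*.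
    by rewrite conjCB conjC1; ring.
  apply: le_lt_trans (ler_normD _ _) _.
  have ni : `|M i i - 1| <= 4^-1 by have := near i i; rewrite eqxx => /ltW.
  have nj : `|(M j j - 1)^*| <= 4^-1 by rewrite norm_conjC; have := near j j; rewrite eqxx => /ltW.
  have := norm_mul_le ni (_ : `|(M j j)^*| <= 5 / 4); rewrite norm_conjC => /(_ (nle _ _)) h.
  apply: le_lt_trans (lerD h nj) _; rewrite -subr_gt0.
  have -> : 1 - (4^-1 * (5 / 4) + 4^-1) = 7 / 16 :> C by field.
  by rewrite divr_gt0.
pose i0 : 'I_(n + n) := lshift n (Ordinal n_gt0).
have ME : M = (M i0 i0)%:M.
  apply/matrixP => i j; rewrite !mxE; have [->|ij] := eqVneq i j; last first.
    by rewrite mulr0n off.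
  have cj : (M j j)^* != 0 by rewrite conjC_eq0.
  by rewrite mulr1n; apply: (mulIf cj); rewrite !diag.
exists (M i0 i0); split=> //.
  by have := SM.1; rewrite [in X in X -> _]ME det_scalar => h; rewrite -[RHS]h mul2n -addnn.
apply/eqP; rewrite -(@pexpr_eq1 _ _ 2) // normCK diag //.
Qed.

(** For e other than 1 the powers e^i with i < k sum to 0, yet each would be at distance less than 1
    from 1. *)
Lemma root_of_unity_near1 (e : C) k : (0 < k)%N -> `|e| = 1 -> e ^+ k = 1 ->
  `|e - 1| < k%:R^-1 -> e = 1.
Proof.
move=> k0 ne ek e1; apply/eqP; rewrite -subr_eq0; apply/negPn/negP => ene.
have kC : (0 : C) < k%:R by rewrite ltr0n.
have s0 : \sum_(i < k) e ^+ i = 0.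
  by apply: (mulfI ene); rewrite mulr0 -subrX1 ek subrr.
have near i : `|e ^+ i - 1| <= i%:R * `|e - 1|.
  rewrite subrX1 normrM mulrC; apply: ler_wpM2r => //.
  apply: le_trans (ler_norm_sum _ _ _) _.
  under eq_bigr do rewrite normrX ne expr1n.
  by rewrite sumr_const card_ord.
have : (k%:R : C) <= \sum_(i < k) k%:R * `|e - 1|.
  have kE : (k%:R : C) = `| \sum_(i < k) (e ^+ i - 1)|.
    by rewrite sumrB s0 sumr_const card_ord sub0r normrN normr_nat.
  rewrite {1}kE; apply: le_trans (ler_norm_sum _ _ _) _; apply: ler_sum => i _.
  apply: le_trans (near i) _; apply: (ler_wpM2r (normr_ge0 _)).
  by rewrite ler_nat ltnW.
rewrite sumr_const card_ord -(mulr_natl (_ * _)) -[X in X <= _]mulr1 ler_pM2l // => h.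
have : (k%:R : C) * `|e - 1| < 1 by rewrite mulrC -ltr_pdivlMr // div1r.
by move=> /(le_lt_trans h); rewrite ltxx.
Qed.

Lemma good_discrete : discrete_set (@good R m n).
Proof.
move=> M gM; apply/isolated_mxP; split=> //.
have [SM pM _] := gM; have gV := goodV gM.
pose B := 1 + \sum_i \sum_j `|invmx M i j|.
have B0 : 0 < B.
  by rewrite ltr_pwDl //; do 2 (apply: sumr_ge0 => ? _).
have kC : (0 : C) < (2 * n)%:R by rewrite ltr0n muln_gt0.
have BE i j : `|invmx M i j| <= B.
  apply: (@le_trans _ _ (\sum_j `|invmx M i j|)).
    by rewrite (bigD1 j) //= lerDl sumr_ge0.
  apply: (@le_trans _ _ (\sum_i \sum_j `|invmx M i j|)).
    by rewrite [leRHS](bigD1 i) //= lerDl; do 2 (apply: sumr_ge0 => ? _).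
  by rewrite /B lerDr.
(* Each of the 2n terms in an entry of M^-1 (N - M) is less than B e, so the sum stays below 1/(8n).
   This is at most 1/4, to make M^-1 N scalar, and at most 1/(2n), to make that scalar 1. *)
pose e : C := 4^-1 / (2 * n)%:R / (B * (2 * n)%:R).
have e0 : 0 < e by rewrite !divr_gt0 ?invr_gt0 ?mulr_gt0.
exists e => // N gN MN.
have gX : good m (invmx M *m N) by exact: goodM.
have SX : SU (invmx M *m N) by case: gX.
have pX : pair_integral m (invmx M *m N) by case: gX.
have near i j : `|(invmx M *m N) i j - (i == j)%:R| < 4^-1 / (2 * n)%:R.
  have -> : (i == j)%:R = (invmx M *m M) i j by rewrite mulVmx ?SU_unitmx // mxE.
  have -> : (invmx M *m N) i j - (invmx M *m M) i j = (invmx M *m (N - M)) i j.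
    by rewrite mulmxBr [RHS]mxE [X in _ = _ + X]mxE.
  rewrite mxE; apply: le_lt_trans (ler_norm_sum _ _ _) _.
  have -> : 4^-1 / (2 * n)%:R = \sum_(k < n + n) B * e :> C.
    rewrite sumr_const card_ord -(mulr_natl (_ * _)) addnn -mul2n /e.
    by field; rewrite (lt0r_neq0 B0) pnatr_eq0 -lt0n n_gt0.
  apply: ltr_sum => [|k _].
    by apply/hasP; exists (lshift n (Ordinal n_gt0)); rewrite ?mem_index_enum.
  rewrite normrM; apply: (@le_lt_trans _ _ (B * `|(N - M) k j|)).
    by apply: (ler_wpM2r (normr_ge0 _)); exact: BE.
  by rewrite ltr_pM2l // !mxE distrC.
have q : (4^-1 / (2 * n)%:R : C) <= 4^-1.
  by rewrite ler_pdivrMr // ler_peMr ?invr_ge0 // ler1n muln_gt0.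
have q' : (4^-1 / (2 * n)%:R : C) <= (2 * n)%:R^-1.
  by rewrite ler_piMl ?invr_ge0 ?ler0n // invf_le1 // ler1n.
have [c [c2n nc XE]] := pair_integral_near1 SX pX (fun i j => lt_le_trans (near i j) q).
suff c1 : c = 1.
  by rewrite -[N](mulKVmx (SU_unitmx SM)) XE c1 mulmx1.
apply: (root_of_unity_near1 (k := 2 * n)) => //; first by rewrite muln_gt0.
pose i0 : 'I_(n + n) := lshift n (Ordinal n_gt0).
apply: lt_le_trans q'; have := near i0 i0; rewrite XE [c%:M _ _]mxE eqxx.
by rewrite mulr1n.
Qed.

Lemma Delta_discrete : discrete_set (Delta R m n).
Proof.
have -> : Delta R m n = @good R m n.
  by apply/seteqP; split=> M; rewrite DeltaP.
exact: good_discrete.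
Qed.

End DeltaDiscrete.

(** * Shimizu's lemma and maximality *)

Section Approximation.

Variable R : realType.
Local Notation C := (Cplx R).

Definition ofR (x : R) : C := real_complex R x.

Lemma ofRB x y : ofR (x - y) = ofR x - ofR y. Proof. exact: (rmorphB (real_complex R)). Qed.
Lemma ofRN x : ofR (- x) = - ofR x. Proof. exact: (rmorphN (real_complex R)). Qed.
Lemma ofRM x y : ofR (x * y) = ofR x * ofR y. Proof. exact: (rmorphM (real_complex R)). Qed.
Lemma ofRX x k : ofR (x ^+ k) = ofR x ^+ k. Proof. exact: (rmorphXn (real_complex R)). Qed.
Lemma ofR_int (k : int) : ofR k%:~R = k%:~R. Proof. exact: (rmorph_int (real_complex R)). Qed.
Lemma ofR_le x y : (ofR x <= ofR y) = (x <= y). Proof. exact: lecR. Qed.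
Lemma ofR_lt x y : (ofR x < ofR y) = (x < y). Proof. exact: ltcR. Qed.

Lemma ofR_ge0 x : (0 <= ofR x) = (0 <= x). Proof. exact: (lecR 0 x). Qed.
Lemma ofR_gt0 x : (0 < ofR x) = (0 < x). Proof. exact: (ltcR 0 x). Qed.
Lemma ofR_lt1 x : (ofR x < 1) = (x < 1). Proof. exact: (ltcR x 1). Qed.

Lemma norm_ofR x : `|ofR x| = ofR `|x|.
Proof.
have [x0|x0] := lerP 0 x.
  by rewrite (ger0_norm x0) ger0_norm // ofR_ge0.
by rewrite (ltr0_norm x0) -normrN -ofRN ger0_norm // ofR_ge0 oppr_ge0 ltW.
Qed.

Lemma ofR_surj (z : C) : z^* = z -> exists x, z = ofR x.
Proof. by move/CrealP => /complex_realP. Qed.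

Lemma exists_expr_lt (q e : C) : 0 <= q -> q < 1 -> 0 < e -> exists k, q ^+ k < e.
Proof.
move=> q0 q1 e0.
have [x xE] : exists x, q = ofR x by apply: ofR_surj; apply/CrealP; exact: ger0_real.
have [y yE] : exists y, e = ofR y by apply: ofR_surj; apply/CrealP; exact: gtr0_real.
move: q0 q1 e0; rewrite xE yE ofR_ge0 ofR_gt0 ofR_lt1 => x0 x1 y0.
suff [k hk] : exists k, x ^+ k < y by exists k; rewrite -ofRX ofR_lt.
have [->|xn0] := eqVneq x 0; first by exists 1%N; rewrite expr1.
have {x0 xn0} x0 : 0 < x by rewrite lt_neqAle eq_sym xn0.
pose h := x^-1 - 1; have h0 : 0 < h by rewrite subr_gt0 invf_gt1.
have bern k : 1 + k%:R * h <= x^-1 ^+ k.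
  have -> : x^-1 = 1 + h by rewrite /h; ring.
  elim: k => [|k IH]; first by rewrite mul0r addr0 expr0.
  rewrite exprS; apply: le_trans (ler_wpM2l _ IH); last by rewrite addr_ge0 // ltW.
  rewrite -natr1 -subr_ge0.
  have -> : (1 + h) * (1 + k%:R * h) - (1 + (k%:R + 1) * h) = k%:R * h ^+ 2 by ring.
  by rewrite mulr_ge0 ?ler0n // exprn_ge0 // ltW.
exists (Num.bound (y^-1 / h)).
have yh : 0 <= y^-1 / h by rewrite ltW // divr_gt0 // invr_gt0.
have := archi_boundP yh; set k := Num.bound _.
rewrite ltr_pdivrMr // => hk.
rewrite -[x]invrK exprVn -[y]invrK ltf_pV2 ?posrE ?invr_gt0 ?exprn_gt0 ?invr_gt0 //.
apply: lt_le_trans hk _; apply: le_trans (bern k).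
by rewrite lerDr.
Qed.

Lemma simultaneous_approximation (al be e : R) : 0 < e ->
  exists (k i j : int), [/\ 0 < k, `|k%:~R * al - i%:~R| < e & `|k%:~R * be - j%:~R| < e].
Proof.
move=> e0; pose T := (Num.bound e^-1).+1.
have T0 : (0 : R) < T%:R by rewrite ltr0n.
have Te : T%:R^-1 < e.
  rewrite -[e]invrK ltf_pV2 ?posrE ?invr_gt0 //.
  have := archi_boundP (ltW (_ : 0 < e^-1)); rewrite invr_gt0 => /(_ e0) h.
  by apply: lt_trans h _; rewrite ltr_nat.
pose fr (x : R) := x - (Num.floor x)%:~R.
have fr0 x : 0 <= fr x by rewrite subr_ge0 floor_le.
have fr1 x : fr x < 1.
  by rewrite ltrBlDl; have /andP[_] := floor_itv x; rewrite intrD addrC.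
pose box (x : R) : 'I_T := inord (Num.truncn (T%:R * fr x)).
have boxE x : (box x)%:R <= T%:R * fr x < (box x).+1%:R.
  have h0 : 0 <= T%:R * fr x by rewrite mulr_ge0 // ltW.
  have := truncn_itv h0; rewrite /box inordK //.
  rewrite -(ltr_nat R); apply: le_lt_trans (_ : T%:R * fr x < _).
    by have /andP[] := truncn_itv h0.
  by rewrite -[ltRHS]mulr1 ltr_pM2l.
have box_close x y : box x = box y -> `|fr x - fr y| < T%:R^-1.
  move=> xy; have /andP[a1 a2] := boxE x; have /andP[b1 b2] := boxE y.
  rewrite -xy in b1 b2; move: a2 b2; rewrite -natr1 => a2 b2.
  rewrite -(ltr_pM2l T0) mulfV ?lt0r_neq0 // -{1}[T%:R]ger0_norm ?ltW // -normrM mulrBr.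
  by rewrite ltr_norml; apply/andP; split; lra.
(* Pigeonhole: T^2 + 1 multiples fall into T^2 boxes of side 1/T. *)
pose F (k : 'I_(T * T).+1) := (box (k%:R * al), box (k%:R * be)).
have : ~~ injectiveb F.
  apply/negP => /injectiveP /leq_card; rewrite card_prod !card_ord.
  by rewrite ltnn.
move=> /injectivePn[k1 [k2 k12 [hal hbe]]].
wlog lt12 : k1 k2 k12 hal hbe / (k1 < k2)%N.
  move=> H; have [lt|gt|eq] := ltngtP k1 k2; first exact: (H k1 k2).
    by apply: (H k2 k1) => //; rewrite eq_sym.
  by move: k12; rewrite -val_eqE /= eq eqxx.
exists (k2%:Z - k1%:Z), (Num.floor (k2%:R * al) - Num.floor (k1%:R * al)),
  (Num.floor (k2%:R * be) - Num.floor (k1%:R * be)).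
have key (x : R) : box (k1%:R * x) = box (k2%:R * x) ->
    `|(k2%:Z - k1%:Z)%:~R * x - (Num.floor (k2%:R * x) - Num.floor (k1%:R * x))%:~R| < e.
  move=> hx; apply: lt_trans Te; rewrite distrC.
  have -> : (Num.floor (k2%:R * x) - Num.floor (k1%:R * x))%:~R - (k2%:Z - k1%:Z)%:~R * x
    = fr (k1%:R * x) - fr (k2%:R * x) by rewrite /fr !rmorphB /=; ring.
  exact: box_close.
by split; [rewrite subr_gt0 ltz_nat|exact: key|exact: key].
Qed.

Lemma gt0_ofR (e : C) : 0 < e -> exists2 x, 0 < x & e = ofR x.
Proof.
move=> e0; have [x xE] : exists x, e = ofR x by apply: ofR_surj; apply/CrealP; exact: gtr0_real.
by exists x; rewrite // -ofR_gt0 -xE.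
Qed.

Lemma imquad_of_real_gap (m : nat) (z e : C) : z^* = z -> 0 < e ->
  (forall a b : int, b%:~R * z - a%:~R = 0 \/ e <= `|b%:~R * z - a%:~R|) ->
  imquad m z.
Proof.
move=> /ofR_surj[x ->] /gt0_ofR[y y0 ->] gap.
have [k [i [_ [k0 hi _]]]] := simultaneous_approximation x x y0.
have kC : (k%:~R : C) != 0 by rewrite intr_eq0 gt_eqF.
case: (gap i k) => [/eqP|].
  rewrite subr_eq0 => /eqP h; have -> : ofR x = i%:~R / k%:~R by rewrite -h mulrC mulKf.
  by apply: imquad_div; exact: imquad_int.
rewrite -!ofR_int -ofRM -ofRB norm_ofR ofR_le => /le_lt_trans/(_ hi).
by rewrite ltxx.
Qed.

(** Write z = al + be w with al, be real and approximate both with the same denominator k up to e /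
    (1 + |w|). Then kz is closer than e to an element of O, so it equals that element. *)
Lemma imquad_of_gap (m : nat) (d : int) (z e : C) : (0 < m)%N -> is_discriminant R m d ->
  0 < e ->
  (forall a b, ringO m a -> ringO m b -> b * z - a = 0 \/ e <= `|b * z - a|) ->
  imquad m z.
Proof.
move=> m0 hd e0 gap.
have [w [t [k0 [Ow [ht hk] dE d0 _]]]] := ringO_basis m0 hd.
have wr := ringO_basis_neq_conj ht hk dE d0.
pose b := (z - z^*) / (w - w^*).
have rb : b^* = b.
  rewrite /b conjCM conjCV !conjCB !conjCK -[z^* - z]opprB -[w^* - w]opprB.
  by rewrite invrN mulrNN.
have ra : (z - b * w)^* = z - b * w.
  have bE : b * (w - w^*) = z - z^* by rewrite /b divfK.
  rewrite conjCB conjCM rb; apply/eqP; rewrite -subr_eq0; apply/eqP.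
  transitivity (b * (w - w^*) - (z - z^*)); first by ring.
  by rewrite bE subrr.
have [be beE] := ofR_surj rb; have [al alE] := ofR_surj ra.
have w1 : 0 < 1 + `|w| by rewrite ltr_pwDl.
have [y y0 yE] := gt0_ofR (divr_gt0 e0 w1).
have [k [i [j [kp hi hj]]]] := simultaneous_approximation al be y0.
have zE : z = ofR al + ofR be * w by rewrite -alE -beE; ring.
have Oij : ringO m (i%:~R + j%:~R * w).
  by apply: ringOD; [|apply: ringOM => //]; exact: ringO_int.
have kC : (k%:~R : C) != 0 by rewrite intr_eq0 gt_eqF.
have dif : k%:~R * z - (i%:~R + j%:~R * w) =
    ofR (k%:~R * al - i%:~R) + ofR (k%:~R * be - j%:~R) * w.
  by rewrite zE !ofRB !ofRM !ofR_int; ring.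
case: (gap _ _ Oij (ringO_int R m k)) => [/eqP|].
  rewrite subr_eq0 => /eqP h.
  have -> : z = (i%:~R + j%:~R * w) / k%:~R by rewrite -h mulrC mulKf.
  by apply: imquad_div; [exact: ringO_imquad|exact: imquad_int].
rewrite dif => /le_trans/(_ (ler_normD _ _)); rewrite normrM !norm_ofR => h.
have : ofR `|k%:~R * al - i%:~R| + ofR `|k%:~R * be - j%:~R| * `|w| < ofR y + ofR y * `|w|.
  apply: ltr_leD; first by rewrite ofR_lt.
  by apply: ler_wpM2r => //; rewrite ofR_le ltW.
move=> /(le_lt_trans h); rewrite -{1}[ofR y]mulr1 -mulrDr -yE divfK ?lt0r_neq0 //.
by rewrite ltxx.
Qed.

End Approximation.

Section Shimizu.

Variables (R : realType) (n : nat) (E : set 'M[Cplx R]_(n + n)).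
Local Notation C := (Cplx R).
Hypotheses (subE : subgroup_of (SU R n) E) (discE : discrete_set E).
Implicit Types v w x : 'cV[C]_(n + n).

Definition transvects w : Prop := form w w = 0 /\ E (transvection w).

Lemma transvects_mul M w : E M -> transvects w -> transvects (M *m w).
Proof.
move=> EM [w0 Ew]; have [ES _ EP EV] := subE; have SM := ES _ EM.
split; first by rewrite formM.
by rewrite -transvection_conj //; apply: (EP); [exact: EP|exact: EV].
Qed.

Lemma transvects_act v w : transvects v -> transvects w ->
  transvects (w + form v w *: v).
Proof. by move=> [_ Ev] Tw; rewrite -transvectionE; exact: transvects_mul. Qed.

Lemma transvection_entry w i j :
  transvection w i j = (i == j)%:R - jsign R j * (w i 0 * (w (swap j) 0)^*).
Proof. by rewrite mxE mulmxJ mxE mxE big_ord1 cadjE mulNr. Qed.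

Local Opaque transvection.

(** W (k + 1) is the image of w under tau_(W k), so its transvection is a conjugate of tau_w in E.
    The sequence serves both for the gap and for the growth of denominators. *)
Lemma shimizu_seq v w : transvects v -> transvects w ->
  exists W : nat -> 'cV[C]_(n + n), [/\ W 0%N = v,
    forall k, W k.+1 = w + form (W k) w *: W k & forall k, transvects (W k)].
Proof.
move=> Tv Tw; exists (fun k => iter k (fun u => w + form u w *: u) v).
split; [by []|by []|elim=> [|k IH]; first exact: Tv].
by rewrite iterS; exact: transvects_act.
Qed.

(* Shimizu's lemma: conjugating tau_w by itself through tau_v gives a         *)
(* sequence of transvections converging to tau_w without being constant.      *)
Lemma shimizu v w : transvects v -> transvects w ->
  form v w = 0 \/ 1 <= `|form v w|.
Proof.
move=> Tv Tw; have [w0 Ew] := Tw.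
have [->|s0] := eqVneq (form v w) 0; first by left.
have [q1|] := real_ltP (normr_real (form v w)) (real1 _); last by right.
exfalso; set q := `|form v w| in q1.
have s0q : `|form v w| <= q by [].
have q0 : 0 < q by rewrite normr_gt0.
clearbody q.
have [W [W0 WS TW]] := shimizu_seq Tv Tw; pose s k := form (W k) w.
(* As w is isotropic, the pairing with w is squared in absolute value at each step: below 1 it tends
   to 0 without ever vanishing. *)
have sS k : s k.+1 = `|s k| ^+ 2 by rewrite /s WS formDl w0 add0r formZl normCKC.
have s_neq0 k : s k != 0.
  elim: k => [|k IH]; first by rewrite /s W0.
  by rewrite sS sqrf_eq0 normr_eq0.
have s_le k : `|s k| <= q ^+ k.+1.
  elim: k => [|k IH]; first by rewrite expr1 /s W0.
  rewrite sS normrX normr_id; apply: (@le_trans _ _ ((q ^+ k.+1) ^+ 2)).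
    by have := ler_pM (normr_ge0 _) (normr_ge0 _) IH IH; rewrite -!expr2.
  by rewrite -exprM; apply: ler_wiXn2l; [exact: ltW|exact: ltW|rewrite muln2 -addnn addSn addnS; lia].
have s_leq k : `|s k| <= q.
  apply: le_trans (s_le k) _; rewrite exprS; apply: ler_piMr; first exact: ltW.
  by apply: exprn_ile1; exact: ltW.
(* A bound stable under the recursion: entries of w are at most (1 - q) B, those of s_k W_k at most
   q B. The summand 1 keeps B positive. *)
pose B := (1 + (\sum_i `|v i 0| + \sum_i `|w i 0|)) / (1 - q).
have q1' : 0 < 1 - q by rewrite subr_gt0.
have sum_ge (x : 'cV[C]_(n + n)) i : `|x i 0| <= \sum_i `|x i 0|.
  by rewrite (bigD1 i) //= lerDl sumr_ge0.
have sum0 (x : 'cV[C]_(n + n)) : 0 <= \sum_i `|x i 0| by rewrite sumr_ge0.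
have B0 : 0 < B.
  by rewrite divr_gt0 // ltr_pwDl // addr_ge0.
have wB i : `|w i 0| <= (1 - q) * B.
  rewrite /B mulrC divfK ?lt0r_neq0 //.
  apply: le_trans (sum_ge w i) _.
  by rewrite -subr_ge0 [X in 0 <= X](_ : _ = 1 + \sum_i `|v i 0|); [rewrite addr_ge0|ring].
have qB : (1 - q) * B <= B.
  by apply: ler_piMl; [exact: ltW|rewrite lerBlDr lerDl ltW].
have WB k i : `|W k i 0| <= B.
  elim: k i => [|k IH] i.
    rewrite W0; apply: le_trans (sum_ge v i) _; apply: le_trans qB; rewrite /B mulrC divfK ?lt0r_neq0 //.
    by rewrite -subr_ge0 [X in 0 <= X](_ : _ = 1 + \sum_i `|w i 0|); [rewrite addr_ge0|ring].
  rewrite WS mxE mxE; apply: le_trans (ler_normD _ _) _.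
  have -> : B = (1 - q) * B + q * B by ring.
  by apply: lerD => //; apply: norm_mul_le; [exact: s_leq|exact: IH].
clearbody B.
have wB' i : `|w i 0| <= B by exact: le_trans (wB i) qB.
have /isolated_mxP[_ [e e0 iso]] := discE Ew.
(* The difference of the two outer products has three terms, each of size at most |s_k| B^2. *)
have B3 : 0 < 3 * B ^+ 2 by rewrite mulr_gt0 // exprn_gt0.
have [k hk] := exists_expr_lt (ltW q0) q1 (divr_gt0 e0 B3).
have sk1 : `|s k| <= 1 by exact: le_trans (s_leq k) (ltW q1).
have ske : `|s k| < e / (3 * B ^+ 2).
  apply: le_lt_trans (s_le k) _; apply: le_lt_trans hk.
  by apply: ler_wiXn2l; [exact: ltW|exact: ltW|exact: leqnSn].
have near i j : `|transvection w i j - transvection (W k.+1) i j| < e.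
  have -> : transvection w i j - transvection (W k.+1) i j =
      jsign R j * ((W k.+1 i 0) * (W k.+1 (swap j) 0)^* - w i 0 * (w (swap j) 0)^*).
    by rewrite (transvection_entry w) (transvection_entry (W _)) mulrBr opprB addrC addrA subrK.
  rewrite normrM; have -> : `|jsign R j| = 1 by rewrite normr_sign.
  rewrite mul1r; set x := w i 0; set y := w _ 0; set a := W k i 0; set b := W k (swap j) 0.
  have -> : W k.+1 i 0 = x + s k * a by rewrite WS mxE mxE.
  have -> : W k.+1 (swap j) 0 = y + s k * b by rewrite WS mxE mxE.
  have -> : (x + s k * a) * (y + s k * b)^* - x * y^* =
      s k * (a * y^*) + (s k)^* * (x * b^*) + (s k)^* * (s k * (a * b^*)).
    by rewrite conjCD conjCM; ring.
  apply: le_lt_trans (_ : `|s k| * (3 * B ^+ 2) < _); last by rewrite -ltr_pdivlMr.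
  have bound2 (g h : C) : `|g| <= B -> `|h| <= B -> `|g * h^*| <= B ^+ 2.
    by move=> gB hB; rewrite expr2; apply: norm_mul_le; rewrite ?norm_conjC.
  have -> : `|s k| * (3 * B ^+ 2) = `|s k| * B ^+ 2 + `|s k| * B ^+ 2 + `|s k| * B ^+ 2 by ring.
  apply: le_trans (ler_normD _ _) _; apply: lerD.
    apply: le_trans (ler_normD _ _) _; apply: lerD.
      by apply: norm_mul_le => //; apply: bound2; [exact: WB|exact: wB'].
    by apply: norm_mul_le; [rewrite norm_conjC|apply: bound2; [exact: wB'|exact: WB]].
  apply: norm_mul_le; first by rewrite norm_conjC.
  by rewrite -[B ^+ 2]mul1r; apply: norm_mul_le => //; apply: bound2; exact: WB.
have [_ Ek] := TW k.+1.
have eqT := iso _ Ek near.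
(* tau_w fixes w, whereas tau_(W (k+1)) moves it by s_(k+1) W (k+1), which is nonzero. *)
have := congr1 (mulmx^~ w) eqT; rewrite (transvectionE w) (transvectionE (W _)) w0 scale0r addr0.
rewrite -[X in _ = X]addr0 => /addrI /eqP; rewrite scaler_eq0 => /orP[].
  by rewrite -/(s k.+1) (negPf (s_neq0 k.+1)).
move=> /eqP Wk; have := s_neq0 k.+1; rewrite /s Wk.
by rewrite -(scale0r w) formZl conjC0 mul0r eqxx.
Qed.

End Shimizu.


(** * Rationality and integrality of vectors whose transvections lie in E *)

Section Maximality.

Variables (R : realType) (m n : nat) (d : int) (E : set 'M[Cplx R]_(n + n)).
Hypotheses (m_gt0 : (0 < m)%N) (hd : is_discriminant R m d) (n_gt0 : (0 < n)%N).
Local Notation C := (Cplx R).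
Local Notation K := (@imquad R m).
Local Notation O := (@ringO R m).
Local Notation SU := (SU R n).
Local Notation Gamma := (hermitian_modular R m n).
Hypotheses (subE : subgroup_of SU E) (discE : discrete_set E) (GE : Gamma `<=` E).
Local Notation T := (transvects E).
Local Notation e_ i := (delta_mx i 0 : 'cV[C]_(n + n)).
Implicit Types v w x : 'cV[C]_(n + n).

Lemma transvects_integral w : (forall i, O (w i 0)) -> form w w = 0 -> T w.
Proof. by move=> iw w0; split=> //; apply: GE; exact: Gamma_transvection. Qed.

Lemma form_swap_delta v i : form v (e_ (swap i)) = jsign R i * (v i 0)^*.
Proof. by rewrite form_delta swapK. Qed.

Lemma gap_of_transvects v w : T v -> T w -> form v w = 0 \/ 1 <= `|form v w|.
Proof. exact: shimizu. Qed.

Lemma norm_jsign (i : 'I_(n + n)) : `|jsign R i : C| = 1.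
Proof. exact: normr_sign. Qed.

Lemma form_combination v i j (a b : C) :
  form v ((jsign R j * a) *: e_ (swap i) + (jsign R i * b) *: e_ (swap j)) =
  jsign R i * jsign R j * (a * (v i 0)^* + b * (v j 0)^*).
Proof. by rewrite formDr !formZr !form_swap_delta; ring. Qed.

(** The test vector is supported on the indices dual to i and j; its pairing with v turns the
    Shimizu gap into a gap for a linear form in the conjugated ratio. *)
Lemma gap_combination v i j (a b : C) : T v -> v j 0 != 0 ->
  T ((jsign R j * a) *: e_ (swap i) + (jsign R i * b) *: e_ (swap j)) ->
  a * (v i 0 / v j 0)^* + b = 0 \/ `|v j 0|^-1 <= `|a * (v i 0 / v j 0)^* + b|.
Proof.
move=> Tv vj Tw; have cvj : (v j 0)^* != 0 by rewrite conjC_eq0.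
have eq : a * (v i 0)^* + b * (v j 0)^* = (a * (v i 0 / v j 0)^* + b) * (v j 0)^*.
  by rewrite conjCM conjCV; field.
have := gap_of_transvects Tv Tw; rewrite form_combination eq !normrM !norm_jsign !mul1r.
case=> [/eqP|h].
  rewrite !mulf_eq0 !(negPf (jsign_neq0 _ _)) (negPf cvj) /= orbF => /eqP h.
  by left.
right; rewrite -[X in X <= _]mul1r ler_pdivrMr ?normr_gt0 //.
by rewrite norm_conjC in h.
Qed.

(** The two basis vectors used span an isotropic plane, so a and b may range over all of O. *)
Lemma ratio_nondual v i j : T v -> v j 0 != 0 -> i != j -> i != swap j ->
  K (v i 0 / v j 0).
Proof.
move=> Tv vj ij isj; rewrite -[_ / _]conjCK; apply: imquad_conj.
have vj0 : 0 < `|v j 0|^-1 by rewrite invr_gt0 normr_gt0.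
apply: (imquad_of_gap m_gt0 hd vj0) => a b Oa Ob.
apply: (gap_combination Tv vj).
apply: transvects_integral => [k|].
  rewrite mxE [X in X + _]mxE [X in _ + X]mxE.
  apply: ringOD; (apply: ringOM; last exact: ringO_delta); apply: ringO_jsign => //.
  exact: ringON.
rewrite formDl !formDr !formZl !formZr !form_delta2.
have e1 k : (swap k == swap (swap k)) = false by rewrite swapK; apply/negbTE; exact: swap_neq.
have e2 : (swap j == swap (swap i)) = false.
  by rewrite swapK eq_sym; exact: negbTE.
have e3 : (swap i == swap (swap j)) = false.
  by rewrite swapK -[j]swapK (inj_eq (can_inj (@swapK n))); exact: negbTE.
by rewrite !e1 e2 e3 !mulr0 !addr0.
Qed.

(** For dual indices the test vector is in general not isotropic. A third nonzero coordinate splits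
    the ratio into two nondual ones; without one, isotropy of v makes the ratio real, and integer
    coefficients, which give real and hence isotropic test vectors, suffice. *)
Lemma ratio_dual v j : T v -> v j 0 != 0 -> K (v (swap j) 0 / v j 0).
Proof.
move=> Tv vj; have [v0 _] := Tv.
have [[k [kj ksj vk]]|none] :=
    pselect (exists k, [/\ k != j, k != swap j & v k 0 != 0]).
  have -> : v (swap j) 0 / v j 0 = (v (swap j) 0 / v k 0) * (v k 0 / v j 0).
    by field; rewrite vk vj.
  apply: imquadM; last exact: ratio_nondual.
  apply: ratio_nondual => //; first by rewrite eq_sym.
  by rewrite (inj_eq (can_inj (@swapK n))) eq_sym.
have oth k : k != j -> k != swap j -> v k 0 = 0.
  by move=> kj ksj; apply/eqP/negPn/negP => vk; apply: none; exists k.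
have rz : (v (swap j) 0 / v j 0)^* = v (swap j) 0 / v j 0.
  have : form v v = jsign R j * ((v j 0)^* * v (swap j) 0 - (v (swap j) 0)^* * v j 0).
    rewrite formE (bigD1 j) //= (bigD1 (swap j)) /=; last exact: swap_neq.
    rewrite big1 => [|k /andP[kj ksj]]; last by rewrite oth // conjC0 mulr0 mul0r.
    by rewrite swapK jsign_swap; ring.
  rewrite v0 => /esym/eqP; rewrite mulf_eq0 (negPf (jsign_neq0 _ _)) subr_eq0 /= => /eqP h.
  have cvj : (v j 0)^* != 0 by rewrite conjC_eq0.
  rewrite conjCM conjCV; apply: (mulIf cvj); apply: (mulIf vj).
  rewrite divfK // [RHS]mulrAC divfK //; rewrite mulrC [RHS]mulrC h; ring.
have vj0 : 0 < `|v j 0|^-1 by rewrite invr_gt0 normr_gt0.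
apply: (imquad_of_real_gap m rz vj0) => a b.
rewrite -{1 2}rz; apply: (gap_combination Tv vj).
have ri k : O (jsign R k * b%:~R) by apply: ringO_jsign; exact: ringO_int.
apply: transvects_integral => [k|].
  rewrite mxE [X in X + _]mxE [X in _ + X]mxE.
  apply: ringOD; (apply: ringOM; last exact: ringO_delta); apply: ringO_jsign => //.
    exact: ringO_int.
  by apply: ringON; exact: ringO_int.
apply: form_real => k; rewrite mxE [X in X + _]mxE [X in _ + X]mxE.
by rewrite conjCD !conjCM !delta_real !conj_jsign conjCN !conjC_int.
Qed.

Lemma ratio_imquad v i j : T v -> v j 0 != 0 -> K (v i 0 / v j 0).
Proof.
move=> Tv vj; have [->|ij] := eqVneq i j; first by rewrite divff //; exact: imquad1.
have [->|isj] := eqVneq i (swap j); first exact: ratio_dual.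
exact: ratio_nondual.
Qed.

(** Ratios determine v only up to a scalar, so |v_j|^2 is needed too. Applying tau_v to the basis
    vector dual to j gives a vector whose dual ratio differs from that of v by 1/|v_j|^2 up to
    sign. *)
Lemma outer_imquad v i j : T v -> K (v i 0 * (v j 0)^*).
Proof.
move=> Tv; have [->|vj] := eqVneq (v j 0) 0; first by rewrite conjC0 mulr0; exact: imquad0.
have cvj : (v j 0)^* != 0 by rewrite conjC_eq0.
have -> : v i 0 * (v j 0)^* = (v i 0 / v j 0) * ((v j 0 * (v j 0)^*)^-1)^-1.
  by field; rewrite vj cvj.
apply: imquadM; [exact: ratio_imquad|apply: imquadV].
have Tx : T (e_ (swap j)).
  apply: transvects_integral; first exact: ringO_delta.
  by apply: form_real; exact: delta_real.
have Tv' := transvects_act subE Tv Tx; set v' := _ + _ in Tv'.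
have v'j : v' j 0 = jsign R j * ((v j 0)^* * v j 0).
  rewrite /v' mxE [X in X + _]mxE [X in _ + X]mxE form_swap_delta.
  by rewrite eq_sym (negPf (swap_neq _)) add0r mulrA.
have v'sj : v' (swap j) 0 = 1 + jsign R j * ((v j 0)^* * v (swap j) 0).
  rewrite /v' mxE [X in X + _]mxE [X in _ + X]mxE form_swap_delta.
  by rewrite !eqxx mulrA.
have v'j0 : v' j 0 != 0 by rewrite v'j !mulf_neq0 // jsign_neq0.
have := ratio_imquad (swap j) Tv' v'j0.
have -> : v' (swap j) 0 / v' j 0 = jsign R j / (v j 0 * (v j 0)^*) + v (swap j) 0 / v j 0.
  have jj := jsignK R j; have j0 := jsign_neq0 R j.
  rewrite v'sj v'j mulrDl mul1r.
  have -> : (jsign R j * ((v j 0)^* * v j 0))^-1 = jsign R j / (v j 0 * (v j 0)^*).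
    by rewrite invfM; congr (_ * _); [apply: (mulIf j0); rewrite mulVf // jj|rewrite mulrC].
  congr (_ + _); rewrite mulrACA jj mul1r; field; by rewrite vj cvj.
move=> /(fun h => imquadB h (ratio_imquad (swap j) Tv vj)); rewrite addrK => h.
have -> : (v j 0 * (v j 0)^*)^-1 = jsign R j * (jsign R j / (v j 0 * (v j 0)^*)).
  by rewrite mulrA jsignK mul1r.
by apply: imquadM => //; rewrite -[jsign R j]mulr1; apply: ringO_imquad; apply: ringO_jsign; exact: ringO1.
Qed.

Lemma common_denominator (I : finType) (F : I -> C) : (forall i, K (F i)) ->
  exists2 D : nat, (0 < D)%N & forall i, O (D%:R * F i).
Proof.
move=> KF; have ex i : exists k : nat, (0 < k)%N /\ O (k%:R * F i).
  by have [k] := imquad_frac (KF i); exists k.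
have [k hk] := fin_all_exists ex.
exists (\prod_i k i)%N; first by rewrite prodn_gt0 // => i; case: (hk i).
move=> i; rewrite (bigD1 i) //= natrM mulrAC; apply: ringOM; first by case: (hk i).
exact: ringO_nat.
Qed.

Lemma form_imquad v x i : T v -> (forall i, O (x i 0)) -> K (form v x * v i 0).
Proof.
move=> Tv ix; rewrite formE mulr_suml; apply: imquad_sum => k _.
have -> : jsign R k * (v k 0)^* * x (swap k) 0 * v i 0 =
  jsign R k * x (swap k) 0 * (v i 0 * (v k 0)^*) by ring.
apply: imquadM; last exact: outer_imquad.
by apply: ringO_imquad; apply: ringO_jsign.
Qed.

Lemma form_norm_imquad v x : T v -> (forall i, O (x i 0)) ->
  K (form v x * (form v x)^*).
Proof.
move=> Tv ix; rewrite {2}formE conjC_sum mulr_sumr; apply: imquad_sum => k _.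
have -> : form v x * (jsign R k * (v k 0)^* * x (swap k) 0)^* =
    jsign R k * (x (swap k) 0)^* * (form v x * v k 0).
  by rewrite !conjCM conjCK conj_jsign; ring.
apply: imquadM; last exact: form_imquad.
by apply: ringO_imquad; apply: ringO_jsign; apply: ringO_conj.
Qed.

Lemma coprime_recursion (a b : nat) (s : C) (q : nat -> C) :
  (0 < b)%N -> coprime a b -> s = a%:R / b%:R -> q 0%N = 0 ->
  (forall k, q k.+1 = s + s ^+ (2 ^ k) * q k) ->
  forall k, exists2 Q : nat, coprime a Q &
    b%:R ^+ (2 ^ k.+1) * q k.+1 = (a * b * Q)%:R.
Proof.
move=> b0 ab sE q0 qS; have bC : (b%:R : C) != 0 by rewrite pnatr_eq0 -lt0n.
elim=> [|k [Q aQ IH]].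
  exists 1%N; first exact: coprimen1.
  rewrite qS q0 mulr0 addr0 sE muln1 natrM expn1; by field.
have N0 : (0 < 2 ^ k.+1)%N by rewrite expn_gt0.
(* With N = 2^(k+1), multiplying the recursion by b^(2N) turns s into a b b^(2N-2). Modulo a the new
   cofactor is this last power of b, hence it is coprime to a. *)
exists (b ^ (2 ^ k.+1).-1.*2 + a ^ (2 ^ k.+1) * Q)%N.
  have [a' ha'] : exists a', (a ^ (2 ^ k.+1) * Q = a' * a)%N.
    by exists (a ^ (2 ^ k.+1).-1 * Q)%N; rewrite -{1}(prednK N0) expnSr mulnAC.
  by rewrite /coprime ha' addnC gcdnMDl -/(coprime _ _) coprimeXr.
set N := (2 ^ k.+1)%N in IH N0 *.
have e1 : b%:R ^+ (2 ^ k.+2) = (b%:R ^+ N.-1.*2 * b%:R ^+ 2 : C).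
  by rewrite -exprD; congr (_ ^+ _); rewrite expnS -/N mul2n -{1}(prednK N0) doubleS addn2.
have e2 : b%:R ^+ (2 ^ k.+2) = (b%:R ^+ N * b%:R ^+ N : C).
  by rewrite -exprD addnn -mul2n -expnS.
rewrite qS mulrDr {1}e1 e2 -/N.
have -> : b%:R ^+ N * b%:R ^+ N * (s ^+ N * q k.+1) =
    (b%:R * s) ^+ N * (b%:R ^+ N * q k.+1) by rewrite exprMn; ring.
have -> : b%:R * s = a%:R by rewrite sE mulrC divfK.
rewrite IH sE !(natrM, natrD, natrX); move: (a%:R ^+ N) (b%:R ^+ N.-1.*2) => X Y.
by field.
Qed.

(** After one common factor a, the remaining power of a is coprime to b and Q and can only share
    divisors with D. The bound does not depend on N. *)
Lemma gcdn_recursion_bound (a b D Q N : nat) : (0 < D)%N -> (0 < N)%N -> (0 < a)%N ->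
  coprime a b -> coprime a Q -> (gcdn (a ^ N) (D * (a * b * Q)) <= a * D)%N.
Proof.
move=> D0 N0 a0 ab aQ; rewrite -(prednK N0) expnS.
have -> : (D * (a * b * Q) = a * (b * Q * D))%N by ring.
rewrite -muln_gcdr leq_mul2l gtn_eqF //=.
rewrite Gauss_gcdr; last by rewrite coprimeXl // coprimeMr ab.
by apply: dvdn_leq => //; exact: dvdn_gcdr.
Qed.

(* If s = |<v,x>|^2 is a fraction a/b, the vectors v_(k+1) = x + s^(2^k) v_k  *)
(* have denominators growing much faster than the integral combinations of x  *)
(* and v_1 can compensate, which contradicts Shimizu's lemma unless b = 1.    *)
Lemma form_norm_integral v x : T v -> (forall i, O (x i 0)) ->
  (forall i, (x i 0)^* = x i 0) -> O (form v x * (form v x)^*).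
Proof.
move=> Tv ix rx; set s := form v x * (form v x)^*.
have rs : s^* = s by rewrite /s conjCM conjCK mulrC.
have [q sq] := imquad_real (form_norm_imquad Tv ix) rs; rewrite -/s in sq.
have sge : 0 <= s by rewrite /s -normCK exprn_ge0.
have [->|s0] := eqVneq s 0; first exact: ringO0.
have q0 : 0 < q.
  rewrite -(ltr0q C) -sq lt_neqAle eq_sym s0; exact: sge.
pose a := `|numq q|%N; pose b := `|denq q|%N.
have a0 : (0 < a)%N by rewrite absz_gt0 numq_eq0 gt_eqF.
have b0 : (0 < b)%N by rewrite absz_gt0 denq_neq0.
have ab : coprime a b by exact: coprime_num_den.
have sE : s = a%:R / b%:R.
  rewrite sq /ratr /a /b !pmulrn absz_denq gez0_abs // numq_ge0 ltW //.
have [b1|b1] := leqP b 1.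
  have {}b1 : b = 1%N by apply/eqP; rewrite eqn_leq b1.
  by rewrite sE b1 divr1; exact: ringO_nat.
exfalso; have x0 : form x x = 0 by exact: form_real.
have Tx : T x by exact: transvects_integral.
(* The image of x under tau_v. In contrast to v, its coordinates are known to lie in K, so they have
   a common denominator D. *)
set v1 := x + form v x *: v.
have Tv1 : T v1 by exact: transvects_act.
have v1x : form v1 x = s by rewrite formDl x0 add0r formZl mulrC.
have xv1 : form x v1 = - s by rewrite -[LHS]conjCK form_conj v1x conjCN rs.
have v10 : form v1 v1 = 0 by case: Tv1.
have Kv1 i : K (v1 i 0).
  by rewrite mxE [X in _ + X]mxE; apply: imquadD; [exact: ringO_imquad|exact: form_imquad].
have [D D0 hD] := common_denominator Kv1.
have [W [W0 WS TW]] := shimizu_seq subE Tv1 Tx.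
have Wx k : form (W k) x = s ^+ (2 ^ k).
  elim: k => [|k IH]; first by rewrite W0 v1x expr1.
  rewrite WS formDl x0 add0r formZl IH conjCX rs -exprD addnn -mul2n.
  by rewrite -expnS.
pose qq k := - form (W k) v1.
have qq0 : qq 0%N = 0 by rewrite /qq W0 v10 oppr0.
have qqS k : qq k.+1 = s + s ^+ (2 ^ k) * qq k.
  by rewrite /qq WS formDl xv1 formZl Wx conjCX rs; ring.
(* This k ensures that the gcd below, at most aD = k < 2^k, is smaller than b^N, as b is at least
   2. *)
pose k := (a * D)%N; pose N := (2 ^ k.+1)%N.
have [Q aQ hQ] := coprime_recursion b0 ab sE qq0 qqS k; rewrite -/N in hQ.
have N0 : (0 < N)%N by rewrite expn_gt0.
have bC : (b%:R : C) != 0 by rewrite pnatr_eq0 -lt0n.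
have aN0 : (0 < a ^ N)%N by rewrite expn_gt0 a0.
have [al be hg _] := egcdnP (D * (a * b * Q))%N aN0.
set g := gcdn _ _ in hg.
(* The Bezout coefficients make the pairing of W (k+1) with w equal to g / b^N, strictly between 0
   and 1; the factor D keeps w integral. *)
pose w := al%:R *: x + (be * D)%:R *: v1.
have Tw : T w.
  apply: transvects_integral => [i|].
    rewrite mxE [X in X + _]mxE [X in _ + X]mxE natrM -mulrA.
    by apply: ringOD; apply: ringOM => //; exact: ringO_nat.
  rewrite formDl !formDr !formZl !formZr x0 v10 v1x xv1 !(conjC_int _ (Posz _)).
  by rewrite -!pmulrn; ring.
have fw : b%:R ^+ N * form (W k.+1) w = g%:R.
  have -> : form (W k.+1) w = al%:R * s ^+ N - (be * D)%:R * qq k.+1.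
    by rewrite formDr !formZr Wx -/N /qq; ring.
  rewrite mulrBr mulrCA -exprMn.
  have -> : b%:R * s = a%:R by rewrite sE mulrC divfK.
  rewrite mulrCA hQ -natrX -!natrM hg natrD.
  by rewrite (mulnA be D) addrAC subrr add0r.
have gle : (g <= a * D)%N by exact: gcdn_recursion_bound.
have gb : (g < b ^ N)%N.
  apply: leq_ltn_trans gle _; rewrite -/k.
  apply: (@leq_trans (2 ^ k)%N); first exact: ltn_expl.
  apply: (@leq_trans (2 ^ N)%N); last by rewrite leq_exp2r.
  rewrite leq_exp2l //; apply: ltnW; apply: (ltn_trans (ltnSn k)).
  exact: ltn_expl.
have bN : (b%:R : C) ^+ N != 0 by rewrite expf_neq0.
case: (gap_of_transvects (TW k.+1) Tw) => [h|].
  move: fw; rewrite h mulr0 => /esym/eqP; rewrite pnatr_eq0.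
  by rewrite gtn_eqF // /g gcdn_gt0 aN0.
have -> : form (W k.+1) w = g%:R / (b ^ N)%:R by rewrite -fw natrX mulrC mulKf.
rewrite normrM normfV !normr_nat ler_pdivlMr ?ltr0n ?expn_gt0 ?b0 // mul1r ler_nat.
by rewrite leqNgt gb.
Qed.

(** Polarization: suitable real test vectors x make |v_i|^2, |v_j|^2 and |v_i + v_j|^2 integers,
    hence also trace and norm of v_i v_j^*. *)
Lemma outer_of_transvects v : T v -> outer_integral m v.
Proof.
move=> Tv i j.
have single k : O (v k 0 * (v k 0)^*).
  have := form_norm_integral Tv (ringO_delta R m (swap k)) (delta_real R (swap k)).
  rewrite form_swap_delta conjCM conjCK conj_jsign mulrACA jsignK mul1r.
  by rewrite mulrC.
have [<-|ij] := eqVneq i j; first exact: single.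
pose x := jsign R i *: e_ (swap i) + jsign R j *: e_ (swap j).
have ix k : O (x k 0).
  rewrite mxE [X in X + _]mxE [X in _ + X]mxE.
  by apply: ringOD; apply: ringO_jsign; exact: ringO_delta.
have rx k : (x k 0)^* = x k 0.
  by rewrite mxE [X in X + _]mxE [X in _ + X]mxE conjCD !conjCM !delta_real !conj_jsign.
have := form_norm_integral Tv ix rx.
have -> : form v x = (v i 0 + v j 0)^*.
  by rewrite formDr !formZr !form_swap_delta !mulrA !jsignK !mul1r conjCD.
rewrite conjCK => h.
have sint k : exists a : int, v k 0 * (v k 0)^* = a%:~R.
  by apply: (ringO_real (single k)); rewrite conjCM conjCK mulrC.
have [k1 hk1] := sint i; have [k2 hk2] := sint j.
have [k3 hk3] : exists k3 : int, (v i 0 + v j 0)^* * (v i 0 + v j 0) = k3%:~R.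
  by apply: (ringO_real h); rewrite conjCM conjCK mulrC.
apply: (@ringO_trace_norm _ _ _ (k3 - k1 - k2) (k1 * k2)); first exact: outer_imquad.
  rewrite !rmorphB /= -hk1 -hk2 -hk3 conjCD conjCM conjCK; ring.
rewrite conjCM conjCK [RHS]rmorphM /= -hk1 -hk2; ring.
Qed.

Lemma discrete_sub_Delta : E `<=` Delta R m n.
Proof.
move=> M EM; have [ES _ _ _] := subE; have SM := ES _ EM.
apply/(DeltaP _ n_gt0); apply: (good_of_pair m_gt0 hd n_gt0) => //.
apply: pair_of_conj => // w iw rw; apply: outer_of_transvects.
apply: (transvects_mul subE) => //.
by apply: transvects_integral => //; exact: form_real.
Qed.

End Maximality.

(** * The class map and its kernel *)

Section IdealClasses.

Variables (R : realType) (m n : nat).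
Hypothesis n_gt0 : (0 < n)%N.
Local Notation C := (Cplx R).
Local Notation K := (@imquad R m).
Local Notation O := (@ringO R m).
Local Notation SU := (SU R n).
Local Notation Gamma := (hermitian_modular R m n).
Local Notation Delta := (Delta R m n).
Implicit Types (M N L : 'M[C]_(n + n)) (A B I : set C).

Lemma generated_mul_min (S T X : set C) x y : submoduleO m X ->
  (forall s t, S s -> T t -> X (s * t)) ->
  generated m S x -> generated m T y -> X (x * y).
Proof.
move=> sX h Sx Ty; have [X0 XD XZ] := sX.
have hs s : S s -> X (s * y).
  move=> Ss; move: y Ty; apply: generated_min; first exact: submodule_scale.
  by move=> t Tt; exact: h.
move: x Sx; apply: generated_min; last exact: hs.
split=> /=; first by rewrite mul0r.
  by move=> a b Xa Xb; rewrite mulrDl; exact: XD.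
by move=> a b Oa Xb; rewrite -mulrA; exact: XZ.
Qed.

Lemma ideal_class_dilate A c : K c -> c != 0 ->
  ideal_class m (dilate c A) = ideal_class m A.
Proof.
move=> Kc c0; apply/seteqP; split=> B [z [Kz z0 ->]].
  by exists (z * c); rewrite mulf_neq0 // dilate_dilate; split=> //; exact: imquadM.
exists (z / c); rewrite mulf_neq0 ?invr_eq0 // dilate_dilate divfK //; split=> //.
exact: imquad_div.
Qed.

Lemma class_mul_class A B :
  class_mul m (ideal_class m A) (ideal_class m B) = ideal_class m (ideal_mul m A B).
Proof.
apply/seteqP; split.
  move=> _ [_ [z [Kz z0 ->]] [_ [w [Kw w0 ->]] <-]].
  exists (z * w); rewrite ideal_mul_dilate // mulf_neq0 //; split=> //.
  exact: imquadM.
move=> _ [z [Kz z0 ->]]; exists (dilate z A); first by exists z.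
exists (dilate 1 B); first by exists 1; rewrite oner_eq0; split=> //; exact: imquad1.
by rewrite ideal_mul_dilate ?oner_eq0 // mulr1.
Qed.

Lemma class_pow_class A k :
  class_pow m (ideal_class m A) k = ideal_class m (ideal_pow m A k).
Proof.
elim: k => [//|k IH].
transitivity (class_mul m (ideal_class m A) (class_pow m (ideal_class m A) k)); first by [].
by rewrite IH class_mul_class.
Qed.

(* The class of a module that becomes a fractional ideal after scaling by     *)
(* some nonzero complex number.                                               *)
Definition module_class A : set (set C) :=
  [set B | exists z, [/\ z != 0, B = dilate z A & B `<=` K]].

Lemma module_class_dilate A c : c != 0 -> A `<=` K -> (exists2 x, A x & x != 0) ->
  module_class (dilate c A) = ideal_class m A.
Proof.
move=> c0 AK [x Ax x0]; apply/seteqP; split=> [_ [z [z0 -> hK]]|_ [z [Kz z0 ->]]].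
  exists (z * c); rewrite dilate_dilate mulf_neq0 //; split=> //.
  have := hK (z * (c * x)); rewrite dilate_dilate => h.
  have {h} : K (z * (c * x)) by apply: h; exists x; rewrite ?mulrA.
  by move=> /imquad_div/(_ (AK _ Ax)); rewrite mulrA mulfK.
exists (z / c); rewrite dilate_dilate mulf_neq0 ?invr_eq0 ?divfK //; split=> //.
by move=> _ [y Ay <-]; apply: imquadM => //; exact: AK.
Qed.

Lemma mem_entry_ideal k (M : 'M[C]_k) i j : entry_ideal m M (M i j).
Proof. by apply: mem_generated; exists i, j. Qed.

Lemma entry_ideal_min k (M : 'M[C]_k) A : submoduleO m A -> (forall i j, A (M i j)) ->
  entry_ideal m M `<=` A.
Proof. by move=> sA h; apply: generated_min => // _ [i [j ->]]. Qed.

Lemma submodule_entry_ideal k (M : 'M[C]_k) : submoduleO m (entry_ideal m M).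
Proof. exact: submodule_generated. Qed.

Lemma entry_idealZ k (M : 'M[C]_k) c : c != 0 ->
  entry_ideal m (c *: M) = dilate c (entry_ideal m M).
Proof.
move=> c0; apply/seteqP; split.
  apply: entry_ideal_min; first exact: submodule_dilate (submodule_entry_ideal _).
  by move=> i j; rewrite mxE; exists (M i j) => //; exact: mem_entry_ideal.
move=> _ [x + <-]; move: x; apply: entry_ideal_min.
  exact: submodule_scale (submodule_entry_ideal _).
by move=> i j /=; have := @mem_entry_ideal _ (c *: M) i j; rewrite mxE.
Qed.

(** For the inclusion of the product, write M = (MN) N^-1: the entries of N^-1 are conjugates of
    entries of N up to sign, so times an entry of N they are integral coefficients. *)
Lemma entry_idealM M N : good m M -> good m N ->
  entry_ideal m (M *m N) = ideal_mul m (entry_ideal m M) (entry_ideal m N).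
Proof.
move=> gM [SN pN _]; apply/seteqP; split.
  apply: entry_ideal_min; first exact: submodule_ideal_mul.
  move=> i j; rewrite mxE; apply: (@submodule_sum _ m); first exact: submodule_ideal_mul.
  by move=> k _; apply: mem_ideal_mul; exact: mem_entry_ideal.
have sI := submodule_entry_ideal (M *m N); have [_ _ IZ] := sI.
apply: ideal_mul_min => // x y; apply: generated_mul_min => // _ _ [i [a ->]] [b [j ->]].
have -> : M i a = \sum_k (M *m N) i k * invmx N k a.
  by rewrite -{1}[M](mulmxK (SU_unitmx SN)) mxE.
rewrite mulr_suml.
apply: (@submodule_sum _ m) => // k _; rewrite mulrAC -mulrA mulrC; apply: IZ; last first.
  exact: mem_entry_ideal.
rewrite SU_invmxE // mulrC -!mulrA; do 2 apply: ringO_jsign.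
by rewrite mulrC; exact: pN.
Qed.

(** The entry module of M = L/u is u^-1 times the entry ideal of L, possibly outside K; its
    [module_class] is the class of that ideal for every representation. *)
Definition class_of_mx M : set (set C) := module_class (entry_ideal m M).

Lemma entry_ideal_neq0 M : (exists i j, M i j != 0) -> exists2 x, entry_ideal m M x & x != 0.
Proof. by move=> [i [j Mij]]; exists (M i j) => //; exact: mem_entry_ideal. Qed.

Lemma entry_ideal_integral L : integral_mx m L -> entry_ideal m L `<=` O.
Proof. by move=> iL; apply: entry_ideal_min => //; exact: submodule_ringO. Qed.

Lemma Delta_rep_neq0 L u : Delta_rep m L u -> exists2 x, entry_ideal m L x & x != 0.
Proof.
move=> [_ u0 _ _ SL]; have [i [j]] := SU_entry_neq0 n_gt0 SL.
rewrite mxE mulf_eq0 negb_or => /andP[_ Lij].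
by apply: entry_ideal_neq0; exists i, j.
Qed.

Lemma class_of_rep L u : Delta_rep m L u ->
  class_of_mx (u^-1 *: L) = ideal_class m (entry_ideal m L).
Proof.
move=> rep; have [iL u0 _ _ _] := rep.
rewrite /class_of_mx entry_idealZ ?invr_eq0 // module_class_dilate ?invr_eq0 //.
  by apply: subset_trans (entry_ideal_integral iL) _; exact: ringO_imquad.
exact: Delta_rep_neq0 rep.
Qed.

Lemma class_of_mx_torsion M : Delta M -> class_torsion R m n (class_of_mx M).
Proof.
move=> [L [u [rep ->]]]; rewrite (class_of_rep rep); have [iL u0 Ou hI _] := rep.
split.
  exists (entry_ideal m L) => //; split.
  - exact: submodule_entry_ideal.
  - by apply: subset_trans (entry_ideal_integral iL) _; exact: ringO_imquad.
  - exact: Delta_rep_neq0 rep.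
  - exists 1; rewrite oner_eq0 dilate1; split=> //; first exact: ringO1.
    exact: entry_ideal_integral.
rewrite class_pow_class -hI ideal_class_dilate //; first exact: ringO_imquad.
by rewrite expf_neq0.
Qed.

Lemma class_of_mxM M N : Delta M -> Delta N ->
  class_of_mx (M *m N) = class_mul m (class_of_mx M) (class_of_mx N).
Proof.
move=> DM DN; have gM : good m M by exact/DeltaP.
have gN : good m N by exact/DeltaP.
have [L [u [rL eM]]] := DM; have [L' [u' [rL' eN]]] := DN.
rewrite /class_of_mx entry_idealM // eM eN -/(class_of_mx _) -/(class_of_mx _).
have [iL u0 _ _ _] := rL; have [iL' u0' _ _ _] := rL'.
rewrite (class_of_rep rL) (class_of_rep rL') class_mul_class.
rewrite !entry_idealZ ?invr_eq0 // ideal_mul_dilate ?invr_eq0 //.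
have [x Lx x0] := Delta_rep_neq0 rL; have [y Ly y0] := Delta_rep_neq0 rL'.
apply: module_class_dilate; first by rewrite mulf_neq0 ?invr_eq0.
  apply: ideal_mul_min; first split.
  - exact: imquad0.
  - by move=> ? ? ? ?; exact: imquadD.
  - by move=> a b Oa Kb; apply: imquadM => //; exact: ringO_imquad.
  - move=> a b /(entry_ideal_integral iL) Oa /(entry_ideal_integral iL') Ob.
    by apply: imquadM; exact: ringO_imquad.
by exists (x * y); [exact: mem_ideal_mul|rewrite mulf_neq0].
Qed.

Lemma ideal_pow_entry_integral M : good m M -> ideal_pow m (entry_ideal m M) n `<=` O.
Proof.
move=> [_ _ qM]; apply: ideal_pow_generated_min; first exact: submodule_ringO.
move=> F hF; have [f hf] := fin_all_exists hF; have [g hg] := fin_all_exists hf.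
by under eq_bigr do rewrite hg; exact: qM.
Qed.

Lemma entry_ideal_exp M x : good m M -> entry_ideal m M x -> O (x ^+ n).
Proof. by move=> gM Jx; apply: (ideal_pow_entry_integral gM); exact: ideal_powX. Qed.

Lemma normC_root1 (e : C) k : (0 < k)%N -> e ^+ k = 1 -> e * e^* = 1.
Proof.
move=> k0 ek; have h : `|e| = 1.
  by apply/eqP; rewrite -(@pexpr_eq1 _ _ k) // -normrX ek normr1.
by rewrite -normCK h expr1n.
Qed.

Lemma goodZ e M : e ^+ (2 * n) = 1 -> good m M -> good m (e *: M).
Proof.
move=> e2n [SM pM qM]; have n20 : (0 < 2 * n)%N by rewrite muln_gt0.
have ee := normC_root1 n20 e2n; split; first exact: SUZ.
  by move=> i a j b; rewrite !mxE conjCM mulrACA ee mul1r; exact: pM.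
move=> f g; under eq_bigr do rewrite mxE.
rewrite big_split /= prodr_const card_ord; apply: ringOM; last exact: qM.
have /eqP : e ^+ n ^+ 2 = 1 by rewrite -exprM mulnC.
by rewrite sqrf_eq1 => /orP[]/eqP ->; [exact: ringO1|apply: ringON; exact: ringO1].
Qed.

Lemma entry_ideal_Gamma M : Gamma M -> entry_ideal m M = O.
Proof.
move=> GM; have [SM iM] := GM; apply/seteqP; split; first exact: entry_ideal_integral.
have sI := submodule_entry_ideal M; have [_ _ IZ] := sI.
move=> x Ox; rewrite -[x]mulr1; apply: (IZ) => //.
pose i := lshift n (Ordinal n_gt0).
have -> : (1 : C) = (M *m invmx M) i i by rewrite mulmxV ?SU_unitmx // mxE eqxx.
rewrite mxE; apply: (@submodule_sum _ m) => // k _; rewrite mulrC; apply: (IZ).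
  rewrite SU_invmxE // -mulrA; do 2 apply: ringO_jsign.
  by apply: ringO_conj; exact: iM.
exact: mem_entry_ideal.
Qed.

Lemma class_of_mxZ_Gamma e M : e != 0 -> Gamma M -> class_of_mx (e *: M) = class_one R m.
Proof.
move=> e0 GM; rewrite /class_of_mx entry_idealZ // entry_ideal_Gamma //.
apply: module_class_dilate => //; first exact: ringO_imquad.
by exists 1; [exact: ringO1|exact: oner_neq0].
Qed.

(** A trivial class means that z times the entry module of M is O for some z. Then z^(2n) = det (zM)
    and z^-n are integral, so z^n is a unit, that is 1 or -1, and M is z^-1 times the element zM of
    Gamma. *)
Lemma class_of_mx_kernel (d : int) : (0 < m)%N -> is_discriminant R m d ->
  d <> -3 -> d <> -4 ->
  [set M | Delta M /\ class_of_mx M = class_one R m] =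
  [set N | exists (e : C) M, [/\ e ^+ (2 * n) = 1, Gamma M & N = e *: M]].
Proof.
move=> m0 hd d3 d4; have n20 : (0 < 2 * n)%N by rewrite muln_gt0.
apply/seteqP; split=> [M [/(DeltaP _ n_gt0) gM hM]|_ [e [M [e2n GM ->]]]]; last first.
  split; first by apply/(DeltaP _ n_gt0); apply: goodZ => //; exact: good_Gamma.
  apply: class_of_mxZ_Gamma => //; apply/eqP => e0.
  by move: e2n; rewrite e0 expr0n gtn_eqF // => /eqP; rewrite eq_sym oner_eq0.
have [SM _ _] := gM.
have : class_one R m O.
  by exists 1; rewrite dilate1 oner_eq0; split=> //; exact: imquad1.
rewrite -hM => -[z [z0 zJ _]].
have iz i j : O (z * M i j).
  by rewrite zJ; exists (M i j) => //; exact: mem_entry_ideal.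
have Jz : entry_ideal m M z^-1.
  have : O 1 by exact: ringO1.
  by rewrite zJ => -[x Jx zx]; rewrite -[z^-1]mulr1 -zx mulKf.
have Ozn := entry_ideal_exp gM Jz.
have Oz2n : O (z ^+ (2 * n)).
  have -> : z ^+ (2 * n) = \det (z *: M) by rewrite detZ SM.1 mulr1 mul2n addnn.
  rewrite /determinant; apply: ringO_sum => s _; apply: ringO_sign.
  by apply: ringO_prod => i _; rewrite mxE.
have zn0 : z ^+ n != 0 by rewrite expf_neq0.
have Oznp : O (z ^+ n).
  have -> : z ^+ n = z ^+ (2 * n) * z^-1 ^+ n.
    by rewrite mul2n -addnn exprD exprVn mulfK.
  exact: ringOM.
rewrite exprVn in Ozn.
have zz : z ^+ (2 * n) = 1.
  rewrite mulnC exprM.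
  by have [->|->] := ringO_unit m0 hd d3 d4 Oznp Ozn zn0; rewrite ?sqrrN expr1n.
exists z^-1, (z *: M); split.
- by rewrite exprVn zz invr1.
- by split; [exact: SUZ|move=> i j; rewrite mxE].
- by rewrite scalerA mulVf // scale1r.
Qed.

End IdealClasses.

(** * Surjectivity of the class map *)

Lemma int_subgroup (P : set int) : P 0 -> (forall x y, P x -> P y -> P (x - y)) ->
  exists2 g : int, P g & forall x, P x -> (g %| x)%Z.
Proof.
move=> P0 PB; have PN x : P x -> P (- x) by rewrite -sub0r; exact: PB.
have PD x y : P x -> P y -> P (x + y) by move=> Px /PN; rewrite -{2}[y]opprK; exact: PB.
have PM x k : P x -> P (x * k).
  have nat_case (j : nat) : P x -> P (x * j%:Z).
    move=> Px; elim: j => [|j IH]; first by rewrite mulr0.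
    by rewrite -[j.+1]addn1 PoszD mulrDr mulr1; exact: PD.
  by move=> Px; case: k => j; [exact: nat_case|rewrite NegzE mulrN; apply: PN; exact: nat_case].
have [ex|none] := pselect (exists k : nat, (0 < k)%N && `[< P k%:Z >]); last first.
  exists 0 => // x Px; rewrite dvd0z; apply/negPn/negP => x0; apply: none.
  exists `|x|%N; rewrite absz_gt0 x0; apply/asboolP.
  by case: (intP x) Px => [|j|j] //; rewrite abszN /= => /PN; rewrite opprK.
have [g /andP[g0 /asboolP Pg] gmin] := ex_minnP ex.
exists g%:Z => // x Px; apply/dvdz_mod0P/eqP/negPn/negP => r0.
have Pr : P (x %% g%:Z)%Z.
  by have := PB _ _ Px (PM _ (x %/ g%:Z)%Z Pg); rewrite {1}(divz_eq x g%:Z) mulrC addrC addKr.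
have rge : 0 <= (x %% g%:Z)%Z by rewrite modz_ge0 // eqz_nat -lt0n.
have rlt : (x %% g%:Z)%Z < g%:Z by rewrite ltz_pmod // ltz_nat.
move: Pr r0 rge rlt; case: (x %% g%:Z)%Z => // r Pr r0 _; rewrite ltz_nat ltnNge gmin //.
by rewrite lt0n -(eqz_nat r 0) r0; exact/asboolP.
Qed.

(** * Elements of ideal powers as determinants *)

Section BidiagonalDeterminant.

Variables (F : comNzRingType) (a b : F).

(** The sum of X_i a^i b^(k-i) for i up to k, in the recursive form that matches determinant
    expansion along the first column. *)
Fixpoint bidiag_sum k (X : nat -> F) : F :=
  if k is k'.+1 then a * bidiag_sum k' (fun i => X i.+1) + X 0%N * b ^+ k else X 0%N.

Definition bidiag_mx k (X : nat -> F) : 'M[F]_k.+1 :=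
  \matrix_(i, j) if i == k :> nat then X j else
    if j == i :> nat then a else if j == i.+1 :> nat then - b else 0.

Lemma det_bidiag_mx k X : \det (bidiag_mx k X) = bidiag_sum k X.
Proof.
elim: k X => [|k IH] X; first by rewrite det_mx11 mxE.
rewrite (expand_det_col _ ord0) (bigD1 ord0) //= (bigD1 ord_max) //= big1 => [|i /andP[i0 im]].
  rewrite addr0; congr (_ + _).
    rewrite mxE /= /cofactor /= expr0 mul1r -IH; congr (_ * \det _).
    by apply/matrixP => i j; rewrite !mxE /= /bump !leq0n !add1n !eqSS.
  rewrite mxE /= eqxx; congr (_ * _); rewrite /cofactor /= addn0.
  set Y := row' _ _; have tY : is_trig_mx Y.
    apply/is_trig_mxP => i j ij; rewrite !mxE /= /bump leq0n add1n leqNgt ltn_ord /= add0n.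
    rewrite (ltn_eqF (ltn_ord i)) (gtn_eqF (ltn_trans ij (ltnSn j))).
    by rewrite eqSS (gtn_eqF ij).
  rewrite det_trig // (eq_bigr (fun=> - b)) => [|i _]; last first.
    rewrite !mxE /= /bump leq0n add1n leqNgt ltn_ord /= add0n.
    by rewrite (ltn_eqF (ltn_ord i)) (gtn_eqF (ltnSn i)) eqxx.
  by rewrite prodr_const card_ord -exprMn mulrNN mul1r.
rewrite mxE; have -> : (i == k.+1 :> nat) = false by apply/negbTE.
have -> : (0%N == i :> nat) = false by apply/negbTE; rewrite eq_sym.
by rewrite mul0r.
Qed.

Lemma bidiag_sumD k X Y :
  bidiag_sum k (fun i => X i + Y i) = bidiag_sum k X + bidiag_sum k Y.
Proof. by elim: k X Y => [//|k IH] X Y /=; rewrite IH; ring. Qed.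

Lemma bidiag_sumZ k c X : bidiag_sum k (fun i => c * X i) = c * bidiag_sum k X.
Proof. by elim: k X => [//|k IH] X /=; rewrite IH; ring. Qed.

End BidiagonalDeterminant.

Section TwoGenerators.

Variables (R : realType) (m : nat).
Local Notation C := (Cplx R).
Local Notation K := (@imquad R m).
Local Notation O := (@ringO R m).
Variables (A : set C) (a b : C).
Hypotheses (sA : submoduleO m A) (Aa : A a) (Ab : A b).
Hypothesis gen : forall x, A x -> exists i j : int, x = i%:~R * a + j%:~R * b.

Definition bidiag_set k : set C :=
  [set x | exists X : nat -> C, (forall i, A (X i)) /\ bidiag_sum a b k X = x].

Lemma submodule_bidiag k : submoduleO m (bidiag_set k).
Proof.
have [A0 AD AZ] := sA; split.
- exists (fun=> 0); split=> //; elim: k => [//|k IH] /=.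
  by rewrite IH mul0r mulr0 addr0.
- move=> _ _ [X [AX <-]] [Y [AY <-]]; exists (fun i => X i + Y i); split.
    by move=> i; exact: AD.
  exact: bidiag_sumD.
- move=> c _ Oc [X [AX <-]]; exists (fun i => c * X i); split; last exact: bidiag_sumZ.
  by move=> i; exact: AZ.
Qed.

Lemma bidiag_mul_a k x : bidiag_set k x -> bidiag_set k.+1 (a * x).
Proof.
have [A0 _ _] := sA; move=> [X [AX <-]]; exists (fun i => if i is i'.+1 then X i' else 0).
by split=> [[]//|/=]; rewrite mul0r addr0.
Qed.

Lemma bidiag_mul_b k x : bidiag_set k x -> bidiag_set k.+1 (b * x).
Proof.
have [A0 _ _] := sA; move=> [X [AX <-]] {x}; elim: k X AX => [|k IH] X AX.
  exists (fun i => if i is 0%N then X 0%N else 0); split; first by case.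
  by rewrite /= mulr0 add0r expr1 mulrC.
have [Y [AY hY]] := IH (fun i => X i.+1) (fun i => AX i.+1).
exists (fun i => if i is i'.+1 then Y i' else X 0%N); split; first by case.
transitivity (a * bidiag_sum a b k.+1 Y + X 0%N * b ^+ k.+2); first by [].
by rewrite hY [RHS]/= !exprS; ring.
Qed.

(** As A is spanned by a and b, every further factor A amounts to multiplication by a and b, which
    shifts the coefficient sequence or extends it by zero. *)
Lemma ideal_pow_bidiag k : ideal_pow m A k.+1 `<=` bidiag_set k.
Proof.
have [A0 AD AZ] := sA; elim: k => [|k IH].
  apply: ideal_mul_min; first exact: submodule_bidiag.
  by move=> x y Ax Oy; exists (fun=> x * y); split=> // _; rewrite mulrC; exact: AZ.
apply: ideal_mul_min; first exact: submodule_bidiag.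
move=> _ s /gen[i [j ->]] /IH Ss; have [_ SD SZ] := submodule_bidiag k.+1.
rewrite mulrDl; apply: SD; rewrite -mulrA; apply: SZ; try exact: ringO_int.
  exact: bidiag_mul_a.
exact: bidiag_mul_b.
Qed.

Lemma ideal_pow_det k x : ideal_pow m A k.+1 x ->
  exists2 P : 'M[C]_k.+1, forall i j, A (P i j) & \det P = x.
Proof.
have [A0 _ _] := sA; move=> /ideal_pow_bidiag[X [AX <-]].
exists (bidiag_mx a b k X); last exact: det_bidiag_mx.
move=> i j; rewrite mxE; case: ifP => _; first exact: AX.
case: ifP => _; first exact: Aa.
by case: ifP => _; [exact: (submodule_opp sA)|exact: A0].
Qed.

(** g is the ideal norm: A times its conjugate is gO. It is the gcd of |a|^2, |b|^2 and the trace of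
    a b^*; then a b^* / g has trace and norm in Z and is integral. *)
Lemma ideal_norm : A `<=` O -> (exists2 x, A x & x != 0) ->
  exists g i j t : int, [/\ 0 < g,
    forall x y, A x -> A y -> O (x * y^* / g%:~R) &
    g%:~R = i%:~R * (a * a^*) + j%:~R * (b * b^*) + t%:~R * (a * b^* + b * a^*)].
Proof.
move=> AO [x0 Ax0 x0n].
have [na ha] := ringO_norm (AO _ Aa); have [nb hb] := ringO_norm (AO _ Ab).
have [tr htr] : exists t : int, a * b^* + b * a^* = t%:~R.
  apply: (@ringO_real _ m); last by rewrite conjCD !conjCM !conjCK addrC mulrC [b * _]mulrC.
  by apply: ringOD; apply: ringOM; try apply: ringO_conj; exact: AO.
have [u [v huv]] := Bezoutz na nb; have [u' [v' huv']] := Bezoutz (gcdz na nb) tr.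
set g := gcdz (gcdz na nb) tr in huv'.
have dna : (g %| na)%Z by apply: dvdz_trans (dvdz_gcdl _ _) _; exact: dvdz_gcdl.
have dnb : (g %| nb)%Z by apply: dvdz_trans (dvdz_gcdl _ _) _; exact: dvdz_gcdr.
have dtr : (g %| tr)%Z by exact: dvdz_gcdr.
have g0 : g != 0.
  apply/eqP => g0; move: dna dnb; rewrite g0 !dvd0z => /eqP na0 /eqP nb0.
  have a0 : a = 0.
    by apply/eqP; rewrite -normr_eq0 -sqrf_eq0 normCK ha na0.
  have b0 : b = 0.
    by apply/eqP; rewrite -normr_eq0 -sqrf_eq0 normCK hb nb0.
  by have [i [j e]] := gen Ax0; move: x0n; rewrite e a0 b0 !mulr0 addr0 eqxx.
have gpos : 0 < g by rewrite lt_neqAle eq_sym g0.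
have gC : (g%:~R : C) != 0 by rewrite intr_eq0.
have [qa eqa] := dvdzP dna; have [qb eqb] := dvdzP dnb; have [qt eqt] := dvdzP dtr.
have Oaa : O (a * a^* / g%:~R) by rewrite ha eqa rmorphM mulfK //; exact: ringO_int.
have Obb : O (b * b^* / g%:~R) by rewrite hb eqb rmorphM mulfK //; exact: ringO_int.
have cg : (g%:~R : C)^* = g%:~R by exact: conjC_int.
have Oab : O (a * b^* / g%:~R).
  apply: (@ringO_trace_norm _ _ _ qt (qa * qb)).
  - apply: imquad_div; last exact: imquad_int.
    by apply: imquadM; last apply: imquad_conj; apply: ringO_imquad; exact: AO.
  - rewrite !conjCM conjCV cg conjCK -mulrDl [a^* * b]mulrC htr eqt rmorphM mulfK //.
  - have -> : a * b^* / g%:~R * (a * b^* / g%:~R)^* =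
      (a * a^* / g%:~R) * (b * b^* / g%:~R).
      by rewrite !conjCM conjCV cg conjCK; ring.
    by rewrite ha hb eqa eqb !rmorphM /= !mulfK.
have Oba : O (b * a^* / g%:~R).
  by have := ringO_conj Oab; rewrite !conjCM conjCV cg conjCK [a^* * b]mulrC.
exists g, (u' * u), (u' * v), v'; split=> //.
  move=> x y Ax Ay; have [i [j ->]] := gen Ax; have [k [l ->]] := gen Ay.
  rewrite conjCD !conjCM !conjC_int.
  have -> : (i%:~R * a + j%:~R * b) * (k%:~R * a^* + l%:~R * b^*) / g%:~R =
    (i * k)%:~R * (a * a^* / g%:~R) + (i * l)%:~R * (a * b^* / g%:~R) +
    ((j * k)%:~R * (b * a^* / g%:~R) + (j * l)%:~R * (b * b^* / g%:~R)).
    by rewrite !rmorphM /=; ring.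
  by do 3 ?apply: ringOD; apply: ringOM => //; exact: ringO_int.
rewrite ha hb htr -!rmorphM -!rmorphD; congr (_%:~R).
by rewrite -huv' -huv; ring.
Qed.

End TwoGenerators.

(** Hermite normal form in the basis 1, w: q generates the w-coordinates of A, and g generates the
    integers contained in A. *)
Lemma ideal_two_generators (R : realType) (m : nat) (d : int) (A : set (Cplx R)) :
  (0 < m)%N -> is_discriminant R m d -> submoduleO m A -> A `<=` @ringO R m ->
  exists a b, [/\ A a, A b &
    forall x, A x -> exists i j : int, x = i%:~R * a + j%:~R * b].
Proof.
move=> m0 hd sA AO; have [A0 AD AZ] := sA.
have AB x y : A x -> A y -> A (x - y).
  by move=> Ax Ay; apply: AD => //; exact: submodule_opp sA Ay.
have AI x (k : int) : A x -> A (k%:~R * x) by apply: AZ; exact: ringO_int.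
have [w [t [k [Ow _ _ _ Ob]]]] := ringO_basis m0 hd.
pose P : set int := [set j | exists i : int, A (i%:~R + j%:~R * w)].
have P0 : P 0 by exists 0; rewrite mul0r addr0.
have PB x y : P x -> P y -> P (x - y).
  move=> [i Ai] [i' Ai']; exists (i - i').
  by have := AB _ _ Ai Ai'; congr A; rewrite !rmorphB /=; ring.
have [q [p Ab] qmin] := int_subgroup P0 PB.
pose Q : set int := [set i | A i%:~R].
have QB x y : Q x -> Q y -> Q (x - y).
  by move=> Ax Ay; rewrite /Q /= rmorphB; exact: AB.
have [g Ag gmin] := int_subgroup (A0 : Q 0) QB.
exists g%:~R, (p%:~R + q%:~R * w); split=> // x Ax.
have [i [j xE]] := Ob _ (AO _ Ax).
have /dvdzP[j' jE] : (q %| j)%Z by apply: qmin; exists i; rewrite -xE.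
have Ai : A (i - j' * p)%:~R.
  have := AB _ _ Ax (AI _ j' Ab); congr A.
  by rewrite xE jE rmorphB !rmorphM /=; ring.
have /dvdzP[i' iE] := gmin _ Ai.
exists i', j'; rewrite xE jE !rmorphM /=.
have -> : i = i' * g + j' * p by rewrite -iE subrK.
by rewrite rmorphD !rmorphM /=; ring.
Qed.

Section Surjectivity.

Variables (R : realType) (m n' : nat) (d : int).
Hypotheses (m_gt0 : (0 < m)%N) (hd : is_discriminant R m d).
Local Notation n := n'.+1.
Local Notation C := (Cplx R).
Local Notation K := (@imquad R m).
Local Notation O := (@ringO R m).

(** A^k times its conjugate is both |z|^2 O and g^k O, so |z|^2 / g^k and its inverse are integers;
    being nonnegative, the quotient is 1. *)
Lemma generator_norm (A : set C) (a b z : C) (k : nat) (g i j t : int) :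
  submoduleO m A -> A a -> A b -> 0 < g ->
  (forall x y, A x -> A y -> O (x * y^* / g%:~R)) ->
  g%:~R = i%:~R * (a * a^*) + j%:~R * (b * b^*) + t%:~R * (a * b^* + b * a^*) ->
  z != 0 -> ideal_pow m A k = dilate z O -> z * z^* = g%:~R ^+ k.
Proof.
move=> sA Aa Ab g0 AA gE z0 Ak.
have gC : (g%:~R : C) != 0 by rewrite intr_eq0 gt_eqF.
have gkC : (g%:~R : C) ^+ k != 0 by rewrite expf_neq0.
have cg : (g%:~R : C)^* = g%:~R by exact: conjC_int.
have zzC : z * z^* != 0 by rewrite mulf_neq0 ?conjC_eq0.
have Az : ideal_pow m A k z by rewrite Ak; exists 1; rewrite ?mulr1 //; exact: ringO1.
have powAA x y : ideal_pow m A k x -> ideal_pow m A k y -> O (x * y^* / g%:~R ^+ k).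
  rewrite -{1 2}(generated_id sA) => hx hy.
  have -> : x * y^* / g%:~R ^+ k = (y^* / g%:~R ^+ k) * x by ring.
  move: x hx; apply: ideal_pow_generated_min; first by apply: submodule_scale; exact: submodule_ringO.
  move=> F AF /=.
  have -> : y^* / g%:~R ^+ k * \prod_i F i = ((\prod_i F i)^* / g%:~R ^+ k * y)^*.
    by rewrite !conjCM conjCV conjCX cg conjCK; ring.
  apply: ringO_conj; move: y hy; apply: ideal_pow_generated_min.
    by apply: submodule_scale; exact: submodule_ringO.
  move=> G AG /=; rewrite conjC_prod.
  have -> : (\prod_i (F i)^*) / g%:~R ^+ k * \prod_i G i = \prod_(l < k) (G l * (F l)^* / g%:~R).
    by rewrite !big_split /= prodr_const card_ord exprVn; ring.
  by apply: ringO_prod => l _; exact: AA.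
(* The product of A^l with its conjugate; expanding one factor g by [gE] at a time shows that it
   contains g^l. *)
pose gen l := generated m [set t | exists x y, [/\ ideal_pow m A l x, ideal_pow m A l y & t = x * y^*]].
have gen_g l : gen l (g%:~R ^+ l).
  elim: l => [|l IH].
    rewrite expr0; apply: mem_generated; exists 1, 1; rewrite conjC1 mulr1.
    by split=> //; exact: ringO1.
  rewrite exprS; move: (g%:~R ^+ l) IH.
  have sG : submoduleO m (gen l.+1) by exact: submodule_generated.
  apply: generated_min; first exact: submodule_scale.
  move=> _ [x [y [Ax Ay ->]]] /=; have [_ GD GZ] := sG.
  have inG e f : A e -> A f -> gen l.+1 (e * f^* * (x * y^*)).
    move=> Ae Af; apply: mem_generated; exists (e * x), (f * y); split.
    - exact: mem_ideal_mul.
    - exact: mem_ideal_mul.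
    - by rewrite conjCM; ring.
  rewrite gE; set q := x * y^*.
  have -> : (i%:~R * (a * a^*) + j%:~R * (b * b^*) + t%:~R * (a * b^* + b * a^*)) * q =
      i%:~R * (a * a^* * q) + j%:~R * (b * b^* * q) +
      (t%:~R * (a * b^* * q) + t%:~R * (b * a^* * q)) by ring.
  by apply: (GD); apply: (GD); apply: (GZ); try exact: ringO_int; exact: inG.
have O1 : O (z * z^* / g%:~R ^+ k) by exact: powAA.
have O2 : O (g%:~R ^+ k / (z * z^*)).
  have : dilate (z * z^*) O (g%:~R ^+ k).
    move: (gen_g k); apply: generated_min; first by apply: submodule_dilate => //; exact: submodule_ringO.
    move=> _ [x [y [+ + ->]]]; rewrite Ak => -[x' Ox <-] [y' Oy <-].
    exists (x' * y'^*); first by apply: ringOM => //; exact: ringO_conj.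
    by rewrite conjCM; ring.
  by move=> /(dilateP _ _ zzC); rewrite mulrC.
have rr : (z * z^* / g%:~R ^+ k)^* = z * z^* / g%:~R ^+ k.
  by rewrite !conjCM conjCV conjCX cg conjCK [z^* * z]mulrC.
have rr' : (g%:~R ^+ k / (z * z^*))^* = g%:~R ^+ k / (z * z^*).
  by rewrite conjCM conjCV conjCX cg conjCM conjCK [z^* * z]mulrC.
have [k1 h1] := ringO_real O1 rr; have [k2 h2] := ringO_real O2 rr'.
have k11 : k1 = 1.
  apply: (@intM_eq1 _ k2).
    by apply/eqP; rewrite -(eqr_int C) rmorphM /= -h1 -h2 mulrA divfK // mulfV.
  rewrite -(ler0z C) -h1 -normCK divr_ge0 ?exprn_ge0 //.
  by rewrite ler0z ltW.
by rewrite -[LHS](divfK gkC) h1 k11 mul1r.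
Qed.

(** * The block diagonal matrix attached to a normalized module B *)

Section Construction.

Variables (B : set C) (U : 'M[C]_n) (al be : C) (i0 j0 t0 : int).
Hypotheses (sB : submoduleO m B) (BU : forall i j, B (U i j)) (dU : \det U = 1).
Hypothesis BB : forall x y, B x -> B y -> O (x * y^*).
Hypothesis Bn : forall F : 'I_n -> C, (forall i, B (F i)) -> O (\prod_i F i).
Hypotheses (Bal : B al) (Bbe : B be).
Hypothesis B1 : 1 = i0%:~R * (al * al^*) + j0%:~R * (be * be^*) +
  t0%:~R * (al * be^* + be * al^*).

Lemma cofactor_integral y i j : B y -> O (y * cofactor U i j).
Proof.
move=> By; rewrite /cofactor mulrCA -signr_odd; apply: ringO_sign.
rewrite /determinant mulr_sumr; apply: ringO_sum => s _; rewrite mulrCA.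
apply: ringO_sign; set F : 'I_n' -> C := fun k => row' i (col' j U) k (s k).
pose G l := if unlift ord0 l is Some k then F k else y.
have : O (\prod_l G l).
  apply: Bn => l; rewrite /G; case: unliftP => [k|] _ //.
  by rewrite /F !mxE; exact: BU.
rewrite big_ord_recl {1}/G unlift_none; congr (O (_ * _)).
by apply: eq_bigr => k _; rewrite /G liftK.
Qed.

(** Multiplying the conjugated cofactor c^* by [B1] gives a sum of terms x (yc)^* with x, y in B,
    where yc is integral as a sum of n-fold products. *)
Lemma conj_cofactor_mem i j : B (cofactor U i j)^*.
Proof.
have [_ BD BZ] := sB; set c := cofactor U i j.
have -> : c^* = c^* * 1 by rewrite mulr1.
have mem x y (k : int) : B x -> B y -> B (k%:~R * (x * y^* * c^*)).
  move=> Bx By; apply: (BZ); first exact: ringO_int.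
  by rewrite -mulrA mulrC -conjCM; apply: (BZ) => //; apply: ringO_conj; exact: cofactor_integral.
have -> : c^* * 1 = i0%:~R * (al * al^* * c^*) + j0%:~R * (be * be^* * c^*) +
    (t0%:~R * (al * be^* * c^*) + t0%:~R * (be * al^* * c^*)).
  by rewrite [X in _ * X]B1; ring.
by apply: (BD); apply: (BD); exact: mem.
Qed.

Let M : 'M[C]_(n + n) := block_mx U 0 0 (cadj (\adj U)).

Lemma construction_mem i j : B (M i j).
Proof.
have [B0 _ _] := sB; rewrite /M; case: (shiftP i) => k; case: (shiftP j) => l;
  rewrite ?block_mxEul ?block_mxEur ?block_mxEdl ?block_mxEdr; try by rewrite mxE.
  exact: BU.
by rewrite cadjE mxE; exact: conj_cofactor_mem.
Qed.

Lemma construction_SU : SU R n M.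
Proof.
have dV : \det (cadj (\adj U)) = 1.
  have : \det (U *m \adj U) = 1 by rewrite mul_mx_adj dU det1.
  rewrite det_mulmx dU mul1r => h.
  by rewrite /cadj det_tr det_map_mx h rmorph1.
split; first by rewrite /M det_ublock dU dV mulr1.
rewrite -/(cadj _) /M cadj_block cadjK.
have -> : cadj (0 : 'M[C]_n) = 0 by rewrite /cadj map_mx0 trmx0.
rewrite /mxJ !mulmx_block !(mul0mx, mulmx0, addr0, add0r, mulmx1, mulmxN, mulNmx).
by rewrite -cadjM !mul_adj_mx dU cadj1.
Qed.

Lemma construction_pair : pair_integral m M.
Proof. by move=> i a j b; apply: BB; exact: construction_mem. Qed.

Lemma construction_Delta : Delta R m n M.
Proof.
apply/DeltaP => //; apply: (good_of_pair m_gt0 hd) => //.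
  exact: construction_SU.
exact: construction_pair.
Qed.

Lemma construction_ideal : entry_ideal m M = B.
Proof.
apply/seteqP; split; first by apply: entry_ideal_min => //; exact: construction_mem.
have sI := submodule_entry_ideal m M; have [_ _ IZ] := sI.
move=> x Bx; rewrite -[x]mulr1; pose i : 'I_(n + n) := lshift n ord0.
have SM := construction_SU.
have -> : (1 : C) = (M *m invmx M) i i by rewrite mulmxV ?SU_unitmx // mxE eqxx.
rewrite mxE mulr_sumr; apply: (@submodule_sum _ m) => // k _.
rewrite mulrCA mulrC; apply: IZ; last exact: mem_entry_ideal.
rewrite SU_invmxE // mulrCA -mulrA; do 2 apply: ringO_jsign.
by apply: BB => //; exact: construction_mem.
Qed.

End Construction.

Lemma class_of_mx_surj_succ :
  set_surj (Delta R m n) (class_torsion R m n) (@class_of_mx R m n).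
Proof.
move=> X [[A0 [sA0 A0K [x1 Ax1 x10] [c [Oc c0 cA]]] XE] Xn].
pose A := dilate c A0.
have sA : submoduleO m A by exact: submodule_dilate.
have XA : X = ideal_class m A by rewrite /A ideal_class_dilate //; exact: ringO_imquad.
have An : exists2 x, A x & x != 0 by exists (c * x1); [exists x1|rewrite mulf_neq0].
have [a [b [Aa Ab gen]]] := ideal_two_generators m_gt0 hd sA cA.
have [g [i [j [t [g0 AA gE]]]]] := ideal_norm Aa Ab gen cA An.
have [z z0 Az] : exists2 z, z != 0 & ideal_pow m A n = dilate z O.
  have : class_one R m O.
    by exists 1; rewrite dilate1 oner_eq0; split=> //; exact: imquad1.
  rewrite -Xn XA class_pow_class => -[w [_ w0 OE]].
  by exists w^-1; rewrite ?invr_eq0 // OE dilate_dilate mulVf // dilate1.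
have zz := generator_norm sA Aa Ab g0 AA gE z0 Az.
pose u := n.-root z.
have un : u ^+ n = z by exact: rootCK.
have u0 : u != 0 by apply: contraNneq z0 => u0; rewrite -un u0 expr0n.
have gC : (g%:~R : C) != 0 by rewrite intr_eq0 gt_eqF.
have uu : u * u^* = g%:~R.
  apply/eqP; rewrite -(@eqrXn2 _ n) //.
  - by rewrite exprMn -conjCX un zz.
  - by rewrite -normCK exprn_ge0.
  - by rewrite ler0z ltW.
have cu0 : u^* != 0 by rewrite conjC_eq0.
have [P AP dP] : exists2 P : 'M[C]_n, forall i j, A (P i j) & \det P = z.
  apply: (ideal_pow_det sA Aa Ab gen); rewrite Az.
  by exists 1; rewrite ?mulr1 //; exact: ringO1.
(* Division by u normalizes A: B times its conjugate is O because |u|^2 = g, n-fold products lie in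
   O because u^n = z, and det U = 1. *)
pose B := dilate u^-1 A; pose U := u^-1 *: P.
have ui0 : u^-1 != 0 by rewrite invr_eq0.
have sB : submoduleO m B by exact: submodule_dilate.
have BU k l : B (U k l) by rewrite mxE; exists (P k l).
have dU : \det U = 1 by rewrite detZ dP exprVn un mulVf.
have BB x y : B x -> B y -> O (x * y^*).
  move=> [x' Ax <-] [y' Ay <-].
  have -> : u^-1 * x' * (u^-1 * y')^* = x' * y'^* / g%:~R.
    by rewrite conjCM conjCV -uu; field; rewrite cu0 u0.
  exact: AA.
have Bn (F : 'I_n -> C) : (forall k, B (F k)) -> O (\prod_k F k).
  move=> BF; have Af k : A (u * F k).
    by have := (dilateP A (F k) ui0).1 (BF k); rewrite invrK.
  have := ideal_pow_prod m Af; rewrite Az => -[o Oo].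
  rewrite big_split /= prodr_const card_ord un => /(mulfI z0) <-.
  exact: Oo.
have Bal : B (u^-1 * a) by exists a.
have Bbe : B (u^-1 * b) by exists b.
have B1 : 1 = i%:~R * (u^-1 * a * (u^-1 * a)^*) + j%:~R * (u^-1 * b * (u^-1 * b)^*) +
    t%:~R * (u^-1 * a * (u^-1 * b)^* + u^-1 * b * (u^-1 * a)^*).
  transitivity (g%:~R / g%:~R : C); first by rewrite mulfV.
  rewrite [X in X / _]gE -uu !conjCM !conjCV; field; by rewrite cu0 u0.
exists (block_mx U 0 0 (cadj (\adj U))).
  exact: (construction_Delta sB BU dU BB Bn Bal Bbe B1).
rewrite /class_of_mx (construction_ideal sB BU dU BB Bn Bal Bbe B1) XA.
apply: module_class_dilate => //.
by apply: subset_trans cA _; exact: ringO_imquad.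
Qed.

End Surjectivity.

Lemma class_of_mx_surj (R : realType) (m n : nat) (d : int) :
  (0 < m)%N -> is_discriminant R m d -> (0 < n)%N ->
  set_surj (Delta R m n) (class_torsion R m n) (@class_of_mx R m n).
Proof. by case: n => // n m0 hd _; exact: (@class_of_mx_surj_succ _ _ n d m0 hd). Qed.

(** * The quotient group *)

Lemma numClosed_prim_root (F : numClosedFieldType) n : (0 < n)%N ->
  exists z : F, n.-primitive_root z.
Proof.
move=> n0; have [r Dp] := closed_field_poly_normal ('X^n - 1 : {poly F}).
rewrite (monicP _) ?monicXnsubC // scale1r in Dp.
have rn1 : all n.-unity_root r by apply/allP => z; rewrite -root_prod_XsubC -Dp.
have sz_r : (n < (size r).+1)%N by rewrite -(size_prod_XsubC r id) -Dp size_XnsubC.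
have [|z] := hasP (has_prim_root n0 rn1 _ sz_r); last by exists z.
by rewrite -separable_prod_XsubC -Dp separable_Xn_sub_1 // pnatr_eq0 -lt0n.
Qed.

Lemma unity_roots_cyclic (F : numClosedFieldType) (gT : finGroupType) (G : {group gT}) n :
  cyclic G -> #|G| = n ->
  exists L : F -> gT,
    [/\ forall x, x ^+ n = 1 -> L x \in G,
        forall x y, x ^+ n = 1 -> y ^+ n = 1 -> L (x * y) = (L x * L y)%g,
        forall x y, x ^+ n = 1 -> y ^+ n = 1 -> L x = L y -> x = y &
        forall c, c \in G -> exists2 x, x ^+ n = 1 & L x = c].
Proof.
move=> /cyclicP[g Gg] Gn; have n0 : (0 < n)%N by rewrite -Gn cardG_gt0.
have og : #[g]%g = n by rewrite -Gn /order -Gg.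
have [z zn] := numClosed_prim_root F n0.
(* Discrete logarithm to the base z; the value 0 off the roots of unity is a dummy. *)
pose log x := if pselect (exists i : nat, x = z ^+ i) is left e then projT1 (cid e) else 0%N.
have logE x : x ^+ n = 1 -> x = z ^+ log x.
  move=> xn; rewrite /log; case: pselect => [e|[]]; first by case: (cid e).
  by have [i ->] := prim_rootP zn xn; exists i.
have eqlog i j : (z ^+ i == z ^+ j) = ((g ^+ i)%g == (g ^+ j)%g).
  by rewrite (eq_prim_root_expr zn) eq_expg_mod_order og.
exists (fun x => (g ^+ log x)%g); split.
- by move=> x _; rewrite Gg mem_cycle.
- move=> x y xn yn; apply/eqP; rewrite -expgD -eqlog exprD -!logE //.
  by rewrite exprMn xn yn mulr1.
- by move=> x y xn yn /eqP; rewrite -eqlog -!logE // => /eqP.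
- rewrite Gg => c /cycleP[i ->]; exists (z ^+ i).
    by rewrite -exprM mulnC exprM (prim_expr_order zn) expr1n.
  apply/eqP; rewrite -eqlog -logE //.
  by rewrite -exprM mulnC exprM (prim_expr_order zn) expr1n.
Qed.

(** * A complement to the scalars modulo Gamma *)

Section Quotient.

Variables (R : realType) (m n : nat) (d : int).
Hypotheses (m_gt0 : (0 < m)%N) (hd : is_discriminant R m d) (n_gt0 : (0 < n)%N).
Hypotheses (d3 : d <> -3) (d4 : d <> -4).
Local Notation C := (Cplx R).
Local Notation O := (@ringO R m).
Local Notation SU := (SU R n).
Local Notation Gamma := (hermitian_modular R m n).
Local Notation good := (@good R m n).
Implicit Types (M N : 'M[C]_(n + n)) (H : set 'M[C]_(n + n)) (e : C).

Local Notation scal e := (e *: 1%:M : 'M[C]_(n + n)).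

Definition mxpow M k : 'M[C]_(n + n) := iter k (mulmx M) 1%:M.

Lemma mxpowS M k : mxpow M k.+1 = M *m mxpow M k. Proof. by []. Qed.

Lemma mxpowD M i j : mxpow M (i + j) = mxpow M i *m mxpow M j.
Proof.
elim: i => [|i IH]; first by rewrite add0n [mxpow M 0]/mxpow /= mul1mx.
by rewrite addSn !mxpowS IH mulmxA.
Qed.

Lemma mxpowM M i j : mxpow M (i * j) = mxpow (mxpow M i) j.
Proof. by elim: j => [|j IH]; rewrite ?muln0 // mulnS mxpowD IH. Qed.

Lemma mxpowZ e M k : mxpow (e *: M) k = e ^+ k *: mxpow M k.
Proof.
elim: k => [|k IH]; first by rewrite expr0 scale1r.
by rewrite !mxpowS IH -scalemxAl -scalemxAr scalerA exprS.
Qed.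

Lemma good_mxpow M k : good M -> good (mxpow M k).
Proof. by move=> gM; elim: k => [|k IH]; [exact: good1|rewrite mxpowS; exact: goodM]. Qed.

Lemma good_unitmx M : good M -> M \in unitmx.
Proof. by move=> [SM _ _]; exact: SU_unitmx. Qed.

(** The entries of M^n lie in the n-th power of the entry module, which is contained in O. *)
Lemma good_exponent M : good M -> Gamma (mxpow M n).
Proof.
move=> gM; split; first by case: (good_mxpow n gM).
have key k i j : ideal_pow m (entry_ideal m M) k (mxpow M k i j).
  elim: k i j => [|k IH] i j; first by rewrite /mxpow /= mxE; exact: ringO_nat.
  rewrite mxpowS mxE; apply: (@submodule_sum _ m); first exact: submodule_ideal_pow.
  by move=> l _; apply: mem_ideal_mul; [exact: mem_entry_ideal|exact: IH].
by move=> i j; apply: (ideal_pow_entry_integral gM); exact: key.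
Qed.

(** In M N M^-1 N^-1 every entry of M meets one of M^-1 and every entry of N one of N^-1, so all
    terms are products of integral pairs. *)
Lemma good_commutator M N : good M -> good N ->
  exists2 P, Gamma P & M *m N = P *m (N *m M).
Proof.
move=> gM gN; have uM := good_unitmx gM; have uN := good_unitmx gN.
have [SM pM _] := gM; have [SN pN _] := gN.
have [SV _ _] := goodV gM; have [SW _ _] := goodV gN.
exists (M *m N *m (invmx M *m invmx N)); last first.
  by rewrite -!mulmxA (mulKmx uN) (mulVmx uM) mulmx1.
split; first by apply: SUM; apply: SUM.
move=> i j; rewrite mxE; apply: ringO_sum => k _; rewrite !mxE big_distrlr /=.
apply: ringO_sum => a _; apply: ringO_sum => b _; rewrite mulrACA.
apply: ringOM; rewrite SU_invmxE // mulrC -!mulrA; do 2 apply: ringO_jsign;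
  rewrite mulrC; [exact: pM|exact: pN].
Qed.

Lemma Gamma_scal e : Gamma (scal e) -> e ^+ 2 = 1.
Proof.
move=> [[dete _] ie]; pose i0 : 'I_(n + n) := lshift n (Ordinal n_gt0).
have Oe : O e by have := ie i0 i0; rewrite mxE mxE eqxx mulr1.
have e2n : e ^+ (n + n) = 1 by move: dete; rewrite detZ det1 mulr1.
have e0 : e != 0.
  by apply/eqP => e0; move: e2n; rewrite e0 expr0n addn_eq0 gtn_eqF //= => /eqP; rewrite eq_sym oner_eq0.
have Oei : O e^-1.
  have -> : e^-1 = e ^+ (n + n).-1.
    by apply: (mulfI e0); rewrite mulfV // -exprS prednK ?e2n // addn_gt0 n_gt0.
  exact: ringOX.
by have [->|->] := ringO_unit m_gt0 hd d3 d4 Oe Oei e0; rewrite ?sqrrN expr1n.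
Qed.

Lemma Gamma1 : Gamma 1%:M.
Proof. by split; [exact: SU1|move=> i j; rewrite mxE; exact: ringO_nat]. Qed.

Lemma GammaM M N : Gamma M -> Gamma N -> Gamma (M *m N).
Proof.
move=> [SM iM] [SN iN]; split; first exact: SUM.
by move=> i j; rewrite mxE; apply: ringO_sum => k _; exact: ringOM.
Qed.

Lemma GammaV M : Gamma M -> Gamma (invmx M).
Proof.
move=> [SM iM]; split; first exact: SUV.
move=> i j; rewrite SU_invmxE // -mulrA; do 2 apply: ringO_jsign.
by apply: ringO_conj; exact: iM.
Qed.

Lemma Gamma_sign e M : e ^+ 2 = 1 -> Gamma M -> Gamma (e *: M).
Proof.
move=> e2 [SM iM]; split; first by apply: SUZ => //; rewrite exprM e2 expr1n.
move=> i j; rewrite mxE; apply: ringOM => //.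
by move/eqP: e2; rewrite sqrf_eq1 => /orP[]/eqP ->; [exact: ringO1|apply: ringON; exact: ringO1].
Qed.

(** Groups between Gamma and Delta that meet the scalars in 1 and -1 at most; a maximal one is a
    complement to the scalars modulo Gamma. *)
Record scalar_free H : Prop := ScalarFree {
  scalar_free_Gamma : Gamma `<=` H;
  scalar_free_good : H `<=` good;
  scalar_freeM : forall M N, H M -> H N -> H (M *m N);
  scalar_freeV : forall M, H M -> H (invmx M);
  scalar_free_scal : forall e, H (scal e) -> e ^+ 2 = 1 }.

Lemma scalar_free_GammaP : scalar_free Gamma.
Proof.
split=> //; [by move=> M; exact: good_Gamma|exact: GammaM|exact: GammaV|exact: Gamma_scal].
Qed.

Lemma exists_maximal_scalar_free : exists2 H, scalar_free H &
  forall H', scalar_free H' -> H `<=` H' -> H' `<=` H.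
Proof.
(* Adjoining Gamma to X makes the property survive the empty chain, whose union is empty. *)
have [|A [PA maxA]] := @Zorn_bigcup _ (fun X : set 'M[C]_(n + n) => scalar_free (X `|` Gamma)).
  move=> F FP tot; set S := _ `|` Gamma.
  have pick1 M : S M -> exists H, [/\ scalar_free H, H `<=` S & H M].
    move=> [[X FX XM]|GM]; last by exists Gamma; split=> //; [exact: scalar_free_GammaP|move=> N; right].
    exists (X `|` Gamma); split; [exact: FP| |by left].
    by move=> N [XN|GN]; [left; exists X|right].
  have pick2 M N : S M -> S N -> exists H, [/\ scalar_free H, H `<=` S, H M & H N].
    have sub X : F X -> X `|` Gamma `<=` S.
      by move=> FX P [XP|GP]; [left; exists X|right].
    move=> [[X FX XM]|GM] [[Y FY YN]|GN].
    - have [XY|YX] := tot _ _ FX FY.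
        exists (Y `|` Gamma); split; [exact: FP|exact: sub|by left; exact: XY|by left].
      exists (X `|` Gamma); split; [exact: FP|exact: sub|by left|by left; exact: YX].
    - by exists (X `|` Gamma); split; [exact: FP|exact: sub|left|right].
    - by exists (Y `|` Gamma); split; [exact: FP|exact: sub|right|left].
    - by exists Gamma; split=> //; [exact: scalar_free_GammaP|move=> P; right].
  split.
  - by move=> M GM; right.
  - by move=> M /pick1[H [[_ h _ _ _] _ /h]].
  - by move=> M N SM SN; have [H [[_ _ h _ _] HS HM HN]] := pick2 _ _ SM SN; apply: HS; exact: h.
  - by move=> M SM; have [H [[_ _ _ h _] HS HM]] := pick1 _ SM; apply: HS; exact: h.
  - by move=> e /pick1[H [[_ _ _ _ h] _ /h]].
exists (A `|` Gamma) => // H' QH' AH'.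
have AsubH' : A `<=` H' by move=> M AM; apply: AH'; left.
apply: contrapT => nH'; apply: (maxA H').
  by split=> // H'A; apply: nH' => M /H'A; left.
suff -> : H' `|` Gamma = H' by [].
by apply/seteqP; split=> M; [case=> // /(scalar_free_Gamma QH')|left].
Qed.

Section Complement.

Variable H : set 'M[C]_(n + n).
Hypotheses (QH : scalar_free H)
  (maxH : forall H', scalar_free H' -> H `<=` H' -> H' `<=` H).

Let HM := scalar_freeM QH.
Let HV := scalar_freeV QH.

Lemma mxpow_mem M k : H M -> H (mxpow M k).
Proof.
move=> hM; elim: k => [|k IH]; first by apply: (scalar_free_Gamma QH); exact: Gamma1.
by rewrite mxpowS; exact: HM.
Qed.

(* An n-torsion abelian group splits off any cyclic subgroup of order n: if   *)
(* M^k is the first power in H up to a scalar zeta, a k-th root of zeta       *)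
(* corrects M so that adjoining it to H creates no new scalars.               *)
Lemma complement_scalar M : good M ->
  exists2 e, e ^+ (2 * n) = 1 & H (e *: M).
Proof.
move=> gM; have uM := good_unitmx gM.
have n20 : (0 < 2 * n)%N by rewrite muln_gt0.
have root0 e : e ^+ (2 * n) = 1 -> e != 0.
  move=> e1; apply/eqP => e0; move: e1; rewrite e0 expr0n gtn_eqF // => /eqP.
  by rewrite eq_sym oner_eq0.
(* The exponents satisfying [S] are multiples of the least positive one, and n is among them. *)
pose S k := exists2 e, e ^+ (2 * n) = 1 & H (e *: mxpow M k).
have uMk k : mxpow M k \in unitmx by exact/good_unitmx/good_mxpow.
have Sn : S n.
  by exists 1; rewrite ?expr1n // scale1r; apply: (scalar_free_Gamma QH); exact: good_exponent.
have SB i j : S i -> S (i + j)%N -> S j.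
  move=> [e e1 He] [f f1 Hf]; exists (e^-1 * f).
    by rewrite exprMn exprVn e1 f1 invr1 mulr1.
  have -> : (e^-1 * f) *: mxpow M j = invmx (e *: mxpow M i) *m (f *: mxpow M (i + j)).
    have ue : e *: mxpow M i \in unitmx by rewrite unitmxZ // unitfE root0.
    by rewrite invmxZ // -scalemxAl -scalemxAr mxpowD mulKmx // scalerA.
  by apply: HM => //; exact: HV.
have exk : exists k, (0 < k)%N && `[< S k >].
  by exists n; rewrite n_gt0; apply/asboolP.
have [k /andP[k0 /asboolP Sk] kmin] := ex_minnP exk.
have Sdvd j : S j -> (k %| j)%N.
  elim/ltn_ind: j => j IH Sj; have [jk|kj] := ltnP j k.
    have [-> //|j0] := posnP j; move: jk; rewrite ltnNge kmin // j0.
    exact/asboolP.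
  rewrite -(subnKC kj) dvdn_addr //; apply: IH; first by rewrite ltn_subrL k0 (leq_trans k0 kj).
  by apply: (SB k) => //; rewrite subnKC.
have [ze ze1 Hze] := Sk; have /dvdnP[q nq] := Sdvd _ Sn.
(* With n = qk the scalar ze^q is a quotient of two elements of H. This makes the k-th root [ep] of
   ze a 2n-th root of unity. *)
have zq : (ze ^+ q) ^+ 2 = 1.
  apply: (scalar_free_scal QH).
  have -> : scal (ze ^+ q) = mxpow (ze *: mxpow M k) q *m invmx (mxpow M n).
    by rewrite mxpowZ -mxpowM mulnC -nq -scalemxAl mulmxV.
  by apply: HM; [exact: mxpow_mem|apply: HV; apply: (scalar_free_Gamma QH); exact: good_exponent].
pose ep := k.-root ze; have epk : ep ^+ k = ze by exact: rootCK.
have ep1 : ep ^+ (2 * n) = 1.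
  by rewrite nq mulnA mulnC exprM epk mulnC exprM.
exists ep => //; set M' := ep *: M.
have gM' : good M' by exact: goodZ.
have M'k : mxpow M' k = ze *: mxpow M k by rewrite mxpowZ epk.
have HM'k : H (mxpow M' k) by rewrite M'k.
have uM'i i : mxpow M' i \in unitmx by exact/good_unitmx/good_mxpow.
pose H' : set 'M[C]_(n + n) := [set N | exists h i, H h /\ N = h *m mxpow M' i].
have H1 : H 1%:M by apply: (scalar_free_Gamma QH); exact: Gamma1.
have HH' : H `<=` H' by move=> h Hh; exists h, 0%N; rewrite /mxpow /= mulmx1.
have H'M X Y : H' X -> H' Y -> H' (X *m Y).
  move=> [h [i [Hh ->]]] [h' [j [Hh' ->]]].
  have [P GP PE] := good_commutator (good_mxpow i gM') (scalar_free_good QH Hh').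
  exists (h *m P *m h'), (i + j)%N; split.
    by apply: HM => //; apply: HM => //; exact: (scalar_free_Gamma QH).
  by rewrite mxpowD !mulmxA -(mulmxA h) PE !mulmxA.
have QH' : scalar_free H'.
  split=> //.
  - by move=> N GN; apply: HH'; exact: (scalar_free_Gamma QH).
  - by move=> _ [h [i [Hh ->]]]; apply: goodM; [exact: (scalar_free_good QH)|exact: good_mxpow].
  - move=> _ [h [i [Hh ->]]].
    have uh : h \in unitmx by exact/good_unitmx/(scalar_free_good QH).
    have -> : invmx (h *m mxpow M' i) = invmx (mxpow M' i) *m invmx h.
      have uX : h *m mxpow M' i \in unitmx by rewrite unitmx_mul uh uM'i.
      apply: (can_inj (mulKmx uX)); rewrite mulmxV // !mulmxA -(mulmxA h) mulmxV //.
      by rewrite mulmx1 mulmxV.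
    apply: H'M; last by apply: HH'; exact: HV.
    exists (invmx (mxpow (mxpow M' k) i)), (k.-1 * i)%N; split.
      by apply: HV; exact: mxpow_mem.
    rewrite -mxpowM -{1}(prednK k0) mulSn; apply: (can_inj (mulKmx (uM'i (i + k.-1 * i)%N))).
    by rewrite mulKVmx // addnC mxpowD -mulmxA mulmxV // mulmx1.
  - move=> e [h [i [Hh he]]]; apply: (scalar_free_scal QH).
    have uh : h \in unitmx by exact/good_unitmx/(scalar_free_good QH).
    have ge : good (scal e) by rewrite he; apply: goodM; [exact: (scalar_free_good QH)|exact: good_mxpow].
    have e1 : e ^+ (2 * n) = 1.
      by have [[dete _] _ _] := ge; move: dete; rewrite detZ det1 mulr1 addnn mul2n.
    (* Solving for M'^i shows that it lies in H up to a scalar, so k divides i and M'^i is already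
       in H: no new scalar arises. *)
    have Si : S i.
      exists (e^-1 * ep ^+ i); first by rewrite exprMn exprVn e1 -exprM mulnC exprM ep1 expr1n invr1 mulr1.
      rewrite -scalerA -mxpowZ -/M' -[mxpow M' i](mulKmx uh) -he.
      by rewrite -scalemxAr mulmx1 scalerA mulVf ?root0 // scale1r; exact: HV.
    have /dvdnP[t it] := Sdvd _ Si.
    by rewrite he it mulnC mxpowM; apply: HM => //; exact: mxpow_mem.
apply: (maxH QH' HH'); exists 1%:M, 1%N.
by rewrite mul1mx mxpowS /mxpow /= mulmx1.
Qed.

Lemma complement_scalar_uniq M e f : good M -> e != 0 -> f != 0 ->
  H (e *: M) -> H (f *: M) -> e ^+ 2 = f ^+ 2.
Proof.
move=> gM e0 f0 He Hf; have uM := good_unitmx gM.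
have uf : f *: M \in unitmx by rewrite unitmxZ // unitfE.
have : H (scal (e / f)).
  have -> : scal (e / f) = (e *: M) *m invmx (f *: M).
    by rewrite invmxZ // -scalemxAl -scalemxAr mulmxV // scalerA.
  by apply: HM => //; exact: HV.
move=> /(scalar_free_scal QH); rewrite expr_div_n => /(congr1 ( *%R^~ (f ^+ 2))).
by rewrite divfK ?expf_neq0 // mul1r.
Qed.

End Complement.

End Quotient.

Section QuotientIsomorphism.

Variables (R : realType) (m n : nat) (d : int).
Hypotheses (m_gt0 : (0 < m)%N) (hd : is_discriminant R m d) (n_gt0 : (0 < n)%N).
Hypotheses (d3 : d <> -3) (d4 : d <> -4).
Local Notation C := (Cplx R).
Local Notation O := (@ringO R m).
Local Notation SU := (SU R n).
Local Notation Gamma := (hermitian_modular R m n).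
Local Notation Delta := (Delta R m n).
Local Notation good := (@good R m n).
Local Notation phi := (@class_of_mx R m n).
Implicit Types (M N : 'M[C]_(n + n)) (e : C).

Definition coset M : set 'M[C]_(n + n) := [set M *m N | N in Gamma].

Lemma class_of_mxZ e M : e != 0 -> phi (e *: M) = phi M.
Proof.
move=> e0; rewrite /class_of_mx entry_idealZ //; apply/seteqP; split=> [B|B].
  move=> [z [z0 -> BK]]; exists (z * e); rewrite -dilate_dilate mulf_neq0 //.
move=> [z [z0 -> BK]]; exists (z / e).
by rewrite dilate_dilate divfK // mulf_neq0 ?invr_eq0.
Qed.

Lemma class_of_mx_Gammar M N : good M -> Gamma N -> phi (M *m N) = phi M.
Proof.
move=> gM GN; rewrite /class_of_mx entry_idealM //; last exact: good_Gamma.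
rewrite (entry_ideal_Gamma n_gt0 GN); congr (module_class _ _).
have sI := submodule_entry_ideal m M; have [_ _ IZ] := sI.
apply/seteqP; split; first by apply: ideal_mul_min => // x y Ix Oy; rewrite mulrC; exact: IZ.
by move=> x Ix; rewrite -[x]mulr1; apply: mem_ideal_mul => //; exact: ringO1.
Qed.

Lemma cosetM M N : good M -> good N ->
  mx_set_mul (coset M) (coset N) = coset (M *m N).
Proof.
move=> gM gN; have uN := good_unitmx gN; have [SN _ _] := gN.
have [SW pW _] := goodV gN.
apply/seteqP; split.
  move=> _ [_ [P GP <-] [_ [Q GQ <-] <-]].
  exists (invmx N *m P *m N *m Q); last by rewrite !mulmxA mulmxK.
  apply: GammaM => //; have := Gamma_conj SW pW GP; by rewrite invmxK.
move=> _ [Q GQ <-]; exists M; first by exists 1%:M; [exact: Gamma1|rewrite mulmx1].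
by exists (N *m Q); [exists Q|rewrite mulmxA].
Qed.

Lemma coset_eq M N : M \in unitmx -> coset M = coset N -> exists2 P, Gamma P & N = M *m P.
Proof.
move=> uM MN; have : coset N N by exists 1%:M; [exact: Gamma1|rewrite mulmx1].
by rewrite -MN => -[P GP <-]; exists P.
Qed.

Lemma coset_mul M P : Gamma P -> coset (M *m P) = coset M.
Proof.
move=> GP; have uP : P \in unitmx by case: GP => SP _; exact: SU_unitmx.
apply/seteqP; split=> _ [Q GQ <-].
  by exists (P *m Q); [exact: GammaM|rewrite mulmxA].
exists (invmx P *m Q); first by apply: GammaM => //; exact: GammaV.
by rewrite !mulmxA mulmxK.
Qed.

(** The map sends the coset of M to (chi M, class of M), where chi M is the square of a root of
    unity that scales M into the complement H; this scalar is unique up to sign. *)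
Lemma Delta_quotient_isomorphic (gT : finGroupType) (G : {group gT}) :
  cyclic G -> #|G| = n ->
  isomorphic (mx_cosets Delta Gamma) (@mx_set_mul R (n + n))
    ([set x | x \in G] `*` class_torsion R m n)
    (prod_op (fun x y : gT => (x * y)%g) (class_mul m)).
Proof.
move=> cG Gn; have [L [LG LM Linj Lsurj]] := unity_roots_cyclic C cG Gn.
have n20 : (0 < 2 * n)%N by rewrite muln_gt0.
have root0 e : e ^+ (2 * n) = 1 -> e != 0.
  move=> e1; apply/eqP => e0; move: e1; rewrite e0 expr0n gtn_eqF // => /eqP.
  by rewrite eq_sym oner_eq0.
have [H QH maxH] := exists_maximal_scalar_free m_gt0 hd n_gt0 d3 d4.
have HM := scalar_freeM QH; have HV := scalar_freeV QH; have HG := scalar_free_Gamma QH.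
have [chi chiP] : exists chi : 'M[C]_(n + n) -> C,
    forall M, good M -> forall e, e ^+ (2 * n) = 1 -> H (e *: M) -> chi M = e ^+ 2.
  have ex M : exists c : C, good M -> forall e, e ^+ (2 * n) = 1 -> H (e *: M) -> c = e ^+ 2.
    have [gM|nM] := pselect (good M); last by exists 0.
    have [e e1 He] := complement_scalar n_gt0 QH maxH gM.
    exists (e ^+ 2) => _ f f1 Hf.
    exact: (complement_scalar_uniq QH gM (root0 _ e1) (root0 _ f1) He Hf).
  by have [chi h] := choice ex; exists chi.
have ex M : good M -> exists2 e, e ^+ (2 * n) = 1 & H (e *: M).
  exact: (complement_scalar n_gt0 QH maxH).
have chi_root M : good M -> chi M ^+ n = 1.
  move=> gM; have [e e1 He] := ex _ gM.
  by rewrite (chiP _ gM e) // -exprM.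
have chiM M N : good M -> good N -> chi (M *m N) = chi M * chi N.
  move=> gM gN; have [e e1 He] := ex _ gM; have [f f1 Hf] := ex _ gN.
  rewrite (chiP _ gM e) // (chiP _ gN f) // -exprMn; apply: chiP.
  - exact: goodM.
  - by rewrite exprMn e1 f1 mulr1.
  - by rewrite -scalerA scalemxAr scalemxAl; exact: HM.
have chiH M : H M -> chi M = 1.
  move=> hM; rewrite (chiP M (scalar_free_good QH hM) 1) ?expr1n //.
  by rewrite scale1r.
(* A chosen representative, with the dummy 1 on sets that are not cosets; [fE] shows independence of
   the choice. *)
pose rep X : 'M[C]_(n + n) := if pselect (exists M, good M /\ X = coset M) is left e
  then projT1 (cid e) else 1%:M.
pose f X : gT * set (set C) := (L (chi (rep X)), phi (rep X)).
have fE M : good M -> f (coset M) = (L (chi M), phi M).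
  move=> gM; rewrite /f /rep; case: pselect => [e|[]]; last by exists M.
  case: (cid e) => N [/= gN MN].
  have [P GP ->] := coset_eq (good_unitmx gN) (esym MN).
  rewrite chiM //; last exact: good_Gamma.
  by rewrite [chi P]chiH ?mulr1 ?class_of_mx_Gammar //; exact: HG.
have goodP M : Delta M -> good M by move/DeltaP; exact.
have DeltaG M : good M -> Delta M by move=> gM; exact/DeltaP.
exists f; split; first split.
- move=> _ [M /goodP gM <-]; rewrite -/(coset M) fE //; split=> /=.
    by apply: LG; exact: chi_root.
  exact/class_of_mx_torsion/DeltaG.
- move=> X Y /set_mem[M /goodP gM <-] /set_mem[N /goodP gN <-].
  rewrite -/(coset M) -/(coset N) !fE // => -[/Linj LMN pMN].
  have cMN : chi M = chi N by apply: LMN; exact: chi_root.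
  have gV := goodV gM; have gD : good (invmx M *m N) by exact: goodM.
  have NE : N = M *m (invmx M *m N) by rewrite mulKVmx // (good_unitmx gM).
  have cD : chi (invmx M *m N) = 1.
    have cM0 : chi M != 0.
      by apply/eqP => c0; have := chi_root _ gM; rewrite c0 expr0n gtn_eqF // => /eqP; rewrite eq_sym oner_eq0.
    by apply: (mulfI cM0); rewrite -chiM // -NE mulr1.
  have pD : phi (invmx M *m N) = class_one R m.
    rewrite class_of_mxM ?pMN //; [|exact: DeltaG|exact: DeltaG].
    rewrite -pMN -class_of_mxM //; [|exact: DeltaG|exact: DeltaG].
    rewrite mulVmx ?(good_unitmx gM) // -[1%:M]scale1r; apply: class_of_mxZ_Gamma => //.
      exact: oner_neq0.
    exact: Gamma1.
  have : [set M | Delta M /\ phi M = class_one R m] (invmx M *m N).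
    by split=> //; exact: DeltaG.
  rewrite (class_of_mx_kernel n_gt0 m_gt0 hd d3 d4) => -[e [P [e1 GP DE]]].
  (* Equal classes make M^-1 N a scalar e times an element of Gamma; equal values of chi then give
     e^2 = 1. *)
  rewrite NE coset_mul // DE; apply: Gamma_sign => //.
  have := chiP _ gD e^-1; rewrite exprVn e1 invr1 => /(_ erefl) h.
  have He : H (e^-1 *: (invmx M *m N)).
    by rewrite DE scalerA mulVf ?root0 // scale1r; exact: HG.
  by have := h He; rewrite cD exprVn => /(congr1 GRing.inv); rewrite invr1 invrK.
- move=> [c X] [/= /Lsurj[x xn Lx] /(class_of_mx_surj m_gt0 hd n_gt0)[M0 /goodP g0 pX]].
  have [e e1 He] := ex _ g0; have x0 : x != 0.
    by apply/eqP => x0; move: xn; rewrite x0 expr0n gtn_eqF // => /eqP; rewrite eq_sym oner_eq0.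
  pose y := sqrtC x; have y2 : y ^+ 2 = x by exact: sqrtCK.
  have y1 : y ^+ (2 * n) = 1 by rewrite exprM y2.
  (* Scaling leaves the class unchanged, and y carries M back to e M0 in H, so chi takes the
     prescribed value y^2 = x. *)
  pose M := y^-1 *: (e *: M0).
  have gM : good M by apply: goodZ => //; [rewrite exprVn y1 invr1|exact: goodZ].
  exists (coset M); first by exists M => //; exact: DeltaG.
  rewrite fE // (chiP _ gM y) //; last by rewrite scalerA mulfV ?root0 // scale1r.
  by rewrite y2 Lx !class_of_mxZ ?invr_eq0 ?root0 // pX.
- move=> _ _ [M /goodP gM <-] [N /goodP gN <-]; rewrite -/(coset M) -/(coset N).
  rewrite cosetM // !fE //; last exact: goodM.
  rewrite /prod_op /= chiM // LM ?chi_root // class_of_mxM //; exact: DeltaG.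
Qed.

End QuotientIsomorphism.

Theorem theorem1 (R : realType) (m n : nat) (d : int)
    (hn : (1 <= n)%N) (hm : squarefree m) (hd : is_discriminant R m d) :
  (* (a) *)
  (subgroup_of (SU R n) (Delta R m n) /\
   hermitian_modular R m n `<=` Delta R m n) /\
  (* (b) *)
  (exists phi : 'M[Cplx R]_(n + n) -> set (set (Cplx R)),
    [/\ forall (L : 'M[Cplx R]_(n + n)) (u : Cplx R), Delta_rep m L u ->
          phi (u^-1 *: L) = ideal_class m (entry_ideal m L),
        set_fun (Delta R m n) (class_torsion R m n) phi,
        is_hom (Delta R m n) mulmx (class_mul m) phi,
        set_surj (Delta R m n) (class_torsion R m n) phi &
        d <> -3 -> d <> -4 ->
          [set M | Delta R m n M /\ phi M = class_one R m] =
          [set N | exists (e : Cplx R) (M : 'M[Cplx R]_(n + n)),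
            [/\ e ^+ (2 * n) = 1, hermitian_modular R m n M & N = e *: M]]]) /\
  (* (c) *)
  [/\ maximal_discrete_extension (SU R n) (hermitian_modular R m n)
        (Delta R m n),
      Delta R m n = mx_normalizer (SU R n) (hermitian_modular R m n) &
      d <> -3 -> d <> -4 ->
        forall (gT : finGroupType) (Cn : {group gT}),
          cyclic Cn -> #|Cn| = n ->
          isomorphic
            (mx_cosets (Delta R m n) (hermitian_modular R m n))
            (@mx_set_mul R (n + n))
            ([set x | x \in Cn] `*` class_torsion R m n)
            (prod_op (fun x y : gT => (x * y)%g) (class_mul m))].

Proof.
have m0 : (0 < m)%N.
  rewrite lt0n; apply/eqP => m0.
  by have : 2 = 1%N by apply: hm; rewrite m0 dvdn0.
split; first by split; [exact: Delta_subgroup|exact: Gamma_sub_Delta].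
split.
  exists (@class_of_mx R m n); split.
  - by move=> L u; exact: class_of_rep.
  - by move=> M; exact: class_of_mx_torsion.
  - by move=> M N; exact: class_of_mxM.
  - exact: class_of_mx_surj m0 hd hn.
  - by move=> d3 d4; exact: class_of_mx_kernel m0 hd d3 d4.
split.
- split; [exact: Delta_subgroup|exact: Delta_discrete|exact: Gamma_sub_Delta|].
  by move=> E subE discE GE; exact: (discrete_sub_Delta m0 hd).
- exact: Delta_normalizer m0 hd hn.
- by move=> d3 d4 gT G; exact: Delta_quotient_isomorphic m0 hd hn d3 d4 gT G.
Qed.
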